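(* Let $(E,\mathcal{L},\mathcal{B})$ be a weakly left-resolving normal labelled space over the alphabet $\mathcal{A}$. Let $\mathcal{A}(E,\mathcal{L},\mathcal{B})$ be the associated commutative $C^*$-algebra and $(X(E,\mathcal{L},\mathcal{B}),\varphi)$ the associated $C^*$-correspondence over it, as defined in the context. Then there is a one-to-one correspondence between covariant representations of $(X(E,\mathcal{L},\mathcal{B}),\varphi)$ and representations of $(E,\mathcal{L},\mathcal{B})$ that takes a covariant representation $(\pi,t)$ of $(X(E,\mathcal{L},\mathcal{B}),\varphi)$ to the representation $\{\pi(\chi_A),\ t(e_a) : A\in\mathcal{B},\ a\in\mathcal{A}\}$ of $(E,\mathcal{L},\mathcal{B})$, and so the Cuntz-Pimsner algebra satisfies $\mathcal{O}_{(X(E,\mathcal{L},\mathcal{B}),\varphi)}\cong C^*(E,\mathcal{L},\mathcal{B})$.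
   Context: Labelled spaces. A directed graph $E=(E^0,E^1,r,s)$ consists of sets $E^0$ (vertices), $E^1$ (edges) and maps $r,s:E^1\to E^0$. A path of length $n\ge 1$ is a sequence $\lambda=\lambda_1\cdots\lambda_n$ of edges with $r(\lambda_i)=s(\lambda_{i+1})$; $s(\lambda)=s(\lambda_1)$, $r(\lambda)=r(\lambda_n)$; $E^n$ is the set of paths of length $n$, $E^*=\bigcup_{n\ge 1}E^n$; $E^0_{\text{sink}}=\{v\in E^0: s^{-1}(v)=\emptyset\}$. A labelled graph $(E,\mathcal{L})$ over a countable alphabet $\mathcal{A}$ is a directed graph with a map $\mathcal{L}:E^1\to\mathcal{A}$, assumed surjective, extended to paths by $\mathcal{L}(e_1\cdots e_n)=\mathcal{L}(e_1)\cdots\mathcal{L}(e_n)$; $\mathcal{L}^*(E)=\bigcup_{n\ge1}\mathcal{L}(E^n)$. For $\alpha\in\mathcal{L}^*(E)$ and $A\subseteq E^0$: $r(\alpha)=\{r(\lambda):\lambda\in E^*,\ \mathcal{L}(\lambda)=\alpha\}$, $r(A,\alpha)=\{r(\lambda):\lambda\in E^*,\ \mathcal{L}(\lambda)=\alpha,\ s(\lambda)\in A\}$, $\mathcal{L}(AE^1)=\{\mathcal{L}(e):e\in E^1,\ s(e)\in A\}$. A collection $\mathcal{B}\subseteq 2^{E^0}$ is accommodating for $(E,\mathcal{L})$ if $r(\alpha)\in\mathcal{B}$ and $r(A,\alpha)\in\mathcal{B}$ for all $A\in\mathcal{B}$, $\alpha\in\mathcal{L}^*(E)$, and $\mathcal{B}$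 is closed under finite intersections and unions. A labelled space is a triple $(E,\mathcal{L},\mathcal{B})$ with $\mathcal{B}$ accommodating; it is normal if $\mathcal{B}$ is also closed under relative complements; it is weakly left-resolving if $r(A,\alpha)\cap r(B,\alpha)=r(A\cap B,\alpha)$ for all $A,B\in\mathcal{B}$, $\alpha\in\mathcal{L}^*(E)$. Representations. A representation of a weakly left-resolving normal labelled space $(E,\mathcal{L},\mathcal{B})$ in a $C^*$-algebra consists of projections $\{p_A:A\in\mathcal{B}\}$ and partial isometries $\{s_a:a\in\mathcal{A}\}$ such that: (i) $p_Ap_B=p_{A\cap B}$ and $p_{A\cup B}=p_A+p_B-p_{A\cap B}$ for $A,B\in\mathcal{B}$, where $p_\emptyset=0$; (ii) $p_As_a=s_ap_{r(A,a)}$ for $a\in\mathcal{A}$, $A\in\mathcal{B}$; (iii) $s_a^*s_a=p_{r(a)}$, and $s_a^*s_b=0$ unless $a=b$; (iv) for $A\in\mathcal{B}$ with $\mathcal{L}(AE^1)$ finite and $A\cap B=\emptyset$ for all $B\in\mathcal{B}$ satisfying $B\subseteq E^0_{\text{sink}}$, $p_A=\sum_{a\in\mathcal{L}(AE^1)}s_ap_{r(A,a)}s_a^*$. $C^*(E,\mathcal{L},\mathcal{B})$ is the $C^*$-algebra generated by a universal representation of $(E,\mathcal{L},\mathcal{B})$. The correspondence. $\chi_A$ is the characteristic function of $A\subseteq E^0$, and $\mathcal{A}(E,\mathcal{L},\mathcal{B})$ is the $C^*$-subalgebra of the bounded functions on $E^0$ generated by $\{\chi_A:A\in\mathcal{B}\}$.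 For $a\in\mathcal{A}$, $X_a$ is the ideal of $\mathcal{A}(E,\mathcal{L},\mathcal{B})$ generated by $\chi_{r(a)}$, a right Hilbert $\mathcal{A}(E,\mathcal{L},\mathcal{B})$-module with $\langle f,g\rangle=f^*g$ and right action by multiplication. $X(E,\mathcal{L},\mathcal{B})=\bigoplus_{a\in\mathcal{A}}X_a$ (Hilbert module direct sum). $\phi_a:\mathcal{A}(E,\mathcal{L},\mathcal{B})\to X_a$ is the unique $*$-homomorphism with $\phi_a(\chi_A)=\chi_{r(A,a)}$ for $A\in\mathcal{B}$, and the left action is $\varphi(f)(x_a)_{a\in\mathcal{A}}=(\phi_a(f)x_a)_{a\in\mathcal{A}}$. For $a\in\mathcal{A}$, $e_a=(\delta_{a,b}\chi_{r(a)})_{b\in\mathcal{A}}\in X(E,\mathcal{L},\mathcal{B})$. Covariant representations and Cuntz-Pimsner algebra (in the sense of Katsura). Write $X=X(E,\mathcal{L},\mathcal{B})$, let $\mathscr{K}(X)$ be the generalized compact operators on $X$, spanned (densely) by $\theta_{x,y}:z\mapsto x\langle y,z\rangle$, and $J_{(X,\varphi)}=\varphi^{-1}(\mathscr{K}(X))\cap\ker(\varphi)^\perp$. A representation of $(X,\varphi)$ on a $C^*$-algebra $\mathcal{X}$ is a pair $(\pi,t)$ with $\pi:\mathcal{A}(E,\mathcal{L},\mathcal{B})\to\mathcal{X}$ a $*$-homomorphism and $t:X\to\mathcal{X}$ linear with $t(x)^*t(y)=\pi(\langle x,y\rangle)$ and $\pi(f)t(x)=t(\varphi(f)x)$. It induces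 a $*$-homomorphism $\psi_t:\mathscr{K}(X)\to\mathcal{X}$, $\psi_t(\theta_{x,y})=t(x)t(y)^*$. It is covariant if $\pi(f)=\psi_t(\varphi(f))$ for all $f\in J_{(X,\varphi)}$. $\mathcal{O}_{(X,\varphi)}$ is the $C^*$-algebra generated by a universal covariant representation of $(X,\varphi)$. *)

(* Defs.v *)
From HB Require Import structures.
From mathcomp Require Import all_boot all_order all_algebra finmap.
From mathcomp Require Import all_classical all_reals topology normedtype.
From mathcomp Require Import complex.
From mathcomp.analysis.showcase Require Import summability.
From mathcomp Require Import ring lra.

Set Implicit Arguments.
Unset Strict Implicit.
Unset Printing Implicit Defensive.

Import Order.TTheory GRing.Theory Num.Theory numFieldNormedType.Exports.

Local Open Scope classical_set_scope.
Local Open Scope ring_scope.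

(* C*-algebras are not assumed unital, so the product cannot come from the
   (unital) ring structures of the library. *)
HB.mixin Record CompleteNormedModule_isCstarAlgebra (R : realType) A
    & CompleteNormedModule R[i] A := {
  cmul : A -> A -> A;
  star : A -> A;
  cmulA : associative cmul;
  cmulDl : left_distributive cmul +%R;
  cmulDr : right_distributive cmul +%R;
  cmulZl : forall (c : R[i]) (x y : A), cmul (c *: x) y = c *: cmul x y;
  cmulZr : forall (c : R[i]) (x y : A), cmul x (c *: y) = c *: cmul x y;
  starK : involutive star;
  starD : {morph star : x y / x + y};
  starZ : forall (c : R[i]) (x : A), star (c *: x) = c^* *: star x;
  starM : forall x y : A, star (cmul x y) = cmul (star y) (star x);
  cmul_norm : forall x y : A, `|cmul x y| <= `|x| * `|y|;
  cstar_norm : forall x : A, `|cmul (star x) x| = `|x| ^+ 2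
}.

#[short(type="cstarAlgType")]
HB.structure Definition CstarAlgebra (R : realType) :=
  {A of CompleteNormedModule_isCstarAlgebra R A & CompleteNormedModule R[i] A}.

Notation "x ** y" := (cmul x y) (at level 40, left associativity) : ring_scope.

Record star_hom (R : realType) (A B : cstarAlgType R) (f : A -> B) : Prop := {
  star_homD : forall x y, f (x + y) = f x + f y;
  star_homZ : forall (c : R[i]) x, f (c *: x) = c *: f x;
  star_homM : forall x y, f (x ** y) = f x ** f y;
  star_homS : forall x, f (star x) = star (f x)
}.

Definition cstar_isomorphic (R : realType) (A B : cstarAlgType R) : Prop :=
  exists2 f : A -> B, star_hom f & bijective f.

Record cstar_subalg (R : realType) (A : cstarAlgType R) (D : set A) : Prop := {
  csub0 : D 0;
  csubD : forall x y, D x -> D y -> D (x + y);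
  csubZ : forall (c : R[i]) x, D x -> D (c *: x);
  csubM : forall x y, D x -> D y -> D (x ** y);
  csubS : forall x, D x -> D (star x);
  csub_closed : closed D
}.

Definition cstar_gen (R : realType) (A : cstarAlgType R) (S : set A) : set A :=
  smallest (@cstar_subalg R A) S.

Record closed_ideal (R : realType) (A : cstarAlgType R) (I : set A) : Prop := {
  cideal0 : I 0;
  cidealD : forall x y, I x -> I y -> I (x + y);
  cidealZ : forall (c : R[i]) x, I x -> I (c *: x);
  cidealMl : forall a x, I x -> I (a ** x);
  cidealMr : forall x a, I x -> I (x ** a);
  cideal_closed : closed I
}.

Definition ideal_gen (R : realType) (A : cstarAlgType R) (S : set A) : set A :=
  smallest (@closed_ideal R A) S.

HB.mixin Record CompleteNormedModule_isHilbertModule (R : realType)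
    (A : cstarAlgType R) X & CompleteNormedModule R[i] X := {
  ract : X -> A -> X;
  ip : X -> X -> A;
  ractDl : forall x y a, ract (x + y) a = ract x a + ract y a;
  ractDr : forall x a b, ract x (a + b) = ract x a + ract x b;
  ractM : forall x a b, ract x (a ** b) = ract (ract x a) b;
  ractZl : forall (c : R[i]) x a, ract (c *: x) a = c *: ract x a;
  ractZr : forall (c : R[i]) x a, ract x (c *: a) = c *: ract x a;
  ipDr : forall x y z, ip x (y + z) = ip x y + ip x z;
  ipZr : forall (c : R[i]) x y, ip x (c *: y) = c *: ip x y;
  ip_ract : forall x y a, ip x (ract y a) = ip x y ** a;
  ip_star : forall x y, star (ip x y) = ip y x;
  ip_pos : forall x, exists b, ip x x = star b ** b;
  ip_norm : forall x, `|x| ^+ 2 = `|ip x x|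
}.

#[short(type="hilbertModType")]
HB.structure Definition HilbertModule (R : realType) (A : cstarAlgType R) :=
  {X of CompleteNormedModule_isHilbertModule R A X
      & CompleteNormedModule R[i] X}.

(* The left action is a *-homomorphism from A to the adjointable operators:
   [lact (star a)] is the adjoint of [lact a]; adjointability already implies
   that [lact a] is linear, bounded and commutes with the right action. *)
HB.mixin Record HilbertModule_isCorrespondence (R : realType)
    (A : cstarAlgType R) X & HilbertModule R A X := {
  lact : A -> X -> X;
  lactD : forall a b x, lact (a + b) x = lact a x + lact b x;
  lactZ : forall (c : R[i]) a x, lact (c *: a) x = c *: lact a x;
  lactM : forall a b x, lact (a ** b) x = lact a (lact b x);
  lact_adj : forall a (x y : X), ip (lact a x) y = ip x (lact (star a) y) :> A
}.

#[short(type="corrType")]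
HB.structure Definition Correspondence (R : realType) (A : cstarAlgType R) :=
  {X of HilbertModule_isCorrespondence R A X & HilbertModule R A X}.

Section CorrespondenceRepresentations.
Variables (R : realType) (A : cstarAlgType R) (X : corrType A).

Definition theta (x y : X) : X -> X := fun z => ract x (ip y z).

Definition finite_rank (T : X -> X) : Prop :=
  exists s : seq (X * X), forall z, T z = \sum_(p <- s) theta p.1 p.2 z.

(* The closure of the finite-rank operators for the operator norm. A map that
   satisfies this is automatically linear and adjointable. *)
Definition compacts (T : X -> X) : Prop :=
  forall e : R[i], 0 < e ->
    exists2 S, finite_rank S & forall z, `|T z - S z| <= e * `|z|.

Definition katsura_ideal : set A :=
  [set f | compacts (lact f) /\
     forall g : A, (forall x : X, lact g x = 0) -> f ** g = 0].

Variable Y : cstarAlgType R.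

Record corr_rep (pi : A -> Y) (t : X -> Y) : Prop := {
  rep_pi : star_hom pi;
  rep_tD : forall x y, t (x + y) = t x + t y;
  rep_tZ : forall (c : R[i]) x, t (c *: x) = c *: t x;
  rep_ip : forall x y, star (t x) ** t y = pi (ip x y);
  rep_lact : forall f x, pi f ** t x = t (lact f x)
}.

(* [psi] restricts to the *-homomorphism on the compact operators that is
   induced by [t]; its values on other maps are irrelevant. On the compact
   operators it is unique, since *-homomorphisms are continuous. *)
Record induced_hom (t : X -> Y) (psi : (X -> X) -> Y) : Prop := {
  inducedD : forall S T, compacts S -> compacts T ->
    psi (fun z => S z + T z) = psi S + psi T;
  inducedZ : forall (c : R[i]) T, compacts T ->
    psi (fun z => c *: T z) = c *: psi T;
  inducedM : forall S T, compacts S -> compacts T ->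
    psi (S \o T) = psi S ** psi T;
  inducedS : forall S T, compacts S -> compacts T ->
    (forall x y, ip (S x) y = ip x (T y) :> A) -> psi T = star (psi S);
  induced_theta : forall x y, psi (theta x y) = t x ** star (t y)
}.

Definition covariant_rep (pi : A -> Y) (t : X -> Y) : Prop :=
  corr_rep pi t /\
  exists2 psi, induced_hom t psi &
    forall f, katsura_ideal f -> pi f = psi (lact f).

End CorrespondenceRepresentations.

(* The universal property determines [O] up to *-isomorphism. *)
Record is_cuntz_pimsner (R : realType) (A : cstarAlgType R) (X : corrType A)
    (O : cstarAlgType R) (pi : A -> O) (t : X -> O) : Prop := {
  cp_rep : covariant_rep pi t;
  cp_gen : cstar_gen (range pi `|` range t) = setT;
  cp_univ : forall (Y : cstarAlgType R) (pi' : A -> Y) (t' : X -> Y),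
    covariant_rep pi' t' ->
    exists2 rho : O -> Y, star_hom rho & pi' = rho \o pi /\ t' = rho \o t
}.

Section RealNorm.
Variable R : realType.
Implicit Types (V : normedModType R[i]).
Local Open Scope complex_scope.

Definition nrm V (x : V) : R := complex.Re `|x|.

Lemma ge0_real (z : R[i]) : 0 <= z -> z = (complex.Re z)%:C.
Proof. by case: z => a b; rewrite lecE /= => /andP[/eqP-> _]. Qed.

Lemma nrmE V (x : V) : `|x| = (nrm x)%:C.
Proof. exact/ge0_real/normr_ge0. Qed.

Lemma ler_complex (x y : R) : (x%:C <= y%:C) = (x <= y).
Proof. by rewrite lecE /= eqxx. Qed.

Lemma ltr_complex (x y : R) : (x%:C < y%:C) = (x < y).
Proof. by rewrite ltcE /= eqxx. Qed.

Lemma nrm_ge0 V (x : V) : 0 <= nrm x.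
Proof. by rewrite -ler_complex -nrmE normr_ge0. Qed.

Lemma nrmD V (x y : V) : nrm (x + y) <= nrm x + nrm y.
Proof. by rewrite -ler_complex rmorphD /= -!nrmE ler_normD. Qed.

Lemma nrmN V (x : V) : nrm (- x) = nrm x.
Proof. by rewrite /nrm normrN. Qed.

Lemma nrmB V (x y : V) : nrm (x - y) = nrm (y - x).
Proof. by rewrite -nrmN opprB. Qed.

Lemma nrm0 V : nrm (0 : V) = 0.
Proof. by rewrite /nrm normr0. Qed.

Lemma nrm0_eq0 V (x : V) : nrm x = 0 -> x = 0.
Proof. by move=> h; apply/normr0_eq0; rewrite nrmE h. Qed.

Lemma nrmZ V (c : R[i]) (x : V) : nrm (c *: x) = nrm (c : R[i]^o) * nrm x.
Proof.
apply: (@complexI R); rewrite rmorphM /= -!nrmE normrZ.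
by congr (_ * _).
Qed.

Lemma nrm_gt0P (e : R[i]) : 0 < e -> exists2 d : R, 0 < d & e = d%:C.
Proof.
move=> e0; exists (complex.Re e); last exact/ge0_real/ltW.
by rewrite -ltr_complex -(ge0_real (ltW e0)).
Qed.

Lemma cvg_nrmP V T (F : set_system T) (FF : Filter F) (f : T -> V) (l : V) :
  f x @[x --> F] --> l <->
  forall e : R, 0 < e -> F [set x | nrm (l - f x) <= e].
Proof.
rewrite cvgrPdist_le; split=> h e e0.
  have /h : 0 < e%:C by rewrite ltr_complex.
  by apply: filterS => x; rewrite nrmE ler_complex.
have [d d0 ->] := nrm_gt0P e0.
by apply: filterS (h _ d0) => x /=; rewrite nrmE ler_complex.
Qed.

Lemma closed_nrmP V (D : set V) : closed D <->
  forall x, (forall e : R, 0 < e -> exists2 y, D y & nrm (x - y) <= e) -> D x.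
Proof.
split=> [cD x h|h x cx].
  apply: cD => B /nbhs_ballP[e /= e0].
  have [d d0 ->] := nrm_gt0P e0 => sB.
  have d20 : 0 < d / 2 by rewrite divr_gt0.
  have [y Dy yd] := h _ d20; exists y; split=> //; apply: sB.
  rewrite -ball_normE /ball_/= nrmE ltr_complex; apply: le_lt_trans yd _.
  by rewrite ltr_pdivrMr// mulr_natr mulr2n ltrDl.
apply: h => e e0.
have /cx[y [Dy]] : nbhs x (ball x e%:C) by apply: nbhsx_ballx; rewrite ltr_complex.
by rewrite -ball_normE /ball_ /= nrmE ltr_complex => /ltW; exists y.
Qed.

Lemma cauchy_nrmP V (F : set_system V) (FF : ProperFilter F) : cauchy F <->
  forall e : R, 0 < e -> exists x, F [set y | nrm (x - y) <= e].
Proof.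
rewrite cauchyP; split=> h e e0.
  have [|x Fx] := h e%:C; first by rewrite ltr_complex.
  exists x; apply: filterS Fx => y.
  by rewrite -ball_normE /ball_ /= nrmE ltr_complex => /ltW.
have [d d0 ->] := nrm_gt0P e0.
have d20 : 0 < d / 2 by rewrite divr_gt0.
have [x Fx] := h _ d20; exists x; apply: filterS Fx => y /= yd.
rewrite -ball_normE /ball_ /= nrmE ltr_complex; apply: le_lt_trans yd _.
by rewrite ltr_pdivrMr// mulr_natr mulr2n ltrDl.
Qed.

Lemma cvgF_nrmP V (F : set_system V) (FF : Filter F) (l : V) :
  F --> l <-> forall e : R, 0 < e -> F [set y | nrm (l - y) <= e].
Proof. exact: (@cvg_nrmP V V F FF id l). Qed.

Definition cabs (z : R[i]) : R := nrm (z : R[i]^o).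

Lemma cabsE z : `|z| = (cabs z)%:C.
Proof. exact: (@nrmE R[i]^o). Qed.

Lemma cabs_ge0 z : 0 <= cabs z. Proof. exact: nrm_ge0. Qed.

Lemma cabsM z w : cabs (z * w) = cabs z * cabs w.
Proof. exact: (@nrmZ R[i]^o). Qed.

Lemma cabsD z w : cabs (z + w) <= cabs z + cabs w.
Proof. exact: (@nrmD R[i]^o). Qed.

Lemma cabsB z w : cabs (z - w) = cabs (w - z).
Proof. exact: (@nrmB R[i]^o). Qed.

Lemma cabsN z : cabs (- z) = cabs z.
Proof. exact: (@nrmN R[i]^o). Qed.

Lemma cabs0 : cabs 0 = 0. Proof. exact: (@nrm0 R[i]^o). Qed.

Lemma cabs1 : cabs 1 = 1. Proof. by rewrite /cabs /nrm normr1. Qed.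

Lemma cabs0_eq0 z : cabs z = 0 -> z = 0.
Proof. exact: (@nrm0_eq0 R[i]^o). Qed.

Lemma cabsJ z : cabs z^* = cabs z.
Proof.
by apply: complexI; rewrite -!cabsE; exact: (@norm_conjC R[i]).
Qed.

Lemma cabs_sqr z : z^* * z = (cabs z ^+ 2)%:C.
Proof. by rewrite mulrC rmorphXn /= -cabsE; exact/esym/(@normCK R[i]). Qed.

Lemma cabs_real (x : R) : 0 <= x -> cabs x%:C = x.
Proof.
by move=> x0; apply: complexI; rewrite -cabsE ger0_norm// -[0]/(0%:C) ler_complex.
Qed.

Lemma cabs_sq_ReIm z : cabs z ^+ 2 = complex.Re z ^+ 2 + complex.Im z ^+ 2.
Proof.
by apply: complexI; rewrite -cabs_sqr; case: z => a b; simpc; congr (_ +i* _); ring.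
Qed.

Lemma Re_cabs z : `|complex.Re z| <= cabs z.
Proof.
rewrite -(@ler_pXn2r _ 2)// ?nnegrE ?cabs_ge0// cabs_sq_ReIm real_normK ?num_real//.
by rewrite lerDl sqr_ge0.
Qed.

Lemma Im_cabs z : `|complex.Im z| <= cabs z.
Proof.
rewrite -(@ler_pXn2r _ 2)// ?nnegrE ?cabs_ge0// cabs_sq_ReIm real_normK ?num_real//.
by rewrite lerDr sqr_ge0.
Qed.

Lemma cabs_le_ReIm z : cabs z <= `|complex.Re z| + `|complex.Im z|.
Proof.
rewrite -(@ler_pXn2r _ 2)// ?nnegrE ?cabs_ge0 ?addr_ge0//.
rewrite cabs_sq_ReIm sqrrD !real_normK ?num_real// lerD2r lerDl.
by rewrite mulrn_wge0 // mulr_ge0.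
Qed.

Lemma C_complete (F : set_system R[i]) (FF : ProperFilter F) :
  (forall e : R, 0 < e -> exists x, F [set y | cabs (x - y) <= e]) ->
  exists l, forall e : R, 0 < e -> F [set y | cabs (l - y) <= e].
Proof.
move=> Fc.
have key (p : R[i] -> R) : (forall z w, `|p z - p w| <= cabs (z - w)) ->
    exists a, forall e : R, 0 < e -> F [set y | `|a - p y| <= e].
  move=> hp.
  have : cvg (p @ F).
    apply/cauchy_cvgP/cauchyP => e e0.
    have e20 : 0 < e / 2 by rewrite divr_gt0.
    have [x Fx] := Fc _ e20; exists (p x).
    change (F [set y | ball (p x) e (p y)]); apply: filterS Fx => y /= h.
    rewrite -ball_normE /ball_ /=; move: (hp x y) => /le_lt_trans; apply.
    by apply: le_lt_trans h _; rewrite ltr_pdivrMr// mulr_natr mulr2n ltrDl.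
  move/cvg_ex => [a /cvgrPdist_le ha]; exists a => e e0; exact: ha.
have [|a ha] := key (@complex.Re R).
  by move=> [z1 z2] [w1 w2]; exact: (Re_cabs ((z1 +i* z2) - (w1 +i* w2))).
have [|b hb] := key (@complex.Im R).
  by move=> [z1 z2] [w1 w2]; exact: (Im_cabs ((z1 +i* z2) - (w1 +i* w2))).
exists (a +i* b) => e e0.
have e20 : 0 < e / 2 by rewrite divr_gt0.
apply: filterS2 (ha _ e20) (hb _ e20) => -[x y] /= h1 h2.
apply: le_trans (cabs_le_ReIm _) _ => /=.
by rewrite [e]splitr lerD.
Qed.

End RealNorm.

Section BoundedFunctions.
Variables (R : realType) (V : Type).
Local Open Scope complex_scope.

Record linfty := Linfty {
  lfun :> V -> R[i];
  lfun_bounded : exists M : R, forall v, cabs (lfun v) <= M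
}.

HB.instance Definition _ := gen_eqMixin linfty.
HB.instance Definition _ := gen_choiceMixin linfty.

Lemma linfty_ext (f g : linfty) : (forall v, f v = g v) -> f = g.
Proof.
case: f g => f Pf [g Pg] /= /funext fg; case: _ / fg Pg => Pg.
by congr Linfty; exact: Prop_irrelevance.
Qed.

Fact linfty0_subproof : exists M : R, forall v : V, cabs (0 : R[i]) <= M.
Proof. by exists 0 => _; rewrite cabs0. Qed.
Definition linfty0 := Linfty linfty0_subproof.

Fact linftyD_subproof (f g : linfty) :
  exists M : R, forall v, cabs (f v + g v) <= M.
Proof.
have [[M hM] [N hN]] := (lfun_bounded f, lfun_bounded g).
by exists (M + N) => v; apply: le_trans (cabsD _ _) _; rewrite lerD.
Qed.
Definition linftyD f g := Linfty (linftyD_subproof f g).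

Fact linftyN_subproof (f : linfty) : exists M : R, forall v, cabs (- f v) <= M.
Proof. by have [M hM] := lfun_bounded f; exists M => v; rewrite cabsN. Qed.
Definition linftyN f := Linfty (linftyN_subproof f).

Fact linftyM_subproof (f g : linfty) :
  exists M : R, forall v, cabs (f v * g v) <= M.
Proof.
have [[M hM] [N hN]] := (lfun_bounded f, lfun_bounded g).
by exists (M * N) => v; rewrite cabsM ler_pM ?cabs_ge0.
Qed.
Definition linftyM f g := Linfty (linftyM_subproof f g).

Fact linftyZ_subproof (c : R[i]) (f : linfty) :
  exists M : R, forall v, cabs (c * f v) <= M.
Proof.
have [M hM] := lfun_bounded f.
by exists (cabs c * M) => v; rewrite cabsM ler_wpM2l ?cabs_ge0.
Qed.
Definition linftyZ c f := Linfty (linftyZ_subproof c f).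

Fact linftyS_subproof (f : linfty) : exists M : R, forall v, cabs (f v)^* <= M.
Proof. by have [M hM] := lfun_bounded f; exists M => v; rewrite cabsJ. Qed.
Definition linftyS f := Linfty (linftyS_subproof f).

Fact linfty_addA : associative linftyD.
Proof. by move=> f g h; apply: linfty_ext => v /=; rewrite addrA. Qed.
Fact linfty_addC : commutative linftyD.
Proof. by move=> f g; apply: linfty_ext => v /=; rewrite addrC. Qed.
Fact linfty_add0 : left_id linfty0 linftyD.
Proof. by move=> f; apply: linfty_ext => v /=; rewrite add0r. Qed.
Fact linfty_addN : left_inverse linfty0 linftyN linftyD.
Proof. by move=> f; apply: linfty_ext => v /=; rewrite addNr. Qed.

HB.instance Definition _ := GRing.isZmodule.Build linfty
  linfty_addA linfty_addC linfty_add0 linfty_addN.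

Fact linfty_scaleA a b f : linftyZ a (linftyZ b f) = linftyZ (a * b) f.
Proof. by apply: linfty_ext => v /=; rewrite mulrA. Qed.
Fact linfty_scale1 : left_id 1 linftyZ.
Proof. by move=> f; apply: linfty_ext => v /=; rewrite mul1r. Qed.
Fact linfty_scaleDr : right_distributive linftyZ +%R.
Proof. by move=> a f g; apply: linfty_ext => v /=; rewrite mulrDr. Qed.
Fact linfty_scaleDl f : {morph linftyZ^~ f : a b / a + b}.
Proof. by move=> a b; apply: linfty_ext => v /=; rewrite mulrDl. Qed.

HB.instance Definition _ := GRing.Zmodule_isLmodule.Build R[i] linfty
  linfty_scaleA linfty_scale1 linfty_scaleDr linfty_scaleDl.

(* On an empty [V] this is [sup set0], which is 0. *)
Definition supnorm (f : linfty) : R := sup [set cabs (f v) | v in setT].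

Lemma le_supnorm (f : linfty) v : cabs (f v) <= supnorm f.
Proof.
apply: ub_le_sup; last by exists v.
by have [M hM] := lfun_bounded f; exists M => _ [w _ <-].
Qed.

Lemma supnorm_le (f : linfty) M :
  0 <= M -> (forall v, cabs (f v) <= M) -> supnorm f <= M.
Proof.
move=> M0 hM; rewrite /supnorm.
have [->|ne] := eqVneq [set cabs (f v) | v in setT] set0; first by rewrite sup0.
by apply: ge_sup; [exact/set0P | move=> _ [w _ <-]].
Qed.

Lemma supnorm_ge0 f : 0 <= supnorm f.
Proof.
have [|/set0P[x [v _ hx]]] := eqVneq [set cabs (f v) | v in setT] set0.
  by rewrite /supnorm => ->; rewrite sup0.
exact: le_trans (cabs_ge0 (f v)) (le_supnorm f v).
Qed.

Fact linfty_normD f g :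
  (supnorm (f + g))%:C <= (supnorm f)%:C + (supnorm g)%:C.
Proof.
rewrite -rmorphD ler_complex; apply: supnorm_le; first by rewrite addr_ge0 ?supnorm_ge0.
by move=> v; apply: le_trans (cabsD _ _) _; rewrite lerD ?le_supnorm.
Qed.

Fact linfty_normZ (c : R[i]) f : (supnorm (c *: f))%:C = `|c| * (supnorm f)%:C.
Proof.
rewrite cabsE -rmorphM; congr (_%:C); apply/eqP; rewrite eq_le.
apply/andP; split.
  apply: supnorm_le; first by rewrite mulr_ge0 ?supnorm_ge0 ?cabs_ge0.
  by move=> v; rewrite cabsM ler_wpM2l ?cabs_ge0 ?le_supnorm.
have [c0|c0] := eqVneq (cabs c) 0; first by rewrite c0 mul0r supnorm_ge0.
have cgt0 : 0 < cabs c by rewrite lt_def c0 cabs_ge0.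
rewrite mulrC -ler_pdivlMr//; apply: supnorm_le.
  by rewrite divr_ge0 ?supnorm_ge0 ?cabs_ge0.
by move=> v; rewrite ler_pdivlMr// mulrC -cabsM; exact: (le_supnorm (c *: f)).
Qed.

Fact linfty_norm0 f : (supnorm f)%:C = 0 -> f = 0.
Proof.
move=> /(@complexI R) f0; apply: linfty_ext => v; apply: cabs0_eq0.
by apply/le_anti; rewrite cabs_ge0 -f0 le_supnorm.
Qed.

HB.instance Definition _ := Lmodule_isNormed.Build R[i] linfty
  linfty_normD linfty_normZ linfty_norm0.

Lemma nrm_linfty (f : linfty) : nrm f = supnorm f.
Proof. by []. Qed.

Fact linfty_complete (F : set_system linfty) :
  ProperFilter F -> cauchy F -> cvg F.
Proof.
move=> FF /(@cauchy_nrmP R linfty) Fc.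
have point v : exists l, forall e : R, 0 < e -> F [set f | cabs (l - f v) <= e].
  have [|l hl] := @C_complete R ((fun f : linfty => f v) @ F).
    move=> e /Fc[f Ff]; exists (f v).
    change (F [set g | cabs (f v - (g : linfty) v) <= e]).
    by apply: filterS Ff => g /=; apply: le_trans; exact: (le_supnorm (f - g)).
  by exists l => e /hl.
have [l hl] := choice point.
have unif e : 0 < e -> exists2 f : linfty, F [set g | nrm (f - g) <= e] &
    forall v, cabs (l v - f v) <= e.
  move=> e0; have [f Ff] := Fc _ e0; exists f => // v.
  apply/ler_addgt0Pr => d d0.
  have [g [/= g1 g2]] := filter_ex (filterI Ff (hl v _ d0)).
  have -> : l v - f v = (l v - g v) + (g v - f v) by rewrite addrA subrK.
  apply: le_trans (cabsD _ _) _; rewrite addrC lerD// cabsB.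
  by apply: le_trans g1; exact: (le_supnorm (f - g)).
have lb : exists M : R, forall v, cabs (l v) <= M.
  have [f _ hf] := unif 1 ltr01; have [M hM] := lfun_bounded f.
  exists (1 + M) => v; rewrite -[l v](subrK (f v)).
  by apply: le_trans (cabsD _ _) _; rewrite lerD.
apply/cvg_ex; exists (Linfty lb); apply/(@cvgF_nrmP R linfty) => e e0.
have e20 : 0 < e / 2 by rewrite divr_gt0.
have [f Ff hf] := unif _ e20; apply: filterS Ff => g /= hg.
rewrite nrm_linfty; apply: supnorm_le; first exact: ltW.
move=> v /=; have -> : l v - g v = (l v - f v) + (f v - g v).
  by rewrite addrA subrK.
apply: le_trans (cabsD _ _) _; rewrite [e]splitr lerD//.
by apply: le_trans hg; exact: (le_supnorm (f - g)).
Qed.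

HB.instance Definition _ := Uniform_isComplete.Build linfty linfty_complete.

Fact linfty_mulA : associative linftyM.
Proof. by move=> f g h; apply: linfty_ext => v /=; rewrite mulrA. Qed.
Fact linfty_mulDl : left_distributive linftyM +%R.
Proof. by move=> f g h; apply: linfty_ext => v /=; rewrite mulrDl. Qed.
Fact linfty_mulDr : right_distributive linftyM +%R.
Proof. by move=> f g h; apply: linfty_ext => v /=; rewrite mulrDr. Qed.
Fact linfty_mulZl (c : R[i]) (f g : linfty) :
  linftyM (c *: f) g = c *: linftyM f g.
Proof. by apply: linfty_ext => v /=; rewrite mulrA. Qed.
Fact linfty_mulZr (c : R[i]) (f g : linfty) :
  linftyM f (c *: g) = c *: linftyM f g.
Proof. by apply: linfty_ext => v /=; rewrite mulrCA. Qed.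
Fact linfty_starK : involutive linftyS.
Proof. by move=> f; apply: linfty_ext => v /=; exact: conjCK. Qed.
Fact linfty_starD : {morph linftyS : f g / f + g}.
Proof. by move=> f g; apply: linfty_ext => v /=; rewrite rmorphD. Qed.
Fact linfty_starZ (c : R[i]) (f : linfty) : linftyS (c *: f) = c^* *: linftyS f.
Proof. by apply: linfty_ext => v /=; rewrite rmorphM. Qed.
Fact linfty_starM f g : linftyS (linftyM f g) = linftyM (linftyS g) (linftyS f).
Proof. by apply: linfty_ext => v /=; rewrite rmorphM mulrC. Qed.
Fact linfty_mul_norm (f g : linfty) : `|linftyM f g| <= `|f| * `|g|.
Proof.
rewrite !nrmE -rmorphM ler_complex !nrm_linfty; apply: supnorm_le.
  by rewrite mulr_ge0 ?supnorm_ge0.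
by move=> v /=; rewrite cabsM ler_pM ?cabs_ge0 ?le_supnorm.
Qed.
Fact linfty_cstar (f : linfty) : `|linftyM (linftyS f) f| = `|f| ^+ 2.
Proof.
rewrite !nrmE -rmorphXn; congr (_%:C); rewrite !nrm_linfty; apply/eqP.
rewrite eq_le; apply/andP; split.
  apply: supnorm_le; first by rewrite exprn_ge0 ?supnorm_ge0.
  by move=> v /=; rewrite cabsM cabsJ ler_pM ?cabs_ge0 ?le_supnorm.
rewrite -[leRHS]sqr_sqrtr ?supnorm_ge0// lerXn2r ?nnegrE ?sqrtr_ge0 ?supnorm_ge0//.
apply: supnorm_le; first exact: sqrtr_ge0.
move=> v; rewrite -[leLHS]ger0_norm ?cabs_ge0// -sqrtr_sqr ler_wsqrtr//.
apply: le_trans (le_supnorm _ v) => /=; by rewrite cabsM cabsJ.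
Qed.

HB.instance Definition _ := CompleteNormedModule_isCstarAlgebra.Build R linfty
  linfty_mulA linfty_mulDl linfty_mulDr linfty_mulZl linfty_mulZr
  linfty_starK linfty_starD linfty_starZ linfty_starM
  linfty_mul_norm linfty_cstar.

End BoundedFunctions.

Section SubAlgebra.
Variables (R : realType) (A : cstarAlgType R).

Record cstarSubalg := CstarSubalg {
  subalg_set :> set A;
  subalgP : cstar_subalg subalg_set
}.

Variable D : cstarSubalg.

Record subcstar := Subcstar { sc_val :> A; sc_valP : subalg_set D sc_val }.

HB.instance Definition _ := gen_eqMixin subcstar.
HB.instance Definition _ := gen_choiceMixin subcstar.

Lemma sc_inj : injective sc_val.
Proof.
case=> f Pf [g Pg] /= fg; case: _ / fg Pg => Pg.
by congr Subcstar; exact: Prop_irrelevance.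
Qed.

Let DP := subalgP D.

Fact sc_opp_subproof (x : subcstar) : subalg_set D (- sc_val x).
Proof. by rewrite -scaleN1r; exact/(csubZ DP)/sc_valP. Qed.

Definition sc0 := Subcstar (csub0 DP).
Definition scD x y := Subcstar (csubD DP (sc_valP x) (sc_valP y)).
Definition scN x := Subcstar (sc_opp_subproof x).
Definition scZ (c : R[i]) x := Subcstar (csubZ DP c (sc_valP x)).
Definition scM x y := Subcstar (csubM DP (sc_valP x) (sc_valP y)).
Definition scS x := Subcstar (csubS DP (sc_valP x)).

Fact sc_addA : associative scD.
Proof. by move=> x y z; apply: sc_inj; rewrite /= addrA. Qed.
Fact sc_addC : commutative scD.
Proof. by move=> x y; apply: sc_inj; rewrite /= addrC. Qed.
Fact sc_add0 : left_id sc0 scD.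
Proof. by move=> x; apply: sc_inj; rewrite /= add0r. Qed.
Fact sc_addN : left_inverse sc0 scN scD.
Proof. by move=> x; apply: sc_inj; rewrite /= addNr. Qed.

HB.instance Definition _ := GRing.isZmodule.Build subcstar
  sc_addA sc_addC sc_add0 sc_addN.

Fact sc_scaleA a b x : scZ a (scZ b x) = scZ (a * b) x.
Proof. by apply: sc_inj; rewrite /= scalerA. Qed.
Fact sc_scale1 : left_id 1 scZ.
Proof. by move=> x; apply: sc_inj; rewrite /= scale1r. Qed.
Fact sc_scaleDr : right_distributive scZ +%R.
Proof. by move=> a x y; apply: sc_inj; rewrite /= scalerDr. Qed.
Fact sc_scaleDl x : {morph scZ^~ x : a b / a + b}.
Proof. by move=> a b; apply: sc_inj; rewrite /= scalerDl. Qed.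

HB.instance Definition _ := GRing.Zmodule_isLmodule.Build R[i] subcstar
  sc_scaleA sc_scale1 sc_scaleDr sc_scaleDl.

Fact sc_normD (x y : subcstar) :
  `|sc_val (x + y)| <= `|sc_val x| + `|sc_val y|.
Proof. exact: ler_normD. Qed.
Fact sc_normZ (c : R[i]) (x : subcstar) :
  `|sc_val (c *: x)| = `|c| * `|sc_val x|.
Proof. exact: normrZ. Qed.
Fact sc_norm0 (x : subcstar) : `|sc_val x| = 0 -> x = 0.
Proof. by move=> /normr0_eq0 x0; apply: sc_inj. Qed.

HB.instance Definition _ := Lmodule_isNormed.Build R[i] subcstar
  sc_normD sc_normZ sc_norm0.

Fact sc_complete (F : set_system subcstar) :
  ProperFilter F -> cauchy F -> cvg F.
Proof.
move=> FF /(@cauchy_nrmP R subcstar) Fc.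
have : cvg (sc_val @ F).
  apply/cauchy_cvgP/cauchy_nrmP => e /Fc[x Fx]; exists (sc_val x).
  exact: Fx.
move/cvg_ex => [l /cvg_nrmP hl].
have Dl : subalg_set D l.
  have /closed_nrmP := csub_closed DP; apply => e /hl/filter_ex[x xe].
  by exists (sc_val x) => //; exact: sc_valP.
by apply/cvg_ex; exists (Subcstar Dl); apply/(@cvgF_nrmP R subcstar).
Qed.

HB.instance Definition _ := Uniform_isComplete.Build subcstar sc_complete.

Fact sc_mulA : associative scM.
Proof. by move=> x y z; apply: sc_inj; rewrite /= cmulA. Qed.
Fact sc_mulDl : left_distributive scM +%R.
Proof. by move=> x y z; apply: sc_inj; rewrite /= cmulDl. Qed.
Fact sc_mulDr : right_distributive scM +%R.
Proof. by move=> x y z; apply: sc_inj; rewrite /= cmulDr. Qed.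
Fact sc_mulZl (c : R[i]) (x y : subcstar) : scM (c *: x) y = c *: scM x y.
Proof. by apply: sc_inj; rewrite /= cmulZl. Qed.
Fact sc_mulZr (c : R[i]) (x y : subcstar) : scM x (c *: y) = c *: scM x y.
Proof. by apply: sc_inj; rewrite /= cmulZr. Qed.
Fact sc_starK : involutive scS.
Proof. by move=> x; apply: sc_inj; rewrite /= starK. Qed.
Fact sc_starD : {morph scS : x y / x + y}.
Proof. by move=> x y; apply: sc_inj; rewrite /= starD. Qed.
Fact sc_starZ (c : R[i]) (x : subcstar) : scS (c *: x) = c^* *: scS x.
Proof. by apply: sc_inj; rewrite /= starZ. Qed.
Fact sc_starM x y : scS (scM x y) = scM (scS y) (scS x).
Proof. by apply: sc_inj; rewrite /= starM. Qed.
Fact sc_mul_norm (x y : subcstar) : `|scM x y| <= `|x| * `|y|.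
Proof. exact: (cmul_norm (sc_val x) (sc_val y)). Qed.
Fact sc_cstar (x : subcstar) : `|scM (scS x) x| = `|x| ^+ 2.
Proof. exact: (cstar_norm (sc_val x)). Qed.

HB.instance Definition _ := CompleteNormedModule_isCstarAlgebra.Build R subcstar
  sc_mulA sc_mulDl sc_mulDr sc_mulZl sc_mulZr
  sc_starK sc_starD sc_starZ sc_starM sc_mul_norm sc_cstar.

Record closedIdeal := ClosedIdeal {
  ideal_set :> set A;
  cidealP : closed_ideal ideal_set
}.

Fact cstar_gen_subproof (S : set A) : cstar_subalg (cstar_gen S).
Proof.
split; rewrite /cstar_gen /smallest /=.
- by move=> M [MP _]; exact: csub0.
- by move=> x y Dx Dy M MP; apply: (csubD MP.1); [exact: Dx|exact: Dy].
- by move=> c x Dx M MP; apply: (csubZ MP.1); exact: Dx.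
- by move=> x y Dx Dy M MP; apply: (csubM MP.1); [exact: Dx|exact: Dy].
- by move=> x Dx M MP; apply: (csubS MP.1); exact: Dx.
- by apply: closed_bigI => M [MP _]; exact: csub_closed.
Qed.
Definition gen_subalg S := CstarSubalg (cstar_gen_subproof S).

Fact ideal_gen_subproof (S : set A) : closed_ideal (ideal_gen S).
Proof.
split; rewrite /ideal_gen /smallest /=.
- by move=> M [MP _]; exact: cideal0.
- by move=> x y Dx Dy M MP; apply: (cidealD MP.1); [exact: Dx|exact: Dy].
- by move=> c x Dx M MP; apply: (cidealZ MP.1); exact: Dx.
- by move=> a x Dx M MP; apply: (cidealMl MP.1); exact: Dx.
- by move=> x a Dx M MP; apply: (cidealMr MP.1); exact: Dx.
- by apply: closed_bigI => M [MP _]; exact: cideal_closed.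
Qed.
Definition gen_ideal S := ClosedIdeal (ideal_gen_subproof S).

End SubAlgebra.

#[global] Existing Instance totally_filter.

Section FiniteSums.
Variable R : realType.

Lemma sum_CauchySchwarz (T : Type) (s : seq T) (a b : T -> R) :
  (forall t, 0 <= a t) -> (forall t, 0 <= b t) ->
  (\sum_(t <- s) a t * b t) ^+ 2 <=
  (\sum_(t <- s) a t ^+ 2) * (\sum_(t <- s) b t ^+ 2).
Proof.
move=> a0 b0; elim: s => [|t s ih]; first by rewrite !big_nil expr0n mul0r.
rewrite !big_cons; move: ih.
set S := \sum_(j <- s) _; set P := \sum_(j <- s) _; set Q := \sum_(j <- s) _.
have S0 : 0 <= S by rewrite sumr_ge0// => j _; rewrite mulr_ge0.
have P0 : 0 <= P by rewrite sumr_ge0// => j _; rewrite sqr_ge0.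
have Q0 : 0 <= Q by rewrite sumr_ge0// => j _; rewrite sqr_ge0.
move: (a t) (b t) (a0 t) (b0 t) => x y x0 y0 ih.
suff h : 2 * S * (x * y) <= P * y ^+ 2 + Q * x ^+ 2.
  rewrite -subr_ge0.
  have -> : (x ^+ 2 + P) * (y ^+ 2 + Q) - (x * y + S) ^+ 2 =
    (P * Q - S ^+ 2) + (P * y ^+ 2 + Q * x ^+ 2 - 2 * S * (x * y)) by ring.
  by rewrite addr_ge0// subr_ge0.
rewrite -(@ler_pXn2r _ 2)// ?nnegrE ?addr_ge0 ?mulr_ge0 ?sqr_ge0//.
have h1 : S ^+ 2 * (x * y) ^+ 2 <= P * Q * (x * y) ^+ 2.
  by rewrite ler_wpM2r ?sqr_ge0.
have h2 : 0 <= (P * y ^+ 2 - Q * x ^+ 2) ^+ 2 by exact: sqr_ge0.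
rewrite -subr_ge0.
have -> : (P * y ^+ 2 + Q * x ^+ 2) ^+ 2 - (2 * S * (x * y)) ^+ 2 =
  (P * y ^+ 2 - Q * x ^+ 2) ^+ 2 +
  4 * (P * Q * (x * y) ^+ 2 - S ^+ 2 * (x * y) ^+ 2) by ring.
by rewrite addr_ge0// mulr_ge0// subr_ge0.
Qed.

Lemma sum_fsetD (K : choiceType) (M : zmodType) (F0 F : {fset K}) (f : K -> M) :
  (F0 `<=` F)%fset ->
  \sum_(k <- F) f k = \sum_(k <- F0) f k + \sum_(k <- (F `\` F0)%fset) f k.
Proof.
move=> sF; rewrite -big_cat; apply: perm_big; apply: uniq_perm.
- exact: fset_uniq.
- rewrite cat_uniq !fset_uniq /= andbT; apply/hasPn => k.
  by rewrite in_fsetD => /andP[].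
- move=> k; rewrite mem_cat in_fsetD.
  case: (boolP (k \in F0)) => //= kF0; exact: (fsubsetP sF).
Qed.

End FiniteSums.

Section DirectSum.
Variables (R : realType) (V : Type) (D : cstarSubalg (linfty R V)).
Variables (K : choiceType) (I : K -> closedIdeal (subcstar D)).
Local Notation A := (subcstar D).
Local Open Scope complex_scope.

Definition ev (a : A) (v : V) : R[i] := lfun (sc_val a) v.

Lemma evD a b v : ev (a + b) v = ev a v + ev b v. Proof. by []. Qed.
Lemma evN a v : ev (- a) v = - ev a v. Proof. by []. Qed.
Lemma evB a b v : ev (a - b) v = ev a v - ev b v. Proof. by []. Qed.
Lemma evZ (c : R[i]) a v : ev (c *: a) v = c * ev a v. Proof. by []. Qed.
Lemma evM a b v : ev (a ** b) v = ev a v * ev b v. Proof. by []. Qed.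
Lemma evS a v : ev (star a) v = (ev a v)^*%R. Proof. by []. Qed.
Lemma ev0 v : ev 0 v = 0. Proof. by []. Qed.

Lemma ev_ext a b : (forall v, ev a v = ev b v) -> a = b.
Proof. by move=> ab; apply: sc_inj; apply: linfty_ext. Qed.

Lemma ev_sum T (s : seq T) (f : T -> A) v :
  ev (\sum_(t <- s) f t) v = \sum_(t <- s) ev (f t) v.
Proof. by elim: s => [|t s ih]; rewrite ?big_nil// !big_cons evD ih. Qed.

Lemma ev_le a v : cabs (ev a v) <= nrm a.
Proof. exact: (le_supnorm (sc_val a)). Qed.

Lemma le_nrm a (M : R) : 0 <= M -> (forall v, cabs (ev a v) <= M) -> nrm a <= M.
Proof. exact: supnorm_le. Qed.

Definition gram (x y : K -> A) (F : {fset K}) : A :=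
  \sum_(k <- F) star (x k) ** y k.

Definition qsum (x : K -> A) (F : {fset K}) (v : V) : R :=
  \sum_(k <- F) cabs (ev (x k) v) ^+ 2.

Lemma qsum_ge0 x F v : 0 <= qsum x F v.
Proof. by apply: sumr_ge0 => k _; rewrite sqr_ge0. Qed.

Lemma ev_gram x y F v :
  ev (gram x y F) v = \sum_(k <- F) (ev (x k) v)^*%R * ev (y k) v.
Proof. by rewrite ev_sum; apply: eq_bigr => k _. Qed.

Lemma ev_gramxx x F v : ev (gram x x F) v = (qsum x F v)%:C.
Proof.
by rewrite ev_gram rmorph_sum; apply: eq_bigr => k _; rewrite cabs_sqr.
Qed.

Lemma cabs_sum T (s : seq T) (f : T -> R[i]) :
  cabs (\sum_(t <- s) f t) <= \sum_(t <- s) cabs (f t).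
Proof.
elim: s => [|t s ih]; first by rewrite !big_nil cabs0.
by rewrite !big_cons; apply: le_trans (cabsD _ _) _; rewrite lerD2l.
Qed.

Lemma gram_CS x y F v :
  cabs (ev (gram x y F) v) ^+ 2 <= qsum x F v * qsum y F v.
Proof.
apply: le_trans (sum_CauchySchwarz _ _ _); last 2 first.
- by move=> k; exact: cabs_ge0.
- by move=> k; exact: cabs_ge0.
rewrite lerXn2r ?nnegrE ?cabs_ge0//.
  by apply: sumr_ge0 => k _; rewrite mulr_ge0 ?cabs_ge0.
rewrite ev_gram; apply: le_trans (cabs_sum _ _) _.
by apply: ler_sum => k _; rewrite cabsM cabsJ.
Qed.

Lemma qsum_mono x F G v : (F `<=` G)%fset -> qsum x F v <= qsum x G v.
Proof. by move=> /sum_fsetD; rewrite /qsum => ->; rewrite lerDl qsum_ge0. Qed.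

Lemma qsumZ (c : R[i]) x F v :
  qsum (fun k => c *: x k) F v = cabs c ^+ 2 * qsum x F v.
Proof.
by rewrite /qsum mulr_sumr; apply: eq_bigr => k _; rewrite evZ cabsM exprMn.
Qed.

Lemma qsumN x F v : qsum (fun k => - x k) F v = qsum x F v.
Proof. by apply: eq_bigr => k _; rewrite evN cabsN. Qed.

Lemma qsum_minkowski x y F v :
  Num.sqrt (qsum (fun k => x k + y k) F v) <=
  Num.sqrt (qsum x F v) + Num.sqrt (qsum y F v).
Proof.
rewrite -(@ler_pXn2r _ 2)// ?nnegrE ?addr_ge0 ?sqrtr_ge0//.
rewrite sqrrD !sqr_sqrtr ?qsum_ge0//.
set S := \sum_(k <- F) cabs (ev (x k) v) * cabs (ev (y k) v).
have hS : S <= Num.sqrt (qsum x F v) * Num.sqrt (qsum y F v).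
  have S0 : 0 <= S by apply: sumr_ge0 => k _; rewrite mulr_ge0 ?cabs_ge0.
  rewrite -(@ler_pXn2r _ 2)// ?nnegrE ?mulr_ge0 ?sqrtr_ge0//.
  rewrite exprMn !sqr_sqrtr ?qsum_ge0//.
  by apply: sum_CauchySchwarz => k; exact: cabs_ge0.
apply: (@le_trans _ _ (qsum x F v + S *+ 2 + qsum y F v)); last first.
  by rewrite lerD2r lerD2l lerMn2r.
rewrite /qsum /S -sumrMnl -!big_split /=; apply: ler_sum => k _.
rewrite evD -sqrrD lerXn2r ?nnegrE ?addr_ge0 ?cabs_ge0//; exact: cabsD.
Qed.

Lemma qsumD2 x y F v : qsum (fun k => x k + y k) F v <=
  2 * qsum x F v + 2 * qsum y F v.
Proof.
rewrite /qsum !mulr_sumr -big_split /=; apply: ler_sum => k _; rewrite evD.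
apply: (@le_trans _ _ ((cabs (ev (x k) v) + cabs (ev (y k) v)) ^+ 2)).
  by rewrite lerXn2r ?nnegrE ?addr_ge0 ?cabs_ge0//; exact: cabsD.
have := sqr_ge0 (cabs (ev (x k) v) - cabs (ev (y k) v)); nra.
Qed.

Lemma totallyP (P : set {fset K}) :
  totally P <-> exists F0, forall F, (F0 `<=` F)%fset -> P F.
Proof.
by split=> [[F0 _ h]|[F0 h]]; exists F0.
Qed.

Definition sq_summable (x : K -> A) : Prop := cvg (gram x x F @[F --> totally]).

Definition usmall (x : K -> A) : Prop := forall e : R, 0 < e ->
  exists F0 : {fset K}, forall F v, qsum x (F `\` F0)%fset v <= e.

Lemma gramD x y F0 F : (F0 `<=` F)%fset ->
  gram x y F = gram x y F0 + gram x y (F `\` F0)%fset.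
Proof. exact: sum_fsetD. Qed.

Lemma usmall_cvg x y : usmall x -> usmall y ->
  cvg (gram x y F @[F --> totally]).
Proof.
move=> hx hy; apply/cauchy_cvgP/cauchy_nrmP => e e0.
have [Fx hFx] := hx _ e0; have [Fy hFy] := hy _ e0.
pose F0 := (Fx `|` Fy)%fset; exists (gram x y F0).
apply/totallyP; exists F0 => F sF /=.
rewrite (gramD _ _ sF) opprD addNKr nrmN; apply: le_nrm; first exact: ltW.
move=> v; rewrite -(@ler_pXn2r _ 2)// ?nnegrE ?cabs_ge0 ?(ltW e0)//.
apply: le_trans (gram_CS _ _ _ _) _; rewrite expr2 ler_pM ?qsum_ge0//.
  by apply: le_trans (hFx F v); apply: qsum_mono; rewrite fsetDS ?fsubsetUl.
by apply: le_trans (hFy F v); apply: qsum_mono; rewrite fsetDS ?fsubsetUr.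
Qed.

Lemma sq_summableP x : sq_summable x <-> usmall x.
Proof.
split=> [/cvg_ex[l /cvg_nrmP hl] e e0|]; last by move=> h; exact: usmall_cvg.
have e20 : 0 < e / 2 by rewrite divr_gt0.
have /totallyP[F0 h] := hl _ e20.
exists F0 => F v; have sU : (F0 `<=` F0 `|` F)%fset by exact: fsubsetUl.
have -> : (F `\` F0 = (F0 `|` F) `\` F0)%fset by rewrite fsetDUl fsetDv fset0U.
set G := (_ `\` F0)%fset.
rewrite -[qsum _ _ _]cabs_real ?qsum_ge0// -ev_gramxx.
apply: le_trans (ev_le _ _) _.
have -> : gram x x G = (l - gram x x F0) - (l - gram x x (F0 `|` F)%fset).
  by rewrite (gramD x x sU) -/G opprB addrC addrA subrK addrAC subrr add0r.
apply: le_trans (nrmD _ _) _; rewrite nrmN [e]splitr lerD//; exact: h.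
Qed.

(* The Hilbert module direct sum of the ideals [I k], each being a module with
   inner product [star x ** y]: the families [x] such that the sum of the
   [star (x k) ** x k] converges in norm along the finite sets of indices. *)
Record dsum := Dsum {
  dval :> K -> A;
  dval_in : forall k, ideal_set (I k) (dval k);
  dval_summable : sq_summable dval
}.

HB.instance Definition _ := gen_eqMixin dsum.
HB.instance Definition _ := gen_choiceMixin dsum.

Lemma dsum_ext (x y : dsum) : (forall k, x k = y k) -> x = y.
Proof.
case: x y => x Px Sx [y Py Sy] /= /funext xy; case: _ / xy Py Sy => Py Sy.
by congr Dsum; exact: Prop_irrelevance.
Qed.

Lemma dsum_small (x : dsum) : usmall x.
Proof. exact/sq_summableP/dval_summable. Qed.

Definition mkdsum (x : K -> A) (xI : forall k, ideal_set (I k) (x k))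
  (sx : usmall x) : dsum := Dsum xI ((sq_summableP x).2 sx).

Fact dsum0_in k : ideal_set (I k) 0. Proof. exact: cideal0 (cidealP _). Qed.
Fact dsum0_small : usmall (fun=> 0).
Proof.
move=> e e0; exists fset0 => F v; rewrite /qsum big1 ?ltW// => k _.
by rewrite ev0 cabs0 expr0n.
Qed.
Definition dsum0 := mkdsum dsum0_in dsum0_small.

Fact dsumD_in (x y : dsum) k : ideal_set (I k) (x k + y k).
Proof. by apply: (cidealD (cidealP _)); exact: dval_in. Qed.
Lemma usmallD x y : usmall x -> usmall y -> usmall (fun k => x k + y k).
Proof.
move=> hx hy e e0; have e40 : 0 < e / 4 by rewrite divr_gt0.
have [Fx hFx] := hx _ e40; have [Fy hFy] := hy _ e40.
exists (Fx `|` Fy)%fset => F v; apply: le_trans (qsumD2 _ _ _ _) _.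
have h1 : qsum x (F `\` (Fx `|` Fy))%fset v <= e / 4.
  by apply: le_trans (hFx F v); apply: qsum_mono; rewrite fsetDS ?fsubsetUl.
have h2 : qsum y (F `\` (Fx `|` Fy))%fset v <= e / 4.
  by apply: le_trans (hFy F v); apply: qsum_mono; rewrite fsetDS ?fsubsetUr.
lra.
Qed.
Definition dsumD (x y : dsum) :=
  mkdsum (dsumD_in x y) (usmallD (dsum_small x) (dsum_small y)).

Lemma usmall_le (M : R) x y : 0 <= M -> usmall x ->
  (forall F v, qsum y F v <= M * qsum x F v) -> usmall y.
Proof.
move=> M0 hx h e e0; have M1 : 0 < M + 1 by rewrite ltr_wpDl.
have [F0 hF0] := hx _ (divr_gt0 e0 M1); exists F0 => F v.
apply: le_trans (h _ _) _; apply: (@le_trans _ _ ((M + 1) * (e / (M + 1)))).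
  by rewrite ler_pM ?qsum_ge0// lerDl.
by rewrite mulrCA divff ?mulr1// gt_eqF.
Qed.

Fact dsumZ_in (c : R[i]) (x : dsum) k : ideal_set (I k) (c *: x k).
Proof. by apply: (cidealZ (cidealP _)); exact: dval_in. Qed.
Fact dsumZ_small (c : R[i]) (x : dsum) : usmall (fun k => c *: x k).
Proof.
apply: (usmall_le (sqr_ge0 (cabs c)) (dsum_small x)) => F v.
by rewrite qsumZ.
Qed.
Definition dsumZ c x := mkdsum (dsumZ_in c x) (dsumZ_small c x).

Fact dsumN_in (x : dsum) k : ideal_set (I k) (- x k).
Proof. by rewrite -scaleN1r; exact: dsumZ_in. Qed.
Fact dsumN_small (x : dsum) : usmall (fun k => - x k).
Proof.
by apply: (usmall_le ler01 (dsum_small x)) => F v; rewrite qsumN mul1r.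
Qed.
Definition dsumN x := mkdsum (dsumN_in x) (dsumN_small x).

Fact dsum_addA : associative dsumD.
Proof. by move=> x y z; apply: dsum_ext => k /=; rewrite addrA. Qed.
Fact dsum_addC : commutative dsumD.
Proof. by move=> x y; apply: dsum_ext => k /=; rewrite addrC. Qed.
Fact dsum_add0 : left_id dsum0 dsumD.
Proof. by move=> x; apply: dsum_ext => k /=; rewrite add0r. Qed.
Fact dsum_addN : left_inverse dsum0 dsumN dsumD.
Proof. by move=> x; apply: dsum_ext => k /=; rewrite addNr. Qed.

HB.instance Definition _ := GRing.isZmodule.Build dsum
  dsum_addA dsum_addC dsum_add0 dsum_addN.

Fact dsum_scaleA a b x : dsumZ a (dsumZ b x) = dsumZ (a * b) x.
Proof. by apply: dsum_ext => k /=; rewrite scalerA. Qed.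
Fact dsum_scale1 : left_id 1 dsumZ.
Proof. by move=> x; apply: dsum_ext => k /=; rewrite scale1r. Qed.
Fact dsum_scaleDr : right_distributive dsumZ +%R.
Proof. by move=> a x y; apply: dsum_ext => k /=; rewrite scalerDr. Qed.
Fact dsum_scaleDl x : {morph dsumZ^~ x : a b / a + b}.
Proof. by move=> a b; apply: dsum_ext => k /=; rewrite scalerDl. Qed.

HB.instance Definition _ := GRing.Zmodule_isLmodule.Build R[i] dsum
  dsum_scaleA dsum_scale1 dsum_scaleDr dsum_scaleDl.

Definition dip (x y : dsum) : A := lim (gram x y F @[F --> totally]).

Lemma dip_cvg (x y : dsum) : gram x y F @[F --> totally] --> dip x y.
Proof. by apply: usmall_cvg; exact: dsum_small. Qed.

Lemma dip_unique (x y : dsum) l : gram x y F @[F --> totally] --> l ->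
  dip x y = l.
Proof. by apply: cvg_lim; exact: norm_hausdorff. Qed.

Lemma qsum_le_dip (x : dsum) F v : qsum x F v <= nrm (dip x x).
Proof.
apply/ler_addgt0Pr => e e0.
have /cvg_nrmP/(_ _ e0)/totallyP[F0 h] := @dip_cvg x x.
have {}h := h _ (fsubsetUl F0 F).
apply: le_trans (qsum_mono _ _ (fsubsetUr F0 F)) _.
rewrite -[qsum _ _ _]cabs_real ?qsum_ge0// -ev_gramxx.
apply: le_trans (ev_le _ _) _.
rewrite -[gram _ _ _](subrK (dip x x)) addrC.
by apply: le_trans (nrmD _ _) _; rewrite nrmB lerD2l nrmB -nrmN opprB.
Qed.

Lemma dip_le (x : dsum) M : 0 <= M -> (forall F v, qsum x F v <= M) ->
  nrm (dip x x) <= M.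
Proof.
move=> M0 h; apply/ler_addgt0Pr => e e0.
have /cvg_nrmP/(_ _ e0)/totallyP[F0 /(_ F0 (fsubset_refl _)) h0] := @dip_cvg x x.
rewrite -[dip x x](subrK (gram x x F0)) addrC.
apply: le_trans (nrmD _ _) _; rewrite lerD//; apply: le_nrm => // v.
by rewrite ev_gramxx cabs_real ?qsum_ge0.
Qed.

Definition dnorm (x : dsum) : R := Num.sqrt (nrm (dip x x)).

Lemma dnorm_ge0 x : 0 <= dnorm x. Proof. exact: sqrtr_ge0. Qed.

Lemma qsum_le_dnorm (x : dsum) F v : Num.sqrt (qsum x F v) <= dnorm x.
Proof. by rewrite ler_wsqrtr ?qsum_le_dip. Qed.

Lemma dnorm_le (x : dsum) M : 0 <= M ->
  (forall F v, Num.sqrt (qsum x F v) <= M) -> dnorm x <= M.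
Proof.
move=> M0 h; rewrite -[M]ger0_norm// -sqrtr_sqr ler_wsqrtr//.
apply: dip_le; first exact: sqr_ge0.
by move=> F v; rewrite -[qsum _ _ _]sqr_sqrtr ?qsum_ge0// lerXn2r ?nnegrE ?sqrtr_ge0.
Qed.

Lemma dipDr (x y z : dsum) : dip x (y + z) = dip x y + dip x z.
Proof.
apply: dip_unique; rewrite (_ : gram x (y + z) = fun F => gram x y F + gram x z F).
  by apply: cvgD; exact: dip_cvg.
by apply/funext => F; rewrite /gram -big_split; apply: eq_bigr => k _; exact: cmulDr.
Qed.

Lemma dipZr (c : R[i]) (x y : dsum) : dip x (c *: y) = c *: dip x y.
Proof.
apply: dip_unique; rewrite (_ : gram x (c *: y) = fun F => c *: gram x y F).
  apply/cvg_nrmP => e e0.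
  have c1 : 0 < cabs c + 1 by rewrite ltr_wpDl ?cabs_ge0.
  have /cvg_nrmP/(_ _ (divr_gt0 e0 c1)) := @dip_cvg x y.
  apply: filterS => F /= h; rewrite -scalerBr nrmZ.
  apply: (@le_trans _ _ ((cabs c + 1) * (e / (cabs c + 1)))).
    by rewrite ler_pM ?nrm_ge0// lerDl.
  by rewrite mulrCA divff ?mulr1// gt_eqF.
by apply/funext => F; rewrite /gram scaler_sumr; apply: eq_bigr => k _; exact: cmulZr.
Qed.

Lemma nrm_star (B : cstarAlgType R) (b : B) : nrm (star b) = nrm b.
Proof.
have h (a : B) : nrm a <= nrm (star a).
  have [a0|a0] := eqVneq (nrm a) 0; first by rewrite a0 nrm_ge0.
  have agt0 : 0 < nrm a by rewrite lt_def a0 nrm_ge0.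
  rewrite -(ler_pM2r agt0) -expr2 -ler_complex rmorphXn /= rmorphM /= -!nrmE.
  by rewrite -cstar_norm cmul_norm.
by apply/eqP; rewrite eq_le h andbT; have := h (star b); rewrite starK.
Qed.

Lemma dip_star (x y : dsum) : star (dip x y) = dip y x.
Proof.
apply/esym/dip_unique; rewrite (_ : gram y x = fun F => star (gram x y F)).
  apply/cvg_nrmP => e e0.
  have /cvg_nrmP/(_ _ e0) := @dip_cvg x y.
  apply: filterS => F /=.
  have -> : star (dip x y) - star (gram x y F) = star (dip x y - gram x y F).
    by apply: ev_ext => v; rewrite evB !evS evB rmorphB.
  by rewrite nrm_star.
apply/funext => F; apply: ev_ext => v; rewrite evS !ev_gram rmorph_sum.
by apply: eq_bigr => k _; rewrite rmorphM /= mulrC; congr (_ * _);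
  exact/esym/(@conjCK R[i]).
Qed.

Fact dsum_normD x y : (dnorm (x + y))%:C <= (dnorm x)%:C + (dnorm y)%:C.
Proof.
rewrite -rmorphD ler_complex; apply: dnorm_le; first by rewrite addr_ge0 ?dnorm_ge0.
move=> F v; apply: le_trans (qsum_minkowski x y F v) _.
by rewrite lerD ?qsum_le_dnorm.
Qed.

Fact dsum_normZ (c : R[i]) x : (dnorm (c *: x))%:C = `|c| * (dnorm x)%:C.
Proof.
rewrite cabsE -rmorphM; congr (_%:C); rewrite /dnorm.
have -> : dip (c *: x) (c *: x) = (cabs c ^+ 2)%:C *: dip x x.
  by rewrite dipZr -dip_star dipZr starZ dip_star scalerA mulrC cabs_sqr.
rewrite nrmZ sqrtrM ?nrm_ge0//; congr (_ * _).
rewrite -/(cabs _) cabs_real ?sqr_ge0// sqrtr_sqr ger0_norm// cabs_ge0//.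
Qed.

Fact dsum_norm0 x : (dnorm x)%:C = 0 -> x = 0.
Proof.
move=> /(@complexI R) x0; apply: dsum_ext => k; apply: ev_ext => v.
have := qsum_le_dnorm x [fset k]%fset v.
rewrite x0 /qsum big_seq_fset1 sqrtr_sqr ger0_norm ?cabs_ge0// => h.
by apply: cabs0_eq0; apply/le_anti; rewrite h cabs_ge0.
Qed.

HB.instance Definition _ := Lmodule_isNormed.Build R[i] dsum
  dsum_normD dsum_normZ dsum_norm0.

Lemma nrm_dsum (x : dsum) : nrm x = dnorm x. Proof. by []. Qed.

Lemma dval_nrm (x : dsum) k : nrm (x k) <= nrm x.
Proof.
apply: le_nrm => [|v]; first exact: dnorm_ge0.
have := qsum_le_dnorm x [fset k]%fset v.
by rewrite /qsum big_seq_fset1 sqrtr_sqr ger0_norm ?cabs_ge0.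
Qed.

Fact dsum_complete (F : set_system dsum) : ProperFilter F -> cauchy F -> cvg F.
Proof.
move=> FF /(@cauchy_nrmP R dsum) Fc.
have coord k : exists l, forall e : R, 0 < e ->
    F [set x : dsum | nrm (l - x k) <= e].
  have : cvg ((fun x : dsum => x k) @ F).
    apply/cauchy_cvgP/cauchy_nrmP => e /Fc[x Fx]; exists (x k).
    change (F [set y : dsum | nrm (x k - y k) <= e]).
    by apply: filterS Fx => y /=; apply: le_trans; exact: (dval_nrm (x - y)).
  by move/cvg_ex => [l /cvg_nrmP hl]; exists l.
have [l hl] := choice coord.
have lI k : ideal_set (I k) (l k).
  have /closed_nrmP := cideal_closed (cidealP (I k)).
  apply => e /(hl k)/filter_ex[x xe].
  by exists (x k) => //; exact: dval_in.
have hlF e (G : {fset K}) : 0 < e ->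
    F [set x : dsum | forall k, k \in G -> nrm (l k - x k) <= e].
  move=> e0; suff h (s : seq K) :
      F [set x : dsum | forall k, k \in s -> nrm (l k - x k) <= e] by exact: h.
  elim: s => [|k s ih]; first by apply: filterS filterT.
  apply: filterS2 ih (hl k _ e0) => x /= h1 h2 j.
  by rewrite inE => /predU1P[->//|/h1].
have unif e : 0 < e -> exists2 x : dsum, F [set y | nrm (x - y) <= e] &
    forall G v, Num.sqrt (qsum (fun k => l k - x k) G v) <= e.
  move=> e0; have [x Fx] := Fc _ e0; exists x => // G v.
  apply/ler_addgt0Pr => d d0.
  pose N : R := (size G)%:R; have N1 : 0 < N + 1 by rewrite ltr_wpDl ?ler0n.
  have dN : 0 < d / (N + 1) by rewrite divr_gt0.
  have [y [/= y1 y2]] := filter_ex (filterI Fx (hlF _ G dN)).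
  have -> : (fun k => l k - x k) = (fun k => (l k - y k) + (y k - x k)).
    by apply/funext => k; rewrite addrA subrK.
  apply: le_trans (qsum_minkowski _ _ _ _) _; rewrite addrC lerD//.
    apply: le_trans y1; rewrite nrmB nrm_dsum; exact: (qsum_le_dnorm (y - x)).
  rewrite -[d]ger0_norm ?(ltW d0)// -sqrtr_sqr ler_wsqrtr//.
  apply: (@le_trans _ _ (\sum_(k <- G) (d / (N + 1)) ^+ 2)).
    rewrite /qsum big_seq [leRHS]big_seq; apply: ler_sum => k kG.
    rewrite lerXn2r ?nnegrE ?cabs_ge0 ?(ltW dN)//.
    by apply: le_trans (ev_le _ _) (y2 _ kG).
  rewrite big_const_seq count_predT iter_addr_0 -mulr_natl -/N exprMn exprVn.
  rewrite mulrCA ler_piMr ?sqr_ge0// ler_pdivrMr ?exprn_gt0// mul1r.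
  have N0 : 0 <= N by rewrite ler0n.
  nra.
have ls : usmall l.
  move=> e e0; have d0 : 0 < Num.sqrt (e / 4) by rewrite sqrtr_gt0 divr_gt0.
  have [x _ hx] := unif _ d0.
  have [F0 hF0] := dsum_small x (divr_gt0 e0 (ltr0n R 4)).
  exists F0 => G v.
  have -> : l = (fun k => (l k - x k) + x k) by apply/funext => k; rewrite subrK.
  apply: le_trans (qsumD2 _ _ _ _) _.
  have h1 : qsum (fun k => l k - x k) (G `\` F0)%fset v <= e / 4.
    by rewrite -(@ler_psqrt _ _ _)// ?nnegrE ?qsum_ge0 ?hx// divr_ge0 ?ltW.
  have h2 := hF0 G v; lra.
apply/cvg_ex; exists (mkdsum lI ls); apply/(@cvgF_nrmP R dsum) => e e0.
have e20 : 0 < e / 2 by rewrite divr_gt0.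
have [x Fx hx] := unif _ e20; apply: filterS Fx => y /= hy.
rewrite -[mkdsum lI ls](subrK x) -addrA [e]splitr.
apply: le_trans (nrmD _ _) _; rewrite lerD// nrm_dsum.
by apply: dnorm_le => [|G v]; [exact: ltW | exact: hx].
Qed.

HB.instance Definition _ := Uniform_isComplete.Build dsum dsum_complete.

End DirectSum.

Section SquareRoot.
Variables (R : realType) (V : Type) (D : cstarSubalg (linfty R V)).
Local Notation A := (subcstar D).
Local Open Scope complex_scope.

Lemma nrmM (B : cstarAlgType R) (a b : B) : nrm (a ** b) <= nrm a * nrm b.
Proof. by rewrite -ler_complex rmorphM /= -!nrmE cmul_norm. Qed.

Fixpoint sqrt_approx (g : A) (n : nat) : A :=
  if n is m.+1 then
    sqrt_approx g m + (2^-1)%:C *: (g - sqrt_approx g m ** sqrt_approx g m)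
  else 0.

Lemma sqrt_approxP (g : A) (s : R) v n : 0 <= s <= 1 ->
  ev g v = (s ^+ 2)%:C ->
  exists2 d, ev (sqrt_approx g n) v = (s - d)%:C &
    (0 <= d <= s) && (d <= 2 / (n.+2)%:R).
Proof.
move=> /andP[s0 s1] gE; elim: n => [|n [d dE /andP[/andP[d0 ds] dn]]].
  exists s; first by rewrite subrr.
  by rewrite s0 lexx /= divff// pnatr_eq0.
exists (d * (1 - s + d / 2)).
  rewrite /= evD evZ evB evM dE gE -rmorphM -rmorphB -rmorphM -rmorphD.
  by congr (_%:C); field.
have h1 : d * (1 - s + d / 2) <= d * (1 - d / 2).
  by rewrite ler_wpM2l//; lra.
apply/andP; split; first (apply/andP; split).
- by rewrite mulr_ge0//; lra.
- by apply: le_trans h1 _; nra.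
apply: le_trans h1 _.
set N : R := (n.+2)%:R in dn.
have N2 : 2 <= N by rewrite ler_nat.
have -> : (n.+3)%:R = N + 1 :> R by rewrite /N -natr1.
clearbody N; have Ngt : 0 < N by lra.
have Nne : N != 0 by rewrite gt_eqF.
apply: (@le_trans _ _ (2 / N * (1 - 2 / N / 2))).
  have : 2 / N <= 1 by rewrite ler_pdivrMr// mul1r.
  by move: (2 / N) dn => t dn t1; nra.
have -> : 2 / N * (1 - 2 / N / 2) = 2 * (N - 1) / N ^+ 2.
  by field.
rewrite ler_pdivrMr ?exprn_gt0// mulrAC ler_pdivlMr; last lra.
nra.
Qed.

Lemma sqrt_ex (a : A) (q : V -> R) : (forall v, 0 <= q v) ->
  (forall v, ev a v = (q v)%:C) ->
  exists b : A, forall v, ev b v = (Num.sqrt (q v))%:C.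
Proof.
move=> q0 aE; pose M := nrm a + 1.
have M0 : 0 < M by rewrite ltr_wpDl ?nrm_ge0.
pose g := (M^-1)%:C *: a.
pose s v := Num.sqrt (q v / M).
have s0 v : 0 <= s v by exact: sqrtr_ge0.
have ss v : s v ^+ 2 = q v / M by rewrite sqr_sqrtr// divr_ge0// ltW.
have s1 v : s v <= 1.
  rewrite -sqrtr1 ler_wsqrtr// ler_pdivrMr// mul1r.
  rewrite -[q v]cabs_real// -aE; apply: le_trans (ev_le _ _) _.
  by rewrite lerDl.
have gE v : ev g v = (s v ^+ 2)%:C by rewrite evZ aE -rmorphM ss mulrC.
have bd : exists M : R, forall v, cabs (s v)%:C <= M.
  by exists 1 => v; rewrite cabs_real.
have Db : subalg_set D (Linfty bd).
  have /closed_nrmP := csub_closed (subalgP D); apply => e e0.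
  pose n := Num.bound (2 / e).
  exists (sc_val (sqrt_approx g n)); first exact: sc_valP.
  apply: supnorm_le; first exact: ltW.
  move=> v; change (cabs ((s v)%:C - ev (sqrt_approx g n) v) <= e).
  have sv : 0 <= s v <= 1 by rewrite s0 s1.
  have [d dE /andP[/andP[d0 _] dn]] := sqrt_approxP n sv (gE v).
  rewrite dE -rmorphB opprB addrC subrK cabs_real//.
  apply: le_trans dn _; rewrite ler_pdivrMr ?ltr0n// mulrC -ler_pdivrMr//.
  have e20 : 0 <= 2 / e by rewrite divr_ge0// ltW.
  apply: (le_trans (ltW (archi_boundP e20))).
  by rewrite ler_nat -/n ltnW// ltnW.
exists ((Num.sqrt M)%:C *: Subcstar Db) => v.
by rewrite evZ -rmorphM -sqrtrM ?(ltW M0)// mulrCA divff ?mulr1 ?gt_eqF.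
Qed.

End SquareRoot.

Section DirectSumModule.
Variables (R : realType) (V : Type) (D : cstarSubalg (linfty R V)).
Variables (K : choiceType) (I : K -> closedIdeal (subcstar D)).
Local Notation A := (subcstar D).
Local Notation X := (dsum I).
Local Open Scope complex_scope.

Lemma dip_real (x : X) v : ev (dip x x) v = (complex.Re (ev (dip x x) v))%:C.
Proof.
set z := ev _ _; suff : `|complex.Im z| <= 0.
  by rewrite normr_le0 => /eqP; case: z => a b /= ->.
apply/ler_addgt0Pr => e e0; rewrite add0r.
have /cvg_nrmP/(_ _ e0)/filter_ex[F /= hF] := @dip_cvg _ _ _ _ _ x x.
apply: le_trans hF; apply: le_trans (ev_le _ v); rewrite evB ev_gramxx -/z.
apply: le_trans (Im_cabs _); case: z => a b /=; by rewrite subr0.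
Qed.

Lemma dip_ge0 (x : X) v : 0 <= complex.Re (ev (dip x x) v).
Proof.
set z := complex.Re _; rewrite -oppr_le0; apply/ler_addgt0Pr => e e0; rewrite add0r.
have /cvg_nrmP/(_ _ e0)/filter_ex[F /= hF] := @dip_cvg _ _ _ _ _ x x.
apply: le_trans hF; apply: le_trans (ev_le _ v).
rewrite evB ev_gramxx dip_real -/z -rmorphB.
apply: le_trans (Re_cabs _) => /=; rewrite distrC.
apply: le_trans (ler_norm _); rewrite lerBrDl addrN; exact: qsum_ge0.
Qed.

Fact dsum_ip_pos (x : X) : exists b, dip x x = star b ** b.
Proof.
have [b bE] := sqrt_ex (dip_ge0 x) (dip_real x).
exists b; apply: ev_ext => v.
by rewrite evM evS cabs_sqr bE cabs_real ?sqrtr_ge0// sqr_sqrtr ?dip_ge0// -dip_real.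
Qed.

Lemma qsumM (a : A) (x : K -> A) F v :
  qsum (fun k => x k ** a) F v <= nrm a ^+ 2 * qsum x F v.
Proof.
rewrite /qsum mulr_sumr; apply: ler_sum => k _.
rewrite evM cabsM exprMn mulrC ler_wpM2r ?sqr_ge0//.
by rewrite lerXn2r ?nnegrE ?cabs_ge0 ?nrm_ge0 ?ev_le.
Qed.

Fact dract_in (x : X) (a : A) k : ideal_set (I k) (x k ** a).
Proof. by apply: (cidealMr (cidealP _)); exact: dval_in. Qed.
Fact dract_small (x : X) (a : A) : usmall (fun k => x k ** a).
Proof.
by apply: (usmall_le (sqr_ge0 (nrm a)) (dsum_small x)) => F v; exact: qsumM.
Qed.
Definition dract (x : X) (a : A) : X := mkdsum (dract_in x a) (dract_small x a).

Fact dractDl (x y : X) a : dract (x + y) a = dract x a + dract y a.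
Proof. by apply: dsum_ext => k; exact: cmulDl. Qed.
Fact dractDr (x : X) a b : dract x (a + b) = dract x a + dract x b.
Proof. by apply: dsum_ext => k; exact: cmulDr. Qed.
Fact dractM (x : X) a b : dract x (a ** b) = dract (dract x a) b.
Proof. by apply: dsum_ext => k; exact: cmulA. Qed.
Fact dractZl (c : R[i]) (x : X) a : dract (c *: x) a = c *: dract x a.
Proof. by apply: dsum_ext => k; exact: cmulZl. Qed.
Fact dractZr (c : R[i]) (x : X) a : dract x (c *: a) = c *: dract x a.
Proof. by apply: dsum_ext => k; exact: cmulZr. Qed.

Lemma gramMr (x y : K -> A) a F : gram x (fun k => y k ** a) F = gram x y F ** a.
Proof.
apply: ev_ext => v; rewrite evM !ev_gram mulr_suml.
by apply: eq_bigr => k _; rewrite evM mulrA.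
Qed.

Fact dip_ract (x y : X) a : dip x (dract y a) = dip x y ** a.
Proof.
apply: dip_unique; apply/cvg_nrmP => e e0.
have a1 : 0 < nrm a + 1 by rewrite ltr_wpDl ?nrm_ge0.
have /cvg_nrmP/(_ _ (divr_gt0 e0 a1)) := @dip_cvg _ _ _ _ _ x y.
apply: filterS => F /= h; rewrite gramMr.
have -> : dip x y ** a - gram x y F ** a = (dip x y - gram x y F) ** a.
  by apply: ev_ext => v; rewrite evB !evM evB mulrBl.
apply: le_trans (nrmM _ _) _.
apply: (@le_trans _ _ (e / (nrm a + 1) * (nrm a + 1))).
  by rewrite ler_pM ?nrm_ge0// lerDl.
by rewrite divfK// gt_eqF.
Qed.

Fact dip_norm (x : X) : `|x| ^+ 2 = `|dip x x|.
Proof.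
rewrite !nrmE -rmorphXn nrm_dsum; congr (_%:C).
by rewrite sqr_sqrtr// nrm_ge0.
Qed.

HB.instance Definition _ := CompleteNormedModule_isHilbertModule.Build R A (dsum I)
  dractDl dractDr dractM dractZl dractZr (@dipDr _ _ _ _ I) (@dipZr _ _ _ _ I)
  dip_ract (@dip_star _ _ _ _ I) dsum_ip_pos dip_norm.

End DirectSumModule.

Record labelledGraph (L : countType) := LabelledGraph {
  vertex : Type;
  edge : Type;
  src : edge -> vertex;
  rng : edge -> vertex;
  lab : edge -> L;
  lab_surj : forall a, exists e, lab e = a
}.

Section LabelledGraphs.
Variables (L : countType) (E : labelledGraph L).
Implicit Types (A B : set (vertex E)) (w : seq L).

(* Paths have length at least 1, so a path is given by its first edge [e] and
   the list [q] of the other edges. *)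
Definition is_path (e : edge E) (q : seq (edge E)) : bool :=
  path (fun f g => `[< rng f = src g >]) e q.

Definition words : set (seq L) :=
  [set w | exists e q, is_path e q /\ [seq lab f | f <- e :: q] = w].

Definition word_range w : set (vertex E) :=
  [set v | exists e q,
    [/\ is_path e q, [seq lab f | f <- e :: q] = w & rng (last e q) = v]].

Definition rel_range A w : set (vertex E) :=
  [set v | exists e q, [/\ is_path e q, [seq lab f | f <- e :: q] = w,
    A (src e) & rng (last e q) = v]].

Definition labels_from A : set L := [set lab e | e in [set e | A (src e)]].

Definition sinks : set (vertex E) := [set v | forall e : edge E, src e <> v].

Record accommodating (BB : set (set (vertex E))) : Prop := {
  acc_word : forall w, words w -> BB (word_range w);
  acc_rel : forall A w, BB A -> words w -> BB (rel_range A w);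
  acc_cap : forall A B, BB A -> BB B -> BB (A `&` B);
  acc_cup : forall A B, BB A -> BB B -> BB (A `|` B)
}.

End LabelledGraphs.

Arguments sinks {L} E _.

Record labelledSpace (L : countType) := LabelledSpace {
  lgraph :> labelledGraph L;
  lsets : set (set (vertex lgraph));
  lsets_acc : accommodating lsets
}.

Definition normal_space (L : countType) (S : labelledSpace L) : Prop :=
  forall A B : set (vertex S), lsets A -> lsets B -> lsets (A `\` B).

Definition weakly_left_resolving (L : countType) (S : labelledSpace L) : Prop :=
  forall (A B : set (vertex S)) w, lsets A -> lsets B -> words S w ->
    rel_range A w `&` rel_range B w = rel_range (A `&` B) w.

Record wlrNormalSpace (L : countType) := WlrNormalSpace {
  lspace :> labelledSpace L;
  lspace_normal : normal_space lspace;
  lspace_wlr : weakly_left_resolving lspace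
}.

Section LabelledSpaces.
Variables (L : countType) (S : wlrNormalSpace L).

Record bset := Bset {
  bset_val :> set (vertex S);
  bsetP : lsets bset_val
}.

Lemma letter_word a : words S [:: a].
Proof. by have [e ea] := lab_surj S a; exists e, [::]; rewrite /= ea. Qed.

Definition bcap (A B : bset) : bset :=
  Bset (acc_cap (lsets_acc S) (bsetP A) (bsetP B)).

Definition bcup (A B : bset) : bset :=
  Bset (acc_cup (lsets_acc S) (bsetP A) (bsetP B)).

Definition brange (a : L) : bset :=
  Bset (acc_word (lsets_acc S) (letter_word a)).

Definition brel_range (A : bset) (a : L) : bset :=
  Bset (acc_rel (lsets_acc S) (bsetP A) (letter_word a)).

Record labelled_rep (R : realType) (Y : cstarAlgType R) (p : bset -> Y)
    (s : L -> Y) : Prop := {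
  lrep_proj : forall A, star (p A) = p A /\ p A ** p A = p A;
  lrep_pisom : forall a, s a ** star (s a) ** s a = s a;
  lrep_cap : forall A B, p A ** p B = p (bcap A B);
  lrep_cup : forall A B, p (bcup A B) = p A + p B - p (bcap A B);
  lrep_empty : forall A : bset, A = set0 :> set _ -> p A = 0;
  lrep_comm : forall A a, p A ** s a = s a ** p (brel_range A a);
  lrep_source : forall a, star (s a) ** s a = p (brange a);
  lrep_orth : forall a b, a <> b -> star (s a) ** s b = 0;
  lrep_sum : forall A : bset, finite_set (labels_from A) ->
    (forall B : bset, B `<=` sinks S -> A `&` B = set0) ->
    p A = \sum_(a \in labels_from A) s a ** p (brel_range A a) ** star (s a)
}.

Record is_labelled_cstar (R : realType) (C : cstarAlgType R) (p : bset -> C)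
    (s : L -> C) : Prop := {
  lc_rep : labelled_rep p s;
  lc_gen : cstar_gen (range p `|` range s) = setT;
  lc_univ : forall (Y : cstarAlgType R) (p' : bset -> Y) (s' : L -> Y),
    labelled_rep p' s' ->
    exists2 rho : C -> Y, star_hom rho & p' = rho \o p /\ s' = rho \o s
}.

End LabelledSpaces.

Section LabelledCorrespondence.
Variables (R : realType) (L : countType) (S : wlrNormalSpace L).
Local Open Scope complex_scope.

Fact char_fun_subproof (A : set (vertex S)) :
  exists M : R, forall v, cabs ((v \in A)%:R : R[i]) <= M.
Proof. by exists 1 => v; case: (v \in A); rewrite ?cabs0 ?cabs1. Qed.
Definition char_fun (A : set (vertex S)) : linfty R (vertex S) :=
  Linfty (char_fun_subproof A).

Definition lalg : cstarAlgType R :=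
  subcstar (gen_subalg [set char_fun A | A in @lsets _ S]).

Fact chi_subproof (A : bset S) :
  cstar_gen [set char_fun A | A in @lsets _ S] (char_fun A).
Proof. by move=> D [_]; apply; exists A => //; exact: bsetP. Qed.
Definition chi (A : bset S) : lalg :=
  @Subcstar _ _ (gen_subalg [set char_fun A | A in @lsets _ S]) _
    (chi_subproof A).

Definition lideal (a : L) : closedIdeal lalg := gen_ideal [set chi (brange S a)].

End LabelledCorrespondence.

Section LeftAction.
Variables (R : realType) (L : countType) (S : wlrNormalSpace L).
Local Notation V := (vertex S).
Local Notation A := (lalg R S).
Local Notation chi := (chi R).
Local Open Scope complex_scope.

Lemma ev_chi (B : bset S) v : ev (chi B : A) v = (v \in bset_val B)%:R.
Proof. by []. Qed.

Section Letter.
Variable a : L.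

Definition umem (v : V) (B : set V) : Prop := lsets B /\ rel_range B [:: a] v.

Lemma umemI v B B' : umem v B -> umem v B' -> umem v (B `&` B').
Proof.
move=> [hB vB] [hB' vB']; split; first exact: (acc_cap (lsets_acc S)).
by rewrite -(lspace_wlr hB hB' (letter_word S a)).
Qed.

Lemma umem_ne v B : umem v B -> exists x, B x.
Proof. by move=> [_ [e [q [_ _ Be _]]]]; exists (src e). Qed.

Lemma umem_range v B : umem v B -> word_range [:: a] v.
Proof. by move=> [_ [e [q [h1 h2 _ h3]]]]; exists e, q. Qed.

Lemma umem_dich v B C : umem v B -> lsets C ->
  umem v C \/ (umem v (B `\` C) /\ ~ rel_range C [:: a] v).
Proof.
move=> [hB [e [q [h1 h2 h3 h4]]]] hC.
case: (pselect (rel_range C [:: a] v)) => vC; first by left.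
right; split=> //; split; first exact: lspace_normal.
exists e, q; split=> //; split=> // Ce; apply: vC; by exists e, q.
Qed.

(* At each vertex [v], [g v] is the limit of [f] along the filter
   of the sets [B] with [v] in [rel_range B a], and 0 if there are none. *)
Definition pull (f : linfty R V) (g : A) : Prop := forall v,
  ((exists B, umem v B) -> forall e : R, 0 < e ->
     exists2 B, umem v B & forall x, B x -> cabs (f x - ev g v) <= e) /\
  ((forall B, ~ umem v B) -> ev g v = 0).

Lemma pull_case v : (exists B, umem v B) \/ (forall B, ~ umem v B).
Proof.
by case: (pselect (exists B, umem v B)) => h; [left | right; exact/forallNP].
Qed.

Lemma pull_dist f g f' g' (M : R) : pull f g -> pull f' g' -> 0 <= M ->
  (forall x, cabs (f x - f' x) <= M) -> nrm (g - g') <= M.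
Proof.
move=> fg fg' M0 fM; apply: le_nrm => // v; rewrite evB.
have [[h1 h2] [h1' h2']] := (fg v, fg' v).
case: (pull_case v) => [U|U]; last by rewrite h2// h2'// subr0 cabs0.
apply/ler_addgt0Pr => e e0; have e20 : 0 < e / 2 by rewrite divr_gt0.
have [B UB hB] := h1 U _ e20; have [B' UB' hB'] := h1' U _ e20.
have [x [Bx B'x]] := umem_ne (umemI UB UB').
have -> : ev g v - ev g' v =
  (f x - f' x) + ((f' x - ev g' v) - (f x - ev g v)) by ring.
apply: le_trans (cabsD _ _) _; rewrite lerD//.
apply: le_trans (cabsD _ _) _; rewrite cabsN [e]splitr lerD//; first exact: hB'.
exact: hB.
Qed.

Lemma pull_unique f g g' : pull f g -> pull f g' -> g = g'.
Proof.
move=> fg fg'; apply/eqP; rewrite -subr_eq0; apply/eqP/nrm0_eq0/le_anti.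
rewrite nrm_ge0 andbT; apply: (pull_dist fg fg') => // x.
by rewrite subrr cabs0.
Qed.

Lemma pull0 : pull 0 0.
Proof.
move=> v; split=> [[B UB] e e0|//].
by exists B => // x _; rewrite ev0 /= subrr cabs0 ltW.
Qed.

Lemma pullD f g f' g' : pull f g -> pull f' g' -> pull (f + f') (g + g').
Proof.
move=> fg fg' v; have [[h1 h2] [h1' h2']] := (fg v, fg' v); split.
  move=> U e e0; have e20 : 0 < e / 2 by rewrite divr_gt0.
  have [B UB hB] := h1 U _ e20; have [B' UB' hB'] := h1' U _ e20.
  exists (B `&` B'); first exact: umemI.
  move=> x [Bx B'x]; rewrite evD.
  have -> : (f + f') x - (ev g v + ev g' v) =
    (f x - ev g v) + (f' x - ev g' v).
    have -> : (f + f') x = f x + f' x by []. ring.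
  by apply: le_trans (cabsD _ _) _; rewrite [e]splitr lerD ?hB ?hB'.
by move=> U; rewrite evD h2// h2'// addr0.
Qed.

Lemma pullZ (c : R[i]) f g : pull f g -> pull (c *: f) (c *: g).
Proof.
move=> fg v; have [h1 h2] := fg v; split; last by move=> U; rewrite evZ h2// mulr0.
move=> U e e0; have c1 : 0 < cabs c + 1 by rewrite ltr_wpDl ?cabs_ge0.
have [B UB hB] := h1 U _ (divr_gt0 e0 c1); exists B => // x Bx; rewrite evZ.
have -> : (c *: f) x = c * f x by [].
rewrite -mulrBr cabsM.
apply: (@le_trans _ _ ((cabs c + 1) * (e / (cabs c + 1)))).
  by rewrite ler_pM ?cabs_ge0 ?lerDl// hB.
by rewrite mulrCA divff ?mulr1// gt_eqF.
Qed.

Lemma pullM f g f' g' : pull f g -> pull f' g' -> pull (f ** f') (g ** g').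
Proof.
move=> fg fg' v; have [[h1 h2] [h1' h2']] := (fg v, fg' v); split; last first.
  by move=> U; rewrite evM h2// mul0r.
move=> U e e0.
pose M := supnorm f + cabs (ev g' v) + 1.
have M0 : 0 < M by rewrite ltr_wpDl// addr_ge0 ?supnorm_ge0 ?cabs_ge0.
have d0 : 0 < e / (M * 2) by rewrite divr_gt0// mulr_gt0.
have [B UB hB] := h1 U _ d0; have [B' UB' hB'] := h1' U _ d0.
exists (B `&` B'); first exact: umemI.
move=> x [Bx B'x]; rewrite evM.
have -> : (f ** f') x - ev g v * ev g' v =
  f x * (f' x - ev g' v) + ev g' v * (f x - ev g v).
  have -> : (f ** f') x = f x * f' x by []. ring.
apply: le_trans (cabsD _ _) _; rewrite !cabsM.
have -> : e = M * (e / (M * 2)) + M * (e / (M * 2)).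
  by field; rewrite gt_eqF.
have c1 := cabs_ge0 (ev g' v); have c2 := supnorm_ge0 f.
have c3 := le_supnorm f x.
rewrite lerD// ler_pM ?cabs_ge0 ?hB ?hB'// /M.
  by apply: le_trans c3 _; lra.
lra.
Qed.

Lemma pullS f g : pull f g -> pull (star f) (star g).
Proof.
move=> fg v; have [h1 h2] := fg v; split; last first.
  by move=> U; rewrite evS h2// rmorph0.
move=> U e e0; have [B UB hB] := h1 U _ e0; exists B => // x /hB.
by rewrite evS -[X in X <= _]cabsJ rmorphB.
Qed.

Lemma pull_chi (B : bset S) : pull (char_fun R B) (chi (brel_range B a)).
Proof.
move=> v; split; last first.
  move=> U; rewrite ev_chi; case: (boolP (v \in _)) => //.
  by rewrite inE /= => vB; case: (U B); split=> //; exact: bsetP.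
move=> [C UC] e e0; rewrite ev_chi.
case: (umem_dich UC (bsetP B)) => [UB|[UB vB]].
  exists B => // x Bx; rewrite /= mem_set// mem_set /=; last by case: UB.
  by rewrite subrr cabs0 ltW.
exists (C `\` B) => // x [_ Bx]; rewrite /= memNset// memNset//.
by rewrite subrr cabs0 ltW.
Qed.

Lemma pull_closed : closed [set f | exists g, pull f g].
Proof.
apply/closed_nrmP => f hf.
have {}hf n : exists fg : linfty R V * A,
    pull fg.1 fg.2 /\ nrm (f - fg.1) <= (n.+1%:R)^-1.
  have n0 : 0 < (n.+1%:R)^-1 :> R by rewrite invr_gt0 ltr0n.
  by have [f' [g' h] h'] := hf _ n0; exists (f', g').
have [u hu] := choice hf.
have ffu n x : cabs (f x - (u n).1 x) <= (n.+1%:R)^-1.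
  by apply: le_trans (hu n).2; exact: (le_supnorm (f - (u n).1)).
have small (e : R) : 0 < e -> exists N, forall n, (N <= n)%N ->
    (n.+1%:R)^-1 <= e.
  move=> e0; exists (Num.bound e^-1) => n Nn.
  rewrite -[e]invrK lef_pV2 ?posrE ?invr_gt0 ?ltr0n//.
  have ei : 0 <= e^-1 by rewrite invr_ge0 ltW.
  by apply: (le_trans (ltW (archi_boundP ei))); rewrite ler_nat ltnW.
have : cvg ((fun n => (u n).2) @ \oo).
  apply/cauchy_cvgP/cauchy_nrmP => e e0.
  have [N hN] := small _ (divr_gt0 e0 (ltr0n R 2)).
  exists (u N).2; exists N => // n /= Nn.
  apply: (pull_dist (hu N).1 (hu n).1); first exact: ltW.
  move=> x; have -> : (u N).1 x - (u n).1 x =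
      (f x - (u n).1 x) - (f x - (u N).1 x) by ring.
  apply: le_trans (cabsD _ _) _; rewrite cabsN [e]splitr lerD//.
    by apply: le_trans (ffu _ _) _; exact: hN.
  by apply: le_trans (ffu _ _) _; exact: hN.
move/cvg_ex => [g /cvg_nrmP hg]; exists g => v.
have near3 e : 0 < e -> exists2 n, nrm (g - (u n).2) <= e &
    forall x, cabs (f x - (u n).1 x) <= e.
  move=> e0; have [N hN] := small _ e0; have [N' _ hN'] := hg _ e0.
  exists (maxn N N') => [|x]; first by apply: hN'; exact: leq_maxr.
  by apply: le_trans (ffu _ _) _; apply: hN; exact: leq_maxl.
split=> U; last first.
  apply/cabs0_eq0/le_anti; rewrite cabs_ge0 andbT.
  apply/ler_addgt0Pr => e e0; rewrite add0r.
  have [n gn _] := near3 _ e0; apply: le_trans gn.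
  rewrite -[ev g v]subr0 -(((hu n).1 v).2 U) -evB; exact: ev_le.
move=> e e0; have e30 : 0 < e / 3 by rewrite divr_gt0.
have [n gn fn] := near3 _ e30.
have [B UB hB] := ((hu n).1 v).1 U _ e30; exists B => // x Bx.
have -> : f x - ev g v = (f x - (u n).1 x) +
   (((u n).1 x - ev (u n).2 v) - ev (g - (u n).2) v) by rewrite evB; ring.
apply: le_trans (cabsD _ _) _.
have h1 := fn x; have h2 := le_trans (ev_le _ v) gn; have h3 := hB _ Bx.
have h4 := cabsD ((u n).1 x - ev (u n).2 v) (- ev (g - (u n).2) v).
rewrite cabsN in h4; lra.
Qed.

Lemma pull_ex (f : A) : exists g, pull (sc_val f) g.
Proof.
pose P := [set f | exists g, pull f g].
suff h : cstar_gen [set char_fun R B | B in @lsets _ S] `<=` P.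
  by case: f => f Pf; exact: h.
apply: smallest_sub; last first.
  by move=> _ [B hB <-]; exists (chi (brel_range (Bset hB) a)); exact: (pull_chi (Bset hB)).
split.
- by exists 0; exact: pull0.
- by move=> f1 f2 [g1 h1] [g2 h2]; exists (g1 + g2); exact: pullD.
- by move=> c f1 [g1 h1]; exists (c *: g1); exact: pullZ.
- by move=> f1 f2 [g1 h1] [g2 h2]; exists (g1 ** g2); exact: pullM.
- by move=> f1 [g1 h1]; exists (star g1); exact: pullS.
- exact: pull_closed.
Qed.

Lemma chi_in_lideal : ideal_set (lideal R S a) (chi (brange S a)).
Proof. by move=> J [_]; apply. Qed.

Record letter_hom (phi : A -> A) : Prop := {
  letter_star_hom : star_hom phi;
  letter_lideal : forall f, ideal_set (lideal R S a) (phi f);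
  letter_chi : forall B, phi (chi B) = chi (brel_range B a)
}.

Lemma letter_hom_ex : exists phi, letter_hom phi /\ forall f, nrm (phi f) <= nrm f.
Proof.
have [phi hphi] := choice pull_ex; exists phi; split; last first.
  move=> f; rewrite -[phi f]subr0.
  apply: (pull_dist (hphi f) pull0); first exact: nrm_ge0.
  by move=> x; rewrite subr0; exact: (le_supnorm (sc_val f)).
split.
- split.
  + move=> f g; apply: (pull_unique (hphi _)); exact: (pullD (hphi f) (hphi g)).
  + move=> c f; apply: (pull_unique (hphi _)); exact: (pullZ c (hphi f)).
  + move=> f g; apply: (pull_unique (hphi _)); exact: (pullM (hphi f) (hphi g)).
  + move=> f; apply: (pull_unique (hphi _)); exact: (pullS (hphi f)).
- move=> f; have -> : phi f = phi f ** chi (brange S a).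
    apply: ev_ext => v; rewrite evM ev_chi.
    case: (pull_case v) => [[B /umem_range vB]|U].
      by rewrite mem_set ?mulr1.
    by rewrite (hphi f v).2// mul0r.
  by apply: (cidealMl (cidealP _)); exact: chi_in_lideal.
- by move=> B; apply: (pull_unique (hphi _)); exact: pull_chi.
Qed.

(* There is only one *-homomorphism satisfying [letter_hom], because
   *-homomorphisms are contractive and the [chi B] generate. *)
Definition letter_map : A -> A := sval (cid letter_hom_ex).

Lemma letter_mapP : letter_hom letter_map.
Proof. by rewrite /letter_map; case: cid => phi []. Qed.

Lemma letter_map_nrm f : nrm (letter_map f) <= nrm f.
Proof. by rewrite /letter_map; case: cid => phi []. Qed.

End Letter.

Definition lmodule : Type := dsum (lideal R S).

HB.instance Definition _ := HilbertModule.on lmodule.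

Fact lact_in (f : A) (x : lmodule) a :
  ideal_set (lideal R S a) (letter_map a f ** dval x a).
Proof. by apply: (cidealMl (cidealP _)); exact: dval_in. Qed.

Fact lact_small (f : A) (x : lmodule) :
  usmall (fun a => letter_map a f ** dval x a).
Proof.
apply: (usmall_le (sqr_ge0 (nrm f)) (dsum_small x)) => F v.
rewrite /qsum mulr_sumr; apply: ler_sum => a _.
rewrite evM cabsM exprMn ler_wpM2r ?sqr_ge0//.
rewrite lerXn2r ?nnegrE ?cabs_ge0 ?nrm_ge0//.
by apply: le_trans (ev_le _ _) (letter_map_nrm _ _).
Qed.

Definition left_action (f : A) (x : lmodule) : lmodule :=
  mkdsum (lact_in f x) (lact_small f x).

Fact left_actionD (f g : A) (x : lmodule) :
  left_action (f + g) x = left_action f x + left_action g x.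
Proof.
apply: dsum_ext => a /=; rewrite (star_homD (letter_star_hom (letter_mapP a))).
exact: cmulDl.
Qed.

Fact left_actionZ (c : R[i]) (f : A) (x : lmodule) :
  left_action (c *: f) x = c *: left_action f x.
Proof.
apply: dsum_ext => a /=; rewrite (star_homZ (letter_star_hom (letter_mapP a))).
exact: cmulZl.
Qed.

Fact left_actionM (f g : A) (x : lmodule) :
  left_action (f ** g) x = left_action f (left_action g x).
Proof.
apply: dsum_ext => a /=; rewrite (star_homM (letter_star_hom (letter_mapP a))).
exact/esym/cmulA.
Qed.

Fact left_action_adj (f : A) (x y : lmodule) :
  ip (left_action f x) y = ip x (left_action (star f) y) :> A.
Proof.
congr (lim (_ @ totally)); apply/funext => F; apply: ev_ext => v.
rewrite !ev_gram; apply: eq_bigr => a _ /=.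
rewrite (star_homS (letter_star_hom (letter_mapP a))) !evM evS rmorphM.
by rewrite mulrCA mulrA.
Qed.

HB.instance Definition _ := HilbertModule_isCorrespondence.Build R A lmodule
  left_actionD left_actionZ left_actionM left_action_adj.

Section Delta.
Variable a : L.

Definition delta_fam (b : L) : A := if b == a then chi (brange S a) else 0.

Fact delta_in b : ideal_set (lideal R S b) (delta_fam b).
Proof.
rewrite /delta_fam; case: eqP => [->|_]; first exact: chi_in_lideal.
exact: (cideal0 (cidealP _)).
Qed.

Fact delta_small : usmall delta_fam.
Proof.
move=> e e0; exists [fset a]%fset => F v; rewrite /qsum big_seq big1 ?ltW// => b.
by rewrite in_fsetD1 /delta_fam => /andP[/negPf-> _]; rewrite ev0 cabs0 expr0n.
Qed.

Definition delta : lmodule := mkdsum delta_in delta_small.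

End Delta.

End LeftAction.

(* Main.v *)
(* A *-homomorphism f is contractive: if b is self-adjoint and |b| < 1, the
   iteration h := (b^2 + h^2)/2 yields a self-adjoint h commuting with b such
   that b^2 + (1 - h)^2 = 1, so f b is half the sum of the two unitaries
   f b +- i (1 - f h).  Contractivity turns every isometric formula on a dense
   set into a map: pi is determined by sum c_i chi_{B_i} |-> sum c_i p_{B_i}
   (make the B_i disjoint; sampling functions at points of the B_i is then a
   *-homomorphism), and t by sum e_a f_a |-> sum s_a pi(f_a).

   For the induced map on compact operators, u = sum t(x_i) t(y_i)^* satisfies
   u t(z) = t(T z), so the powers (u^* u)^n are bounded by M (2 |T|^2)^n and
   therefore |u| <= 2 |T|; the constant 2 comes from a crude Cauchy-Schwarz
   inequality and is harmless.

   Call B regular if it satisfies the hypotheses of relation (iv).  Then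
   lact chi_B is the finite sum of the theta_{e_a chi_{r(B,a)}, e_a}, so that
   covariance at chi_B is relation (iv).  Moreover chi_B is in the Katsura
   ideal J for B regular, and each f in J is a uniform limit of simple
   functions over regular sets: where f is close to a constant c <> 0 on B,
   compactness of lact f leaves finitely many labels on B, and a set of sinks
   C has lact chi_C = 0, hence f chi_C = 0 and B does not meet C. *)
Require Import Defs.
From HB Require Import structures.
From mathcomp Require Import all_boot all_order all_algebra finmap.
From mathcomp Require Import all_classical all_reals topology normedtype sequences.
From mathcomp Require Import complex.

From mathcomp Require Import ring lra.

Set Implicit Arguments.
Unset Strict Implicit.
Unset Printing Implicit Defensive.

Import Order.TTheory GRing.Theory Num.Theory numFieldNormedType.Exports.

Local Open Scope classical_set_scope.
Local Open Scope ring_scope.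
Local Open Scope complex_scope.

(** * C*-algebras and *-homomorphisms *)

Section CstarAlgebra.
Variables (R : realType) (A : cstarAlgType R).
Implicit Types x y z : A.

Lemma cmul0l x : 0 ** x = 0.
Proof. by apply: (@addIr _ (0 ** x)); rewrite -cmulDl !add0r. Qed.

Lemma cmul0r x : x ** 0 = 0.
Proof. by apply: (@addIr _ (x ** 0)); rewrite -cmulDr !add0r. Qed.

Lemma cmulNl x y : (- x) ** y = - (x ** y).
Proof. by rewrite -scaleN1r cmulZl scaleN1r. Qed.

Lemma cmulNr x y : x ** (- y) = - (x ** y).
Proof. by rewrite -scaleN1r cmulZr scaleN1r. Qed.

Lemma cmulBl x y z : (x - y) ** z = x ** z - y ** z.
Proof. by rewrite cmulDl cmulNl. Qed.

Lemma cmulBr x y z : x ** (y - z) = x ** y - x ** z.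
Proof. by rewrite cmulDr cmulNr. Qed.

Lemma cmul_suml (I : Type) (s : seq I) (f : I -> A) y :
  (\sum_(i <- s) f i) ** y = \sum_(i <- s) f i ** y.
Proof. by elim: s => [|i s ih]; rewrite ?big_nil ?cmul0l// !big_cons cmulDl ih. Qed.

Lemma cmul_sumr (I : Type) (s : seq I) (f : I -> A) y :
  y ** (\sum_(i <- s) f i) = \sum_(i <- s) y ** f i.
Proof. by elim: s => [|i s ih]; rewrite ?big_nil ?cmul0r// !big_cons cmulDr ih. Qed.

Lemma star0 : star 0 = 0 :> A.
Proof. by apply: (@addIr _ (star 0)); rewrite -starD !add0r. Qed.

Lemma starN x : star (- x) = - star x.
Proof. by rewrite -scaleN1r starZ rmorphN rmorph1 scaleN1r. Qed.

Lemma starB x y : star (x - y) = star x - star y.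
Proof. by rewrite starD starN. Qed.

Lemma star_sum (I : Type) (s : seq I) (f : I -> A) :
  star (\sum_(i <- s) f i) = \sum_(i <- s) star (f i).
Proof. by elim: s => [|i s ih]; rewrite ?big_nil ?star0// !big_cons starD ih. Qed.

Lemma nrm_cstar x : nrm (star x ** x) = nrm x ^+ 2.
Proof. by apply: (@complexI R); rewrite rmorphXn /= -!nrmE cstar_norm. Qed.

End CstarAlgebra.

Section StarHom.
Variables (R : realType) (A B : cstarAlgType R) (f : A -> B).
Hypothesis fH : star_hom f.

Lemma star_hom0 : f 0 = 0.
Proof. by apply: (@addIr _ (f 0)); rewrite -(star_homD fH) !add0r. Qed.

Lemma star_homN x : f (- x) = - f x.
Proof. by rewrite -scaleN1r (star_homZ fH) scaleN1r. Qed.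

Lemma star_homB x y : f (x - y) = f x - f y.
Proof. by rewrite (star_homD fH) star_homN. Qed.

Lemma star_hom_sum (I : Type) (s : seq I) (g : I -> A) :
  f (\sum_(i <- s) g i) = \sum_(i <- s) f (g i).
Proof.
by elim: s => [|i s ih]; rewrite ?big_nil ?star_hom0// !big_cons (star_homD fH) ih.
Qed.

End StarHom.

Lemma star_hom_comp (R : realType) (A B C : cstarAlgType R) (f : B -> C) (g : A -> B) :
  star_hom f -> star_hom g -> star_hom (f \o g).
Proof.
move=> fH gH; split=> [x y|c x|x y|x] /=.
- by rewrite (star_homD gH) (star_homD fH).
- by rewrite (star_homZ gH) (star_homZ fH).
- by rewrite (star_homM gH) (star_homM fH).
- by rewrite (star_homS gH) (star_homS fH).
Qed.

(** * Sequential limits, and Lipschitz extension from a dense family *)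

Section Limits.
Variable R : realType.

Lemma nrm_le_eq (V : normedModType R[i]) (x y : V) :
  (forall e : R, 0 < e -> nrm (x - y) <= e) -> x = y.
Proof.
move=> h; apply/eqP; rewrite -subr_eq0; apply/eqP/nrm0_eq0/le_anti.
rewrite nrm_ge0 andbT; apply/ler_addgt0Pr => e e0; rewrite add0r; exact: h.
Qed.

Lemma inv_small (e : R) : 0 < e ->
  exists N, forall n, (N <= n)%N -> (n.+1%:R)^-1 <= e.
Proof.
move=> e0; exists (Num.bound e^-1) => n Nn.
rewrite -[e]invrK lef_pV2 ?posrE ?invr_gt0 ?ltr0n//.
have ei : 0 <= e^-1 by rewrite invr_ge0 ltW.
by apply: (le_trans (ltW (archi_boundP ei))); rewrite ler_nat ltnW.
Qed.

Lemma cvg_seq_nrmP (V : normedModType R[i]) (u : nat -> V) (l : V) :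
  u n @[n --> \oo] --> l <->
  forall e : R, 0 < e -> \forall n \near \oo, nrm (l - u n) <= e.
Proof. exact: cvg_nrmP. Qed.

Lemma cvg_seq_unique (V : normedModType R[i]) (u : nat -> V) (l l' : V) :
  u n @[n --> \oo] --> l -> u n @[n --> \oo] --> l' -> l = l'.
Proof. by apply: cvg_unique; exact: norm_hausdorff. Qed.

Lemma cvg_lip (V W : normedModType R[i]) (u : nat -> V) (l : V)
    (w : nat -> W) (m : W) (C : R) :
  (forall n, nrm (m - w n) <= C * nrm (l - u n)) ->
  u n @[n --> \oo] --> l -> w n @[n --> \oo] --> m.
Proof.
move=> h /cvg_seq_nrmP ul; apply/cvg_seq_nrmP => e e0.
have C1 : 0 < `|C| + 1 by rewrite ltr_wpDl.
apply: filterS (ul _ (divr_gt0 e0 C1)) => n /= un.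
apply: le_trans (h n) _; apply: le_trans (ler_wpM2r (nrm_ge0 _) (ler_norm _)) _.
apply: (@le_trans _ _ ((`|C| + 1) * (e / (`|C| + 1)))).
  by rewrite ler_pM ?nrm_ge0// lerDl.
by rewrite mulrCA divff ?mulr1// gt_eqF.
Qed.

Lemma cvg_star (A : cstarAlgType R) (u : nat -> A) (l : A) :
  u n @[n --> \oo] --> l -> star (u n) @[n --> \oo] --> star l.
Proof. by apply: (cvg_lip (C := 1)) => n; rewrite -starB nrm_star mul1r. Qed.

Lemma cvg_scale (V : normedModType R[i]) (u : nat -> V) (l : V) (c : R[i]) :
  u n @[n --> \oo] --> l -> c *: u n @[n --> \oo] --> c *: l.
Proof. by apply: (cvg_lip (C := cabs c)) => n; rewrite -scalerBr nrmZ. Qed.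

Lemma cvg_nrm_bounded (V : normedModType R[i]) (u : nat -> V) (l : V) :
  u n @[n --> \oo] --> l -> \forall n \near \oo, nrm (u n) <= nrm l + 1.
Proof.
move=> /cvg_seq_nrmP/(_ 1 ltr01); apply: filterS => n /= h.
rewrite -[u n](subrK l) addrC; apply: le_trans (nrmD _ _) _.
by rewrite lerD2l nrmB.
Qed.

Lemma cvg_cmul (A : cstarAlgType R) (u v : nat -> A) (l m : A) :
  u n @[n --> \oo] --> l -> v n @[n --> \oo] --> m ->
  u n ** v n @[n --> \oo] --> l ** m.
Proof.
move=> ul vm; apply/cvg_seq_nrmP => e e0.
pose K := nrm l + nrm m + 1.
have [l0 m0] := (nrm_ge0 l, nrm_ge0 m).
have K0 : 0 < K by rewrite /K; lra.
have d0 : 0 < e / (2 * K) by rewrite divr_gt0// mulr_gt0.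
have /cvg_seq_nrmP/(_ _ d0) h1 := ul; have /cvg_seq_nrmP/(_ _ d0) h2 := vm.
near=> n.
have -> : l ** m - u n ** v n = l ** (m - v n) + (l - u n) ** v n.
  by rewrite cmulBr cmulBl addrA subrK.
apply: le_trans (nrmD _ _) _.
have -> : e = K * (e / (2 * K)) + e / (2 * K) * K.
  by field; rewrite gt_eqF.
rewrite lerD//; apply: le_trans (nrmM _ _) _; rewrite ler_pM ?nrm_ge0//.
- by rewrite /K -addrA lerDl addr_ge0.
- by near: n; exact: h2.
- by near: n; exact: h1.
- apply: (@le_trans _ _ (nrm m + 1)); last by rewrite /K; lra.
  near: n; exact: cvg_nrm_bounded vm.
Unshelve. all: by end_near. Qed.

(** The indices themselves are returned, so that the same sequence of indices can afterwards be
    evaluated by another family. *)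
Lemma approx_seq (V : normedModType R[i]) (I : Type) (v : I -> V) (x : V) :
  (forall e : R, 0 < e -> exists i, nrm (x - v i) <= e) ->
  exists i : nat -> I, v (i n) @[n --> \oo] --> x.
Proof.
move=> h; have hn n : exists i, nrm (x - v i) <= (n.+1%:R)^-1.
  by apply: h; rewrite invr_gt0 ltr0n.
have [i hi] := choice hn; exists i; apply/cvg_seq_nrmP => e /inv_small[N hN].
by exists N => // n /= Nn; apply: le_trans (hi n) (hN n Nn).
Qed.

(* [P e i] reads "[i] is an [e]-approximation of the point at which the value
   of a Lipschitz extension is sought". *)
Lemma lipschitz_limit (Y : completeNormedModType R[i]) (I : Type)
    (P : R -> I -> Prop) (u : I -> Y) (K : R) : 0 <= K ->
  (forall e, 0 < e -> exists i, P e i) ->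
  (forall d e i j, P d i -> P e j -> nrm (u i - u j) <= K * (d + e)) ->
  exists y, forall e i, P e i -> nrm (y - u i) <= K * e.
Proof.
move=> K0 ex lip; have hn n : exists i, P (n.+1%:R)^-1 i.
  by apply: ex; rewrite invr_gt0 ltr0n.
have [i hi] := choice hn.
have K1 : 0 < K + 1 by rewrite ltr_wpDl.
have small e : 0 < e -> exists N, forall n, (N <= n)%N -> K * (n.+1%:R)^-1 <= e.
  move=> e0; have [N hN] := inv_small (divr_gt0 e0 K1); exists N => n Nn.
  apply: (@le_trans _ _ ((K + 1) * (e / (K + 1)))).
    by rewrite ler_pM ?hN ?invr_ge0 ?ler0n// lerDl.
  by rewrite mulrCA divff ?mulr1// gt_eqF.
have : cvg ((u \o i) @ \oo).
  apply/cauchy_cvgP/cauchy_nrmP => e e0.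
  have [N hN] := small _ (divr_gt0 e0 (ltr0n R 2)).
  exists (u (i N)); exists N => // n /= Nn.
  apply: le_trans (lip _ _ _ _ (hi N) (hi n)) _.
  by rewrite mulrDr [e]splitr lerD// hN.
move/cvg_ex => [y /cvg_seq_nrmP hy]; exists y => e j Pj.
(* The slack [d] absorbs the distance from [y] to [u (i n)] and the term [K / (n + 1)], each at most
   [d / 2]. *)
apply/ler_addgt0Pr => d d0; have d20 : 0 < d / 2 by rewrite divr_gt0.
have [N hN] := small _ d20; have [N' _ hN'] := hy _ d20.
pose n := maxn N N'.
have -> : y - u j = (y - u (i n)) + (u (i n) - u j) by rewrite addrA subrK.
apply: le_trans (nrmD _ _) _.
apply: le_trans (lerD (hN' n (leq_maxr _ _)) (lip _ _ _ _ (hi n) Pj)) _.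
move: (hN n (leq_maxl _ _)); rewrite mulrDr.
move: (K * e) (K * _) => a b; lra.
Qed.

(** The estimate contains all that is used later: [f (v i) = u i], and [u (i n)] tends to [f x]
    whenever [v (i n)] tends to [x]. In particular [u i] depends only on [v i]. *)
Lemma lipschitz_extension (W : normedModType R[i]) (Y : completeNormedModType R[i])
    (I : Type) (v : I -> W) (u : I -> Y) (K : R) : 0 <= K ->
  (forall x (e : R), 0 < e -> exists i, nrm (x - v i) <= e) ->
  (forall i j, nrm (u i - u j) <= K * nrm (v i - v j)) ->
  exists f : W -> Y, forall x i, nrm (f x - u i) <= K * nrm (x - v i).
Proof.
move=> K0 dense lip.
suff h x : exists y, forall i, nrm (y - u i) <= K * nrm (x - v i).
  by have [f hf] := choice h; exists f.
have [||y hy] := @lipschitz_limit Y I (fun e i => nrm (x - v i) <= e) u K K0.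
- exact: dense.
- move=> d e i j hi hj; apply: le_trans (lip i j) _; rewrite ler_wpM2l//.
  have -> : v i - v j = (x - v j) - (x - v i).
    by rewrite opprB [RHS]addrC addrA subrK.
  by apply: le_trans (nrmD _ _) _; rewrite nrmN addrC lerD.
by exists y => i; exact: hy.
Qed.

End Limits.

Lemma expr_small (R : realType) (q e : R) : 0 <= q < 1 -> 0 < e ->
  exists N, forall n, (N <= n)%N -> q ^+ n <= e.
Proof.
move=> /andP[q0 q1] e0.
have : q ^+ n @[n --> \oo] --> (0 : R) by apply: cvg_expr; rewrite ger0_norm.
move=> /cvgrPdist_le/(_ e e0)[N _ hN]; exists N => n Nn.
by have := hN n Nn; rewrite /= sub0r normrN ger0_norm ?exprn_ge0.
Qed.

(** * Contractivity of *-homomorphisms *)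

Section Contractivity.
Variable R : realType.

Lemma nrm_half (V : normedModType R[i]) (x : V) : nrm ((2^-1 : R[i]) *: x) = nrm x / 2.
Proof.
have -> : 2^-1 = (2^-1 : R)%:C :> R[i] by rewrite fmorphV rmorph_nat.
rewrite nrmZ mulrC; congr (_ * _); by apply: cabs_real; rewrite invr_ge0.
Qed.

Section QuadraticRoot.
Variables (A : cstarAlgType R) (b : A).
Hypotheses (b_sa : star b = b) (b_lt1 : nrm b < 1).

Let beta := nrm b.

(** Fixed-point iteration for [h = (b^2 + h^2) / 2], whose limit plays the role of 1 - sqrt (1 -
    b^2) without a unit. All iterates are polynomials in [b], hence self-adjoint and commuting with
    [b]. *)
Fixpoint qroot_approx (n : nat) : A :=
  if n is m.+1 then (2^-1 : R[i]) *: (b ** b + qroot_approx m ** qroot_approx m) else 0.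

Local Notation h := qroot_approx.

Lemma qroot_approx_nrm n : nrm (h n) <= beta.
Proof.
have b0 : 0 <= beta by exact: nrm_ge0.
elim: n => [|n ih]; first by rewrite nrm0.
rewrite [h _]/= nrm_half.
have h1 : nrm (b ** b + h n ** h n) <= beta * beta + beta * beta.
  apply: le_trans (nrmD _ _) _; rewrite lerD//; apply: le_trans (nrmM _ _) _ => //.
  by rewrite ler_pM ?nrm_ge0.
have : beta * beta <= beta by rewrite ler_piMr// ltW.
lra.
Qed.

(** On the ball of radius [beta], squaring is Lipschitz with constant [2 * beta], by h^2 - k^2 = h
    (h - k) + (h - k) k; the factor 1/2 of the iteration leaves [beta]. *)
Lemma qroot_approx_step m n :
  nrm (h m.+1 - h n.+1) <= beta * nrm (h m - h n).
Proof.
rewrite [h m.+1]/= [h n.+1]/= -scalerBr nrm_half ler_pdivrMr// opprD addrACA subrr add0r.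
have -> : h m ** h m - h n ** h n = h m ** (h m - h n) + (h m - h n) ** h n.
  by rewrite cmulBr cmulBl addrA subrK.
apply: le_trans (nrmD _ _) _; rewrite mulr_natr mulr2n lerD//.
  by apply: le_trans (nrmM _ _) _; rewrite ler_wpM2r ?nrm_ge0 ?qroot_approx_nrm.
by apply: le_trans (nrmM _ _) _; rewrite mulrC ler_wpM2r ?nrm_ge0 ?qroot_approx_nrm.
Qed.

Lemma qroot_approx_cauchy n k : nrm (h (n + k) - h n) <= beta ^+ n.
Proof.
have b0 : 0 <= beta by exact: nrm_ge0.
elim: n => [|n ih]; first by
  rewrite add0n subr0 expr0; exact: le_trans (qroot_approx_nrm _) (ltW b_lt1).
rewrite addSn; apply: le_trans (qroot_approx_step _ _) _.
by rewrite exprS ler_wpM2l.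
Qed.

Lemma quadratic_root :
  exists h : A, [/\ star h = h, h ** b = b ** h & h + h - h ** h = b ** b].
Proof.
have b0 : 0 <= beta by exact: nrm_ge0.
(* The index [n] counts as an [e]-approximation as soon as the geometric error bound [beta ^+ n] is
   at most [e]. *)
have [|e e0|d e i j hi hj|y hy] := @lipschitz_limit R A nat (fun e n => beta ^+ n <= e) h 1.
- exact: ler01.
- have [|N hN] := @expr_small R beta e _ e0; first by rewrite b0.
  by exists N; exact: hN.
- rewrite mul1r; wlog ij : i j d e hi hj / (i <= j)%N.
    move=> H; have [ij|/ltnW ij] := leqP i j; first exact: (H _ _ _ _ hi hj ij).
    by rewrite nrmB [d + e]addrC; exact: (H _ _ _ _ hj hi ij).
  rewrite nrmB -(subnKC ij); apply: le_trans (qroot_approx_cauchy _ _) _.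
  by rewrite (le_trans hi)// lerDl (le_trans _ hj)// exprn_ge0.
(* The shifts 0 and 1 are both needed: comparing their limits yields the fixed-point equation. *)
have hcvg (k : nat) : h (k + n) @[n --> \oo] --> y.
  apply/cvg_seq_nrmP => e e0; have [|N hN] := @expr_small R beta e _ e0.
    by rewrite b0.
  exists N => // n /= Nn; apply: le_trans (hy _ _ (lexx _)) _.
  by rewrite mul1r hN// (leq_trans Nn)// leq_addl.
have h0 := hcvg 0%N; have h1 := hcvg 1%N.
exists y; split.
- apply: (cvg_seq_unique _ h0); apply: cvg_trans (cvg_star h0).
  rewrite (_ : (fun n => star _) = h)//; apply/funext => n; rewrite /= add0n.
  elim: n => [|n ih] /=; first exact: star0.
  rewrite starZ starD !starM ih b_sa; congr (_ *: _).
  by rewrite fmorphV rmorph_nat.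
- apply: (cvg_seq_unique (cvg_cmul h0 (cvg_cst b))).
  rewrite (_ : (fun n => _ ** b) = (fun n => b ** h (0 + n))).
    exact: (cvg_cmul (cvg_cst b) h0).
  apply/funext => n; rewrite /= add0n; elim: n => [|n ih] /=.
    by rewrite cmul0l cmul0r.
  rewrite cmulZl cmulZr cmulDl cmulDr cmulA; congr (_ *: (_ + _)).
  by rewrite -cmulA ih cmulA ih cmulA.
- have : y = (2^-1 : R[i]) *: (b ** b + y ** y).
    apply: (cvg_seq_unique h1).
    by apply: cvg_scale; apply: cvgD; [exact: cvg_cst | exact: cvg_cmul].
  move=> /(congr1 (fun z => (2 : R[i]) *: z)).
  rewrite scalerA divff ?pnatr_eq0// scale1r scaler_nat mulr2n => ->.
  by rewrite addrK.
Qed.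

End QuadraticRoot.

(* [x + i (1 - k)] and [x - i (1 - k)] are unitaries in the unitization and
   [x] is half their sum; they enter as isometries of [A] by left
   multiplication, so that the unit is not needed. *)
Lemma nrm_le1_quadratic (A : cstarAlgType R) (x k : A) :
  star x = x -> star k = k -> k ** x = x ** k -> k + k - k ** k = x ** x ->
  nrm x <= 1.
Proof.
move=> xs ks kx kk.
(* In [star w ** w], for [w] the element on the left, the cross terms cancel because [k] commutes
   with [x], and the quadratic relation makes the square terms add up to [star z ** z]. *)
have iso (c : R[i]) z : (c^*)%R = - c -> c * c = -1 ->
    nrm (x ** z + c *: (z - k ** z)) = nrm z.
  move=> cs cc; apply: (@pexpIrn _ 2); rewrite ?nnegrE ?nrm_ge0//.
  rewrite -!nrm_cstar; congr nrm.
  set a := z - k ** z; have as_ : star a = star z - star z ** k.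
    by rewrite starB starM ks.
  rewrite starD starZ starM xs cs cmulDl !cmulDr !(cmulZl, cmulZr) scalerA.
  rewrite mulNr cc opprK scale1r.
  have -> : star a ** (x ** z) = star z ** x ** a.
    by rewrite as_ cmulBl cmulBr -!cmulA [k ** (x ** z)]cmulA kx -cmulA.
  rewrite scaleNr addrA.
  rewrite addrK.
  have -> : star a ** a = star z ** z - (star z ** (k + k - k ** k) ** z).
    rewrite as_ /a !(cmulBl, cmulBr, cmulDl, cmulDr) !cmulA !opprB opprD -addrA.
    by congr (_ + _); rewrite addrCA.
  by rewrite kk !cmulA addrC subrK.
have xz z : nrm (x ** z) <= nrm z.
  have i1 : 'i%C * 'i%C = -1 :> R[i] by rewrite -expr2 sqr_i.
  have ic : ('i%C^*)%R = - 'i%C :> R[i].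
    by apply/eqP; rewrite eq_complex /= oppr0 !eqxx.
  have h2 := iso 'i%C z ic i1.
  have icN : ((- 'i%C)^*)%R = - (- 'i%C) :> R[i].
    by apply/eqP; rewrite eq_complex /= !oppr0 !eqxx.
  have := iso _ z icN; rewrite mulrNN => /(_ i1) h1.
  move: h1 h2; set a := z - _; move=> h1 h2.
  have -> : x ** z = (2^-1 : R[i]) *: (x ** z + x ** z).
    by rewrite -mulr2n -[(x ** z) *+ 2]scaler_nat scalerA mulVf ?pnatr_eq0// scale1r.
  rewrite nrm_half ler_pdivrMr// mulr_natr mulr2n.
  have -> : x ** z + x ** z = (x ** z + 'i%C *: a) + (x ** z + - 'i%C *: a).
    by rewrite scaleNr addrACA subrr addr0.
  apply: le_trans (nrmD _ _) _; by rewrite h1 h2.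
(* Left multiplication by [x] being contractive, the choice [z = x] gives |x|^2 = |x x| <= |x|. *)
have [x0|x0] := leP (nrm x) 0; first exact: le_trans x0 ler01.
by have := xz x; rewrite -{1}xs nrm_cstar expr2 ger_pMr.
Qed.

(** The quadratic relation is algebraic, so [f] carries it over to the target. Scaling then passes
    from the open unit ball to all self-adjoint elements, and the C*-identity to all elements. *)
Lemma star_hom_contractive (A B : cstarAlgType R) (f : A -> B) :
  star_hom f -> forall x, nrm (f x) <= nrm x.
Proof.
move=> fH.
have unit_ball b : star b = b -> nrm b < 1 -> nrm (f b) <= 1.
  move=> bs b1; have [h [hs hb hh]] := quadratic_root bs b1.
  apply: (nrm_le1_quadratic (k := f h)).
  - by rewrite -(star_homS fH) bs.
  - by rewrite -(star_homS fH) hs.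
  - by rewrite -!(star_homM fH) hb.
  - by rewrite -!(star_homM fH) -(star_homD fH) -(star_homB fH) hh.
have sa b : star b = b -> nrm (f b) <= nrm b.
  move=> bs; apply/ler_addgt0Pr => e e0.
  (* Dividing by [nrm b + e] instead of [nrm b] lands in the open ball, where the iteration
     converges, and covers [b = 0]. *)
  have d0 : 0 < nrm b + e by rewrite ltr_wpDl ?nrm_ge0.
  pose c : R[i] := ((nrm b + e)^-1)%:C.
  have cc (V : normedModType R[i]) (v : V) : nrm (c *: v) = nrm v / (nrm b + e).
    by rewrite nrmZ mulrC; congr (_ * _); apply/cabs_real/ltW; rewrite invr_gt0.
  have /unit_ball : star (c *: b) = c *: b.
    by rewrite starZ bs; congr (_ *: _); exact: conjc_real.
  rewrite (star_homZ fH) !cc ltr_pdivrMr// ler_pdivrMr// !mul1r; apply.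
  by rewrite ltrDl.
move=> x; rewrite -(@ler_pXn2r _ 2)// ?nnegrE ?nrm_ge0//.
rewrite -!nrm_cstar -(star_homS fH) -(star_homM fH); apply: sa.
by rewrite starM starK.
Qed.

Lemma star_hom_cvg (A B : cstarAlgType R) (f : A -> B) (u : nat -> A) (l : A) :
  star_hom f -> u n @[n --> \oo] --> l -> f (u n) @[n --> \oo] --> f l.
Proof.
move=> fH; apply: (cvg_lip (C := 1)) => n.
by rewrite -(star_homB fH) mul1r; exact: star_hom_contractive.
Qed.

(** The equalizer of two *-homomorphisms is a subalgebra closed under [star], and it is
    topologically closed by contractivity. *)
Lemma star_hom_eq_gen (A B : cstarAlgType R) (f g : A -> B) (S : set A) :
  star_hom f -> star_hom g -> (forall x, S x -> f x = g x) ->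
  forall x, cstar_gen S x -> f x = g x.
Proof.
move=> fH gH fg x /(_ [set y | f y = g y]); apply; split=> //; split=> /=.
- by rewrite !star_hom0.
- by move=> y z hy hz; rewrite (star_homD fH) (star_homD gH) hy hz.
- by move=> c y hy; rewrite (star_homZ fH) (star_homZ gH) hy.
- by move=> y z hy hz; rewrite (star_homM fH) (star_homM gH) hy hz.
- by move=> y hy; rewrite (star_homS fH) (star_homS gH) hy.
- apply/closed_nrmP => y hy.
  have {}hy e : 0 < e -> exists z : {z | f z = g z}, nrm (y - sval z) <= e.
    by move=> /hy[z fz yz]; exists (exist _ z fz).
  have [u uy] := approx_seq hy.
  apply: (cvg_seq_unique (star_hom_cvg fH uy)).
  rewrite (_ : (fun n => _) = (fun n => g (sval (u n)))); first exact: star_hom_cvg.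
  by apply/funext => n; exact: (svalP (u n)).
Qed.

End Contractivity.

(** * Hilbert modules and compact operators *)

Lemma nrmB_le (R : realType) (V : normedModType R[i]) (x y : V) :
  nrm (x - y) <= nrm x + nrm y.
Proof. by rewrite -(nrmN y); exact: nrmD. Qed.

Section HilbertModules.
Variables (R : realType) (A : cstarAlgType R) (X : hilbertModType A).
Implicit Types (x y z : X) (a : A).

Lemma ipDl x y z : ip (x + y) z = ip x z + ip y z :> A.
Proof. by rewrite -ip_star ipDr starD !ip_star. Qed.

Lemma ip0r x : ip x 0 = 0 :> A.
Proof. by apply: (@addIr _ (ip x 0)); rewrite -ipDr !add0r. Qed.

Lemma ip0l x : ip 0 x = 0 :> A.
Proof. by rewrite -ip_star ip0r star0. Qed.

Lemma ipNr x y : ip x (- y) = - ip x y :> A.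
Proof. by rewrite -scaleN1r ipZr scaleN1r. Qed.

Lemma ipNl x y : ip (- x) y = - ip x y :> A.
Proof. by rewrite -ip_star ipNr starN ip_star. Qed.

Lemma ipBr x y z : ip x (y - z) = ip x y - ip x z :> A.
Proof. by rewrite ipDr ipNr. Qed.

Lemma ipBl x y z : ip (x - y) z = ip x z - ip y z :> A.
Proof. by rewrite ipDl ipNl. Qed.

Lemma ip_suml (I : Type) (s : seq I) (f : I -> X) y :
  ip (\sum_(i <- s) f i) y = \sum_(i <- s) ip (f i) y :> A.
Proof. by elim: s => [|i s ih]; rewrite ?big_nil ?ip0l// !big_cons ipDl ih. Qed.

Lemma ip_sumr (I : Type) (s : seq I) (f : I -> X) y :
  ip y (\sum_(i <- s) f i) = \sum_(i <- s) ip y (f i) :> A.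
Proof. by elim: s => [|i s ih]; rewrite ?big_nil ?ip0r// !big_cons ipDr ih. Qed.

Lemma ip_ractl x y a : ip (ract x a) y = star a ** ip x y.
Proof. by rewrite -ip_star ip_ract starM ip_star. Qed.

Lemma nrm_ip x : nrm (ip x x : A) = nrm x ^+ 2.
Proof. by apply: (@complexI R); rewrite rmorphXn /= -!nrmE ip_norm. Qed.

Lemma ract0l a : ract 0 a = 0 :> X.
Proof. by apply: (@addIr _ (ract 0 a)); rewrite -ractDl !add0r. Qed.

Lemma ract0r x : ract x (0 : A) = 0.
Proof. by apply: (@addIr _ (ract x 0)); rewrite -ractDr !add0r. Qed.

Lemma nrm_ract x a : nrm (ract x a) <= nrm x * nrm a.
Proof.
rewrite -(@ler_pXn2r _ 2)// ?nnegrE ?mulr_ge0 ?nrm_ge0//.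
rewrite -nrm_ip ip_ract ip_ractl exprMn -nrm_ip.
apply: le_trans (nrmM _ _) _; rewrite expr2 mulrA ler_wpM2r ?nrm_ge0//.
by apply: le_trans (nrmM _ _) _; rewrite nrm_star mulrC.
Qed.

Lemma ipZl_real (c : R) x y : ip (c%:C *: x) y = c%:C *: ip x y :> A.
Proof.
by rewrite -ip_star ipZr starZ ip_star; congr (_ *: _); exact: conjc_real.
Qed.

Lemma ip_polar x y :
  ip (x + y) (x + y) - ip (x - y) (x - y) = (ip x y + ip y x) *+ 2 :> A.
Proof.
rewrite ipDl ipBl !ipDr !ipNr !opprD !opprK mulr2n addrACA.
rewrite [X in X + _ = _]addrACA subrr add0r [X in _ + X = _]addrACA subrr addr0.
exact: addrACA.
Qed.

(* The constant 2 makes an elementary proof by polarization possible. *)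
Lemma nrm_ip_le x y : nrm (ip x y : A) <= 2 * (nrm x * nrm y).
Proof.
set b : A := ip y x; have bE : ip x y = star b by rewrite ip_star.
rewrite bE nrm_star; have [->|bn0] := eqVneq (nrm b) 0.
  by rewrite !mulr_ge0 ?nrm_ge0.
have b0 : 0 < nrm b by rewrite lt_def bn0 nrm_ge0.
pose m := nrm x * nrm y.
have m0 : 0 < m.
  rewrite /m mulr_gt0// lt_def nrm_ge0 andbT; apply: contra_neq bn0 => /nrm0_eq0 h.
    by rewrite /b h ip0r nrm0.
  by rewrite /b h ip0l nrm0.
have realZ (V : normedModType R[i]) (c : R) (v : V) : 0 <= c -> nrm (c%:C *: v) = c * nrm v.
  by move=> c0; rewrite nrmZ; congr (_ * _); exact: cabs_real.
(* Acting on [y] by [b] turns the inner product into a multiple of the self-adjoint element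
   [star b ** b], and the scalars give both vectors norm at most [m * nrm b]. Polarization then
   bounds [nrm b] by [2 * m]. *)
pose u := (nrm y * nrm b)%:C *: x; pose w := (nrm x)%:C *: ract y b.
have un : nrm u = m * nrm b.
  by rewrite realZ ?mulr_ge0 ?nrm_ge0// mulrC mulrA.
have wn : nrm w <= m * nrm b.
  by rewrite realZ ?nrm_ge0// -mulrA ler_wpM2l ?nrm_ge0 ?nrm_ract.
pose c := (m * nrm b)%:C : R[i].
have uw : ip u w = c *: (star b ** b).
  by rewrite ipZl_real ipZr ip_ract bE scalerA -rmorphM /= mulrC mulrA.
have wu : ip w u = c *: (star b ** b).
  rewrite -ip_star uw starZ starM starK; congr (_ *: _); exact: conjc_real.
have k0 : 0 < m * nrm b by rewrite mulr_gt0.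
have h1 : nrm (u + w) <= 2 * (m * nrm b) by have := nrmD u w; lra.
have h2 : nrm (u - w) <= 2 * (m * nrm b) by have := nrmD u (- w); rewrite nrmN; lra.
have h : 4 * (m * nrm b) * nrm b ^+ 2 <= nrm (u + w) ^+ 2 + nrm (u - w) ^+ 2.
  rewrite -!nrm_ip; apply: (le_trans _ (nrmB_le _ _)); rewrite ip_polar uw wu.
  have -> : (c *: (star b ** b) + c *: (star b ** b)) *+ 2 =
      4%:C *: (c *: (star b ** b)).
    by rewrite -mulr2n -mulrnA -[RHS]/(_ *: _) rmorph_nat scaler_nat.
  by rewrite !realZ ?(ltW k0)// nrm_cstar -mulrA.
have h3 : 4 * (m * nrm b) * nrm b ^+ 2 <= 8 * (m * nrm b) * (m * nrm b).
  apply: (le_trans h); have -> : 8 * (m * nrm b) * (m * nrm b) =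
    (2 * (m * nrm b)) ^+ 2 + (2 * (m * nrm b)) ^+ 2 by ring.
  by rewrite lerD// lerXn2r ?nnegrE ?nrm_ge0 ?(mulr_ge0 _ (ltW k0)).
have h4 : 4 * (m * nrm b) * nrm b * nrm b <= 4 * (m * nrm b) * nrm b * (2 * m).
  have -> : 4 * (m * nrm b) * nrm b * (2 * m) = 8 * (m * nrm b) * (m * nrm b) by ring.
  by rewrite -mulrA -expr2.
by move: h4; rewrite ler_pM2l//; do 2 apply: mulr_gt0 => //.
Qed.

Lemma nrm_theta x y z : nrm (ract x (ip y z : A)) <= 2 * (nrm x * nrm y) * nrm z.
Proof.
apply: le_trans (nrm_ract _ _) _.
have -> : 2 * (nrm x * nrm y) * nrm z = nrm x * (2 * (nrm y * nrm z)) by ring.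
by rewrite ler_wpM2l ?nrm_ge0 ?nrm_ip_le.
Qed.

Lemma cvg_ip (u v : nat -> X) x y : u n @[n --> \oo] --> x -> v n @[n --> \oo] --> y ->
  ip (u n) (v n) @[n --> \oo] --> (ip x y : A).
Proof.
move=> hu hv; apply/cvg_seq_nrmP => e e0.
pose K := 2 * (nrm x + nrm y + 1).
have K0 : 0 < K by rewrite mulr_gt0// ltr_wpDl// addr_ge0 ?nrm_ge0.
have d0 : 0 < e / (2 * K) by rewrite divr_gt0// mulr_gt0.
have /cvg_seq_nrmP/(_ _ d0) h1 := hu; have /cvg_seq_nrmP/(_ _ d0) h2 := hv.
have hb := cvg_nrm_bounded hv.
near=> n.
have -> : ip x y - ip (u n) (v n) = ip x (y - v n) + ip (x - u n) (v n) :> A.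
  by rewrite ipBr ipBl addrA subrK.
apply: le_trans (nrmD _ _) _.
have -> : e = K * (e / (2 * K)) + K * (e / (2 * K)).
  by field; rewrite gt_eqF.
rewrite lerD//; apply: le_trans (nrm_ip_le _ _) _; rewrite /K -mulrA ler_wpM2l//.
  rewrite ler_pM ?nrm_ge0//; last by near: n; exact: h2.
  by rewrite -addrA lerDl addr_ge0 ?nrm_ge0.
rewrite mulrC ler_pM ?nrm_ge0//; last by near: n; exact: h1.
apply: (@le_trans _ _ (nrm y + 1)); last by rewrite lerD2r lerDr nrm_ge0.
by near: n; exact: hb.
Unshelve. all: by end_near. Qed.

End HilbertModules.

(** * Powers of a self-adjoint element and its norm *)

(** In the absence of a unit the exponent is shifted: [cpow v n] is the power of [v] with exponent n
    + 1. *)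
Fixpoint cpow (R : realType) (A : cstarAlgType R) (v : A) (n : nat) : A :=
  if n is m.+1 then v ** cpow v m else v.

Section PowerTrick.
Variables (R : realType) (A : cstarAlgType R).
Implicit Types v : A.

Lemma cpowD v m n : cpow v (m + n).+1 = cpow v m ** cpow v n.
Proof. by elim: m => [//|m ih]; rewrite addSn /= -cmulA -ih. Qed.

Lemma cpow_comm v n : cpow v n ** v = v ** cpow v n.
Proof. by rewrite -[in LHS](_ : cpow v 0 = v)// -cpowD addn0. Qed.

Lemma cpow_sa v n : star v = v -> star (cpow v n) = cpow v n.
Proof. by move=> vs; elim: n => [//|n ih] /=; rewrite starM ih vs cpow_comm. Qed.

(** Repeated squaring: for self-adjoint elements the C*-identity reads |v^2| = |v|^2. *)
Lemma nrm_cpow v k : star v = v -> nrm (cpow v (2 ^ k).-1) = nrm v ^+ (2 ^ k).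
Proof.
move=> vs; elim: k => [|k ih]; first by rewrite expr1.
rewrite [in RHS]expnS mulnC exprM -ih -nrm_cstar cpow_sa// -cpowD.
congr (nrm (cpow v _)); have := expn_gt0 2 k; rewrite expnS.
by case: (2 ^ k)%N => // n _; rewrite mul2n -addnn /= addnS.
Qed.

(** The norm of a self-adjoint element is the exponential growth rate of its powers, so the constant
    [M] does not survive in the conclusion. *)
Lemma nrm_le_cpow v (M B : R) : star v = v -> 0 <= B ->
  (forall n, nrm (cpow v n) <= M * B ^+ n) -> nrm v <= B.
Proof.
move=> vs B0 h; rewrite leNgt; apply/negP => Bv.
have v0 : 0 < nrm v by exact: le_lt_trans Bv.
have q01 : 0 <= B / nrm v < 1 by rewrite divr_ge0 ?nrm_ge0// ltr_pdivrMr ?mul1r.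
have M1 : 0 < `|M| + 1 by rewrite ltr_wpDl.
(* Once [(B / nrm v) ^+ n] is below this threshold, [M * B ^+ n] is smaller than [nrm v ^+ n.+1],
   which contradicts the hypothesis at [n = 2 ^ N - 1]. *)
have d0 : 0 < nrm v / (`|M| + 1) by rewrite divr_gt0.
have [N hN] := expr_small q01 d0.
have pE : (2 ^ N = (2 ^ N).-1.+1)%N by rewrite prednK// expn_gt0.
have Nn : (N <= (2 ^ N).-1)%N by rewrite -ltnS -pE ltn_expl.
have := h (2 ^ N).-1; rewrite nrm_cpow// {1}pE; move: (hN _ Nn); move: ((2 ^ N).-1) => n.
rewrite expr_div_n ler_pdivrMr ?exprn_gt0// => h1 h2.
have /lt_geF : M * B ^+ n < nrm v ^+ n.+1; last by rewrite h2.
apply: (@le_lt_trans _ _ (`|M| * (nrm v / (`|M| + 1) * nrm v ^+ n))).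
  apply: le_trans (ler_wpM2r _ (ler_norm M)) _; first exact: exprn_ge0.
  by rewrite ler_wpM2l.
rewrite exprS mulrA ltr_pM2r ?exprn_gt0// mulrA ltr_pdivrMr// mulrC.
by rewrite ltr_pM2l// ltrDl.
Qed.

End PowerTrick.

(** * Finite-rank operators and their operator-norm limits *)

Section FiniteRank.
Variables (R : realType) (A : cstarAlgType R) (X : corrType A).
Implicit Types (s : seq (X * X)) (x y z : X) (S T : X -> X).

(** Finite-rank operators are handled through lists of pairs, because the candidate value of the
    induced map is computed from the list and is only later seen to depend on the operator alone. *)
Definition rank_op s z : X := \sum_(p <- s) theta p.1 p.2 z.

Definition rank_adj s : seq (X * X) := [seq (p.2, p.1) | p <- s].

Definition rank_mulr S s : seq (X * X) := [seq (S p.1, p.2) | p <- s].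

Definition bounded_by (C : R) T := forall z, nrm (T z) <= C * nrm z.

Lemma rank_opD s x y : rank_op s (x + y) = rank_op s x + rank_op s y.
Proof.
by rewrite -big_split; apply: eq_bigr => p _; rewrite /theta ipDr ractDr.
Qed.

Lemma rank_opN s x : rank_op s (- x) = - rank_op s x.
Proof.
rewrite /rank_op -sumrN; apply: eq_bigr => p _.
by rewrite /theta -scaleN1r ipZr ractZr scaleN1r.
Qed.

Lemma rank_op_sum s I (r : seq I) (f : I -> X) :
  rank_op s (\sum_(i <- r) f i) = \sum_(i <- r) rank_op s (f i).
Proof.
elim: r => [|i r ih]; last by rewrite !big_cons rank_opD ih.
by rewrite !big_nil /rank_op big1// => p _; rewrite /theta ip0r ract0r.
Qed.

Lemma rank_op_ract s x (a : A) : rank_op s (ract x a) = ract (rank_op s x) a.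
Proof.
rewrite /rank_op; elim: s => [|p s ih]; first by rewrite !big_nil ract0l.
by rewrite !big_cons ractDl ih /theta ip_ract ractM.
Qed.

Lemma rank_op_cat s s' z : rank_op (s ++ s') z = rank_op s z + rank_op s' z.
Proof. exact: big_cat. Qed.

Lemma rank_op_mulr s s' z : rank_op (rank_mulr (rank_op s) s') z = rank_op s (rank_op s' z).
Proof.
rewrite [rank_op s' z]/rank_op rank_op_sum [LHS]/rank_op big_map.
by apply: eq_bigr => p _; rewrite /theta rank_op_ract.
Qed.

Lemma rank_op_scale (c : R[i]) s z :
  rank_op (rank_mulr ( *:%R c) s) z = c *: rank_op s z.
Proof.
by rewrite /rank_op big_map scaler_sumr; apply: eq_bigr => p _; rewrite /theta ractZl.
Qed.

Lemma ip_rank_op s x y : ip (rank_op s x) y = ip x (rank_op (rank_adj s) y) :> A.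
Proof.
rewrite /rank_op big_map ip_suml ip_sumr; apply: eq_bigr => p _ /=.
by rewrite /theta ip_ractl ip_ract ip_star.
Qed.

Lemma bounded_rank_op s : exists2 C, 0 <= C & bounded_by C (rank_op s).
Proof.
elim: s => [|p s [C C0 hC]].
  by exists 0 => // z; rewrite /rank_op big_nil nrm0 mul0r.
exists (2 * (nrm p.1 * nrm p.2) + C) => [|z].
  by rewrite addr_ge0// !mulr_ge0 ?nrm_ge0.
rewrite /rank_op big_cons mulrDl; apply: le_trans (nrmD _ _) _.
by rewrite lerD ?hC ?nrm_theta.
Qed.

(** |T z|^2 is the norm of the inner product of [S (T z)] with [z]; the factor 2 is that of the
    crude Cauchy-Schwarz inequality. *)
Lemma bounded_adj (C : R) S T : 0 <= C ->
  (forall x y, ip (S x) y = ip x (T y) :> A) -> bounded_by C S -> bounded_by (2 * C) T.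
Proof.
move=> C0 ST hS z; have [T0|T0] := eqVneq (nrm (T z)) 0.
  by rewrite T0 !mulr_ge0 ?nrm_ge0.
have Tgt0 : 0 < nrm (T z) by rewrite lt_def T0 nrm_ge0.
rewrite -(ler_pM2l Tgt0) -expr2 -nrm_ip -ST.
apply: le_trans (nrm_ip_le _ _) _.
have -> : nrm (T z) * (2 * C * nrm z) = 2 * (C * nrm (T z) * nrm z) by ring.
by rewrite ler_pM2l// ler_wpM2r ?nrm_ge0 ?hS.
Qed.

Definition op_cvg (u : nat -> seq (X * X)) T := forall e : R, 0 < e ->
  \forall n \near \oo, bounded_by e (fun z => T z - rank_op (u n) z).

Lemma compactsP T : compacts T <->
  forall e : R, 0 < e -> exists s, bounded_by e (fun z => T z - rank_op s z).
Proof.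
split=> h e e0.
  have [|S [s sE] hS] := h e%:C; first by rewrite ltr_complex.
  exists s => z; rewrite -ler_complex rmorphM /= -!nrmE.
  by have := hS z; rewrite sE.
have [d d0 ->] := nrm_gt0P e0; have [s hs] := h d d0.
exists (rank_op s) => [|z]; first by exists s.
by rewrite !nrmE -rmorphM ler_complex.
Qed.

Lemma op_cvg_compacts u T : op_cvg u T -> compacts T.
Proof.
move=> h; apply/compactsP => e /h/filter_ex[n hn]; by exists (u n).
Qed.

Lemma compacts_seq T : compacts T -> exists u, op_cvg u T.
Proof.
move=> /compactsP h.
have hn n : exists s, bounded_by (n.+1%:R)^-1 (fun z => T z - rank_op s z).
  by apply: h; rewrite invr_gt0 ltr0n.
have [u hu] := choice hn; exists u => e /inv_small[N hN].
exists N => // n /= /hN Nn z; apply: le_trans (hu n z) _.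
by rewrite ler_wpM2r ?nrm_ge0.
Qed.

Lemma bounded_compacts T : compacts T -> exists2 C, 0 <= C & bounded_by C T.
Proof.
move=> /compactsP/(_ _ ltr01)[s hs]; have [C C0 hC] := bounded_rank_op s.
exists (1 + C) => [|z]; first by rewrite addr_ge0.
rewrite -[T z](subrK (rank_op s z)) mulrDl; apply: le_trans (nrmD _ _) _.
by rewrite lerD ?hs ?hC.
Qed.

Lemma op_cvg_rank s : op_cvg (fun=> s) (rank_op s).
Proof.
move=> e e0; exists 0%N => // n _ z.
by rewrite subrr nrm0 mulr_ge0 ?nrm_ge0 ?ltW.
Qed.

Lemma op_cvgD u v S T : op_cvg u S -> op_cvg v T ->
  op_cvg (fun n => u n ++ v n) (fun z => S z + T z).
Proof.
move=> hu hv e e0; have e20 : 0 < e / 2 by rewrite divr_gt0.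
apply: filterS2 (hu _ e20) (hv _ e20) => n h1 h2 z.
rewrite rank_op_cat opprD addrACA [e]splitr mulrDl.
by apply: le_trans (nrmD _ _) _; rewrite lerD.
Qed.

Lemma op_cvgZ (c : R[i]) u T : op_cvg u T ->
  op_cvg (fun n => rank_mulr ( *:%R c) (u n)) (fun z => c *: T z).
Proof.
move=> hu e e0; have c1 : 0 < cabs c + 1 by rewrite ltr_wpDl ?cabs_ge0.
apply: filterS (hu _ (divr_gt0 e0 c1)) => n h z.
rewrite rank_op_scale -scalerBr nrmZ.
apply: (@le_trans _ _ ((cabs c + 1) * (e / (cabs c + 1) * nrm z))).
  by rewrite ler_pM ?nrm_ge0// lerDl.
by rewrite mulrA mulrCA divff ?mulr1// gt_eqF.
Qed.

Lemma op_cvg_comp u v S T : op_cvg u S -> op_cvg v T ->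
  op_cvg (fun n => rank_mulr (rank_op (u n)) (v n)) (S \o T).
Proof.
move=> hu hv; have [C C0 hC] := bounded_compacts (op_cvg_compacts hu).
have [D D0 hD] := bounded_compacts (op_cvg_compacts hv).
move=> e e0; pose K := C + D + 1.
have K0 : 0 < K by rewrite /K; lra.
(* Precision at most 1 keeps [rank_op (u n)] bounded by [C + 1]; the other bound makes the total
   error [d * D + (C + 1) * d = d * K] at most [e / 2]. *)
have d0 : 0 < Num.min 1 (e / (2 * K)) by rewrite lt_min ltr01 divr_gt0// mulr_gt0.
apply: filterS2 (hu _ d0) (hv _ d0) => n; set d := Num.min _ _ => h1 h2 z.
have d1 : d <= 1 by rewrite ge_min lexx.
have dK : d * K <= e / 2.
  rewrite -ler_pdivlMr// (_ : e / 2 / K = e / (2 * K)).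
    by rewrite ge_min lexx orbT.
  by rewrite invfM mulrA.
have -> : (S \o T) z - rank_op (rank_mulr (rank_op (u n)) (v n)) z =
    (S (T z) - rank_op (u n) (T z)) + rank_op (u n) (T z - rank_op (v n) z).
  by rewrite rank_op_mulr rank_opD rank_opN addrA subrK.
apply: le_trans (nrmD _ _) _.
have b1 : nrm (S (T z) - rank_op (u n) (T z)) <= d * D * nrm z.
  by rewrite (le_trans (h1 _))// -mulrA ler_wpM2l ?(ltW d0) ?hD.
have b2 w : nrm (rank_op (u n) w) <= (C + 1) * nrm w.
  have -> : rank_op (u n) w = S w - (S w - rank_op (u n) w) by rewrite opprB addrC subrK.
  apply: le_trans (nrmB_le _ _) _; rewrite mulrDl lerD ?hC// mul1r.
  by apply: le_trans (h1 _) _; rewrite ler_piMl ?nrm_ge0.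
have b3 := b2 (T z - rank_op (v n) z).
have b4 : (C + 1) * nrm (T z - rank_op (v n) z) <= (C + 1) * (d * nrm z).
  by rewrite ler_wpM2l ?addr_ge0// h2.
have b5 : d * K * nrm z <= e / 2 * nrm z by rewrite ler_wpM2r ?nrm_ge0.
have b6 : e / 2 * nrm z <= e * nrm z by rewrite ler_wpM2r ?nrm_ge0//; lra.
apply: le_trans b6; apply: le_trans b5.
apply: le_trans (lerD b1 (le_trans b3 b4)) _.
have -> : d * K * nrm z = d * D * nrm z + (C + 1) * (d * nrm z) by rewrite /K; ring.
exact: lexx.
Qed.

Lemma op_cvg_adj u S T : op_cvg u S ->
  (forall x y, ip (S x) y = ip x (T y) :> A) -> op_cvg (fun n => rank_adj (u n)) T.
Proof.
move=> hu ST e e0; have e20 : 0 < e / 2 by rewrite divr_gt0.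
apply: filterS (hu _ e20) => n h.
have -> : e = 2 * (e / 2) by field.
apply: (bounded_adj (ltW e20) _ h) => x y.
by rewrite ipBl ipBr ST ip_rank_op.
Qed.

End FiniteRank.

Lemma nrm_sum (R : realType) (V : normedModType R[i]) I (r : seq I) (f : I -> V) :
  nrm (\sum_(i <- r) f i) <= \sum_(i <- r) nrm (f i).
Proof.
elim: r => [|i r ih]; first by rewrite !big_nil nrm0.
by rewrite !big_cons; apply: le_trans (nrmD _ _) _; rewrite lerD2l.
Qed.

(** * The map on compact operators induced by a representation *)

Section Representations.
Variables (R : realType) (A : cstarAlgType R) (X : corrType A) (Y : cstarAlgType R).
Variables (pi : A -> Y) (t : X -> Y).
Hypothesis rep : corr_rep pi t.
Implicit Types (s : seq (X * X)) (x y z : X) (S T : X -> X).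

Let pH := rep_pi rep.

Lemma rep_t0 : t 0 = 0.
Proof. by apply: (@addIr _ (t 0)); rewrite -(rep_tD rep) !add0r. Qed.

Lemma rep_tN x : t (- x) = - t x.
Proof. by rewrite -scaleN1r (rep_tZ rep) scaleN1r. Qed.

Lemma rep_tB x y : t (x - y) = t x - t y.
Proof. by rewrite (rep_tD rep) rep_tN. Qed.

Lemma rep_t_sum I (r : seq I) (f : I -> X) :
  t (\sum_(i <- r) f i) = \sum_(i <- r) t (f i).
Proof.
by elim: r => [|i r ih]; rewrite ?big_nil ?rep_t0// !big_cons (rep_tD rep) ih.
Qed.

Lemma nrm_rep_t x : nrm (t x) <= nrm x.
Proof.
rewrite -(@ler_pXn2r _ 2)// ?nnegrE ?nrm_ge0// -nrm_cstar (rep_ip rep) -nrm_ip.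
exact: star_hom_contractive.
Qed.

(** The difference [d] of the two sides is killed on the left by every [star (t z)]. As [star d] is
    built from such factors, [star d ** d = 0]. *)
Lemma rep_ract x a : t (ract x a) = t x ** pi a.
Proof.
apply/eqP; rewrite -subr_eq0; set d := _ - _.
have td z : star (t z) ** d = 0.
  by rewrite cmulBr cmulA !(rep_ip rep) ip_ract (star_homM pH) subrr.
suff : nrm d ^+ 2 == 0 by rewrite expf_eq0 => /eqP/nrm0_eq0 ->.
by rewrite -nrm_cstar {1}/d starB starM cmulBl -cmulA !td cmul0r subr0 nrm0.
Qed.

Definition rank_val s : Y := \sum_(p <- s) t p.1 ** star (t p.2).

Lemma rank_val_cat s s' : rank_val (s ++ s') = rank_val s + rank_val s'.
Proof. exact: big_cat. Qed.

Lemma rank_val_scale (c : R[i]) s : rank_val (rank_mulr ( *:%R c) s) = c *: rank_val s.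
Proof.
rewrite /rank_val big_map scaler_sumr; apply: eq_bigr => p _ /=.
by rewrite (rep_tZ rep) cmulZl.
Qed.

Lemma rank_val_adj s : rank_val (rank_adj s) = star (rank_val s).
Proof.
rewrite /rank_val big_map star_sum; apply: eq_bigr => p _ /=.
by rewrite starM starK.
Qed.

Lemma rank_val_t s z : rank_val s ** t z = t (rank_op s z).
Proof.
rewrite /rank_val cmul_suml rep_t_sum; apply: eq_bigr => p _.
by rewrite -cmulA (rep_ip rep) -rep_ract.
Qed.

Lemma rank_val_mulr s s' :
  rank_val (rank_mulr (rank_op s) s') = rank_val s ** rank_val s'.
Proof.
rewrite [rank_val s']/rank_val cmul_sumr [LHS]/rank_val big_map.
by apply: eq_bigr => p _ /=; rewrite cmulA rank_val_t.
Qed.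

(** The powers of [v] grow at most like those of [B = 2 * C * C], so |u|^2 = |v| <= 2 C^2, which is
    at most (2 C)^2. *)
Lemma nrm_rank_val s C : 0 <= C -> bounded_by C (rank_op s) -> nrm (rank_val s) <= 2 * C.
Proof.
move=> C0 hC; pose u := rank_val s; pose v := star u ** u.
have hC' : bounded_by (2 * C) (rank_op (rank_adj s)).
  exact: (bounded_adj C0 (ip_rank_op s)).
have vs : star v = v by rewrite /v starM starK.
pose B := 2 * C * C; have B0 : 0 <= B by rewrite !mulr_ge0.
pose M : R := \sum_(p <- s) nrm (rank_op (rank_adj s) p.1) * nrm p.2.
pose S z := rank_op (rank_adj s) (rank_op s z).
have hS : bounded_by B S.
  move=> z; by apply: le_trans (hC' _) _; rewrite /B -[leRHS]mulrA ler_wpM2l ?mulr_ge0.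
have vt z : v ** t z = t (S z).
  by rewrite /v -cmulA rank_val_t -rank_val_adj rank_val_t.
have iterS_le n z : nrm (iter n S z) <= B ^+ n * nrm z.
  elim: n => [|n ihn]; first by rewrite expr0 mul1r.
  by rewrite iterS exprS -mulrA; apply: le_trans (hS _) _; rewrite ler_wpM2l.
have : nrm v <= B.
  apply: (nrm_le_cpow (M := M)) => // n.
  (* Multiplying by [v] only moves the first vectors by [S]: the number of terms stays fixed, so
     that [M] is independent of [n]. *)
  have -> : cpow v n = \sum_(p <- s) t (iter n S (rank_op (rank_adj s) p.1)) ** star (t p.2).
    elim: n => [|n /= ->].
      by rewrite /= /v -rank_val_adj -rank_val_mulr /rank_val big_map.
    by rewrite cmul_sumr; apply: eq_bigr => p _; rewrite cmulA vt.
  apply: le_trans (nrm_sum _ _) _; rewrite /M mulr_suml; apply: ler_sum => p _.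
  apply: le_trans (nrmM _ _) _; rewrite nrm_star mulrAC ler_pM ?nrm_ge0 ?nrm_rep_t//.
  by apply: le_trans (nrm_rep_t _) _; rewrite mulrC iterS_le.
rewrite /v nrm_cstar => h; rewrite -(@ler_pXn2r _ 2)// ?nnegrE ?nrm_ge0 ?mulr_ge0//.
apply: (le_trans h); have -> : (2 * C) ^+ 2 = B + B by rewrite /B; ring.
by rewrite lerDl.
Qed.

(** With [C = 0] this says that [rank_val] depends only on the operator; in general it makes
    [rank_val] Lipschitz for the operator norm. *)
Lemma rank_valB s s' C : 0 <= C ->
  bounded_by C (fun z => rank_op s z - rank_op s' z) -> nrm (rank_val s - rank_val s') <= 2 * C.
Proof.
move=> C0 h; have -> : rank_val s - rank_val s' = rank_val (s ++ rank_mulr ( *:%R (-1)) s').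
  by rewrite rank_val_cat rank_val_scale scaleN1r.
apply: nrm_rank_val => // z.
by rewrite rank_op_cat rank_op_scale scaleN1r.
Qed.

Lemma induced_map_ex T : exists w : Y, forall s (e : R), compacts T -> 0 <= e ->
  bounded_by e (fun z => T z - rank_op s z) -> nrm (w - rank_val s) <= 2 * e.
Proof.
(* Off the compact operators 0 is a default value. *)
have [cT|ncT] := pselect (compacts T); last by exists 0 => s e /ncT.
have [||d e s s' [d0 hs] [e0 hs']|y hy] := @lipschitz_limit R Y _
  (fun e s => 0 <= e /\ bounded_by e (fun z => T z - rank_op s z)) rank_val 2.
- exact: ler0n.
- move=> e e0; have /compactsP/(_ _ e0)[s hs] := cT; exists s; split=> //; exact: ltW.
- apply: rank_valB => [|z]; first exact: addr_ge0.
  have -> : rank_op s z - rank_op s' z = (T z - rank_op s' z) - (T z - rank_op s z).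
    by rewrite opprB [RHS]addrC addrA subrK.
  by apply: le_trans (nrmB_le _ _) _; rewrite addrC mulrDl lerD.
by exists y => s e _ e0 hs; apply: hy.
Qed.

Definition induced_map : (X -> X) -> Y := projT1 (choice induced_map_ex).

Lemma induced_mapP T s e : compacts T -> 0 <= e ->
  bounded_by e (fun z => T z - rank_op s z) -> nrm (induced_map T - rank_val s) <= 2 * e.
Proof. by rewrite /induced_map; case: choice => f /= hf; exact: hf. Qed.

Lemma induced_map_bound T C : compacts T -> 0 <= C -> bounded_by C T ->
  nrm (induced_map T) <= 2 * C.
Proof.
move=> cT C0 hC; have := @induced_mapP T [::] C cT C0.
rewrite /rank_val big_nil subr0; apply => z.
by rewrite /rank_op big_nil subr0.
Qed.

Lemma induced_map_cvg u T : op_cvg u T ->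
  rank_val (u n) @[n --> \oo] --> induced_map T.
Proof.
move=> h; apply/cvg_seq_nrmP => e e0; have e20 : 0 < e / 2 by rewrite divr_gt0.
apply: filterS (h _ e20) => n hn; have -> : e = 2 * (e / 2) by field.
by apply: induced_mapP (ltW e20) hn; exact: op_cvg_compacts h.
Qed.

Lemma induced_map_hom : induced_hom t induced_map.
Proof.
split.
- move=> S T /compacts_seq[u hu] /compacts_seq[v hv].
  apply: (cvg_seq_unique (induced_map_cvg (op_cvgD hu hv))).
  rewrite (_ : (fun n => _) = (fun n => rank_val (u n) + rank_val (v n))).
    by apply: cvgD; exact: induced_map_cvg.
  by apply/funext => n; rewrite rank_val_cat.
- move=> c T /compacts_seq[u hu].
  apply: (cvg_seq_unique (induced_map_cvg (op_cvgZ c hu))).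
  rewrite (_ : (fun n => _) = (fun n => c *: rank_val (u n))).
    by apply: cvg_scale; exact: induced_map_cvg.
  by apply/funext => n; rewrite rank_val_scale.
- move=> S T /compacts_seq[u hu] /compacts_seq[v hv].
  apply: (cvg_seq_unique (induced_map_cvg (op_cvg_comp hu hv))).
  rewrite (_ : (fun n => _) = (fun n => rank_val (u n) ** rank_val (v n))).
    by apply: cvg_cmul; exact: induced_map_cvg.
  by apply/funext => n; rewrite rank_val_mulr.
- move=> S T /compacts_seq[u hu] _ ST.
  apply: (cvg_seq_unique (induced_map_cvg (op_cvg_adj hu ST))).
  rewrite (_ : (fun n => _) = (fun n => star (rank_val (u n)))).
    by apply: cvg_star; exact: induced_map_cvg.
  by apply/funext => n; rewrite rank_val_adj.
- move=> x y; have -> : theta x y = rank_op [:: (x, y)].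
    by apply/funext => z; rewrite /rank_op big_seq1.
  apply: (cvg_seq_unique (induced_map_cvg (@op_cvg_rank _ _ _ [:: (x, y)]))).
  by rewrite /rank_val big_seq1; exact: cvg_cst.
Qed.

(** Covariance only provides some induced map [psi]; this evaluates it on finite-rank operators,
    whichever [psi] is given. *)
Lemma induced_hom_rank psi s : induced_hom t psi -> psi (rank_op s) = rank_val s.
Proof.
move=> h; have comp (r : seq (X * X)) : compacts (rank_op r).
  exact: op_cvg_compacts (@op_cvg_rank _ _ _ r).
elim: s => [|p s ih].
  (* The value of [psi] at the zero operator comes from scaling by 0. *)
  have := inducedZ h 0 (comp [::]); rewrite scale0r /rank_val big_nil => <-.
  by congr psi; apply/funext => z; rewrite scale0r /rank_op big_nil.
have -> : rank_op (p :: s) = (fun z => theta p.1 p.2 z + rank_op s z).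
  by apply/funext => z; rewrite /rank_op big_cons.
rewrite (inducedD h) ?(induced_theta h) ?ih ?/rank_val ?big_cons//.
have -> : theta p.1 p.2 = rank_op [:: p]; last exact: comp.
by apply/funext => z; rewrite /rank_op big_seq1.
Qed.

End Representations.

(** * Simple functions *)

HB.instance Definition _ (L : countType) (S : wlrNormalSpace L) := gen_eqMixin (bset S).
HB.instance Definition _ (L : countType) (S : wlrNormalSpace L) := gen_choiceMixin (bset S).

Section SimpleFunctions.
Variables (R : realType) (L : countType) (S : wlrNormalSpace L).
Local Notation A := (lalg R S).
Local Notation chi := (@chi R L S).
Implicit Types (B D : bset S) (s : seq (R[i] * bset S)).

Lemma bset_ext B D : B = D :> set _ -> B = D.
Proof.
case: B D => B hB [D hD] /= BD; case: _ / BD hD => hD.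
by congr Bset; exact: Prop_irrelevance.
Qed.

Definition bdiff B D : bset S := Bset (lspace_normal (bsetP B) (bsetP D)).

(** This isolates relation (i), so that the [chi B], their images under *-homomorphisms and the
    projections of a representation are treated alike. Idempotence is [pfam_cap] with equal sets. *)
Record projection_family (Y : cstarAlgType R) (p : bset S -> Y) : Prop := {
  pfam_star : forall B, star (p B) = p B;
  pfam_cap : forall B D, p B ** p D = p (bcap B D);
  pfam_cup : forall B D, p (bcup B D) = p B + p D - p (bcap B D);
  pfam_empty : forall B, B = set0 :> set _ -> p B = 0
}.

Lemma chi_projections : projection_family chi.
Proof.
split=> [B|B D|B D|B B0]; apply: ev_ext => v.
- by rewrite evS ev_chi rmorph_nat.
- by rewrite evM !ev_chi in_setI -natrM mulnb.
- rewrite evB evD !ev_chi in_setU in_setI.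
  by case: (v \in _); case: (v \in _); rewrite ?(addrK, addr0, add0r, subr0, subrr).
- by rewrite ev_chi B0 in_set0.
Qed.

(** A formal combination of sets is evaluated in any module; comparing the evaluations at [chi] and
    at [p] is what produces [pi]. *)
Definition simple (M : lmodType R[i]) (phi : bset S -> M) s : M :=
  \sum_(q <- s) q.1 *: phi q.2.

Lemma simple_cat (M : lmodType R[i]) (phi : bset S -> M) s s' :
  simple phi (s ++ s') = simple phi s + simple phi s'.
Proof. exact: big_cat. Qed.

Definition simple_scale (c : R[i]) s := [seq (c * q.1, q.2) | q <- s].

Lemma simpleZ (M : lmodType R[i]) (phi : bset S -> M) c s :
  simple phi (simple_scale c s) = c *: simple phi s.
Proof.
by rewrite /simple big_map scaler_sumr; apply: eq_bigr => q _; rewrite scalerA.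
Qed.

Lemma ev_simple s v :
  ev (simple chi s : A) v = \sum_(q <- s) q.1 * (v \in bset_val q.2)%:R.
Proof. by rewrite ev_sum; apply: eq_bigr => q _; rewrite evZ ev_chi. Qed.

Definition disjoint_sets (q q' : R[i] * bset S) : bool :=
  `[< forall v, bset_val q.2 v -> bset_val q'.2 v -> False >].

Lemma ev_simple_in s q v : pairwise disjoint_sets s -> q \in s -> bset_val q.2 v ->
  ev (simple chi s : A) v = q.1.
Proof.
rewrite ev_simple; elim: s => [//|q' s ih].
rewrite pairwise_cons inE big_cons => /andP[/allP h1 /ih h2] /predU1P[-> qv|qs qv].
  rewrite mem_set// mulr1 big_seq big1 ?addr0// => q2 /h1/asboolP q2s.
  by rewrite memNset ?mulr0// => /(q2s _ qv).
rewrite h2// memNset ?mulr0 ?add0r// => qv'.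
by have /asboolP := h1 _ qs; apply; first exact: qv'.
Qed.

Lemma ev_simple_out s v : (forall q, q \in s -> ~ bset_val q.2 v) -> ev (simple chi s : A) v = 0.
Proof.
by move=> h; rewrite ev_simple big_seq big1// => q /h qv; rewrite memNset ?mulr0.
Qed.

Section ProjectionFamily.
Variables (Y : cstarAlgType R) (p : bset S -> Y).
Hypothesis pP : projection_family p.

Lemma pfam_split B D : p B = p (bcap B D) + p (bdiff B D).
Proof.
have {1}-> : B = bcup (bcap B D) (bdiff B D).
  by apply: bset_ext; rewrite /= setUIDK.
rewrite (pfam_cup pP) [X in _ - X](pfam_empty pP) ?subr0//=.
by apply/seteqP; split=> // v [[_ Dv] []].
Qed.

Definition simple_mul s s' := [seq (q.1 * q'.1, bcap q.2 q'.2) | q <- s, q' <- s'].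

Lemma simpleM s s' : simple p (simple_mul s s') = simple p s ** simple p s'.
Proof.
rewrite /simple big_allpairs_dep cmul_suml; apply: eq_bigr => q _.
rewrite cmul_sumr; apply: eq_bigr => q' _ /=.
by rewrite cmulZl cmulZr (pfam_cap pP) scalerA.
Qed.

Definition simple_star s := [seq ((q.1^*)%R, q.2) | q <- s].

Lemma simpleS s : simple p (simple_star s) = star (simple p s).
Proof.
rewrite /simple big_map star_sum; apply: eq_bigr => q _ /=.
by rewrite starZ (pfam_star pP).
Qed.

Lemma simple_cvgD u v x y : simple p (u n) @[n --> \oo] --> x ->
  simple p (v n) @[n --> \oo] --> y -> simple p (u n ++ v n) @[n --> \oo] --> x + y.
Proof.
move=> hu hv; rewrite (_ : (fun n => _) = fun n => simple p (u n) + simple p (v n)).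
  exact: cvgD.
by apply/funext => n; rewrite simple_cat.
Qed.

Lemma simple_cvgZ (c : R[i]) u x : simple p (u n) @[n --> \oo] --> x ->
  simple p (simple_scale c (u n)) @[n --> \oo] --> c *: x.
Proof.
move=> hu; rewrite (_ : (fun n => _) = fun n => c *: simple p (u n)).
  exact: cvg_scale.
by apply/funext => n; rewrite simpleZ.
Qed.

Lemma simple_cvgM u v x y : simple p (u n) @[n --> \oo] --> x ->
  simple p (v n) @[n --> \oo] --> y ->
  simple p (simple_mul (u n) (v n)) @[n --> \oo] --> x ** y.
Proof.
move=> hu hv; rewrite (_ : (fun n => _) = fun n => simple p (u n) ** simple p (v n)).
  exact: cvg_cmul.
by apply/funext => n; rewrite simpleM.
Qed.

Lemma simple_cvgS u x : simple p (u n) @[n --> \oo] --> x ->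
  simple p (simple_star (u n)) @[n --> \oo] --> star x.
Proof.
move=> hu; rewrite (_ : (fun n => _) = fun n => star (simple p (u n))).
  exact: cvg_star.
by apply/funext => n; rewrite simpleS.
Qed.

(* The value of [g] at a chosen point of [B] (0 if [B] is empty). *)
Definition sample (g : linfty R (vertex S)) B : R[i] :=
  if pselect (exists v, bset_val B v) is left h then g (sval (cid h)) else 0.

(** Evaluation at a point is multiplicative, and disjoint sets have orthogonal projections, so no
    mixed terms appear in a product. *)
Lemma sample_hom s : pairwise disjoint_sets s ->
  star_hom (fun g : linfty R (vertex S) => \sum_(q <- s) sample g q.2 *: p q.2).
Proof.
move=> sd; split=> [f g|c f|f g|f].
- rewrite -big_split; apply: eq_bigr => q _ /=; rewrite -scalerDl; congr (_ *: _).
  by rewrite /sample; case: pselect => // _; rewrite addr0.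
- rewrite scaler_sumr; apply: eq_bigr => q _; rewrite scalerA; congr (_ *: _).
  by rewrite /sample; case: pselect => // _; rewrite mulr0.
- have sM B : sample (f ** g) B = sample f B * sample g B.
    by rewrite /sample; case: pselect => // _; rewrite mulr0.
  elim: s sd => [_|q s ih]; first by rewrite !big_nil cmul0l.
  rewrite pairwise_cons !big_cons => /andP[/allP h1 /ih ->].
  have orth q' : q' \in s -> p q.2 ** p q'.2 = 0 /\ p q'.2 ** p q.2 = 0.
    move=> /h1/asboolP h; rewrite !(pfam_cap pP).
    by rewrite !(pfam_empty pP)//=; apply/seteqP; split=> // v [] a b; apply: (h v).
  have r0 : p q.2 ** (\sum_(q' <- s) sample g q'.2 *: p q'.2) = 0.
    rewrite cmul_sumr big_seq big1// => q' q's.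
    by rewrite cmulZr (orth _ q's).1 scaler0.
  have l0 : (\sum_(q' <- s) sample f q'.2 *: p q'.2) ** p q.2 = 0.
    rewrite cmul_suml big_seq big1// => q' q's.
    by rewrite cmulZl (orth _ q's).2 scaler0.
  have pp : p q.2 ** p q.2 = p q.2.
    by rewrite (pfam_cap pP); congr p; apply: bset_ext; rewrite /= setIid.
  rewrite cmulDl !cmulDr cmulZl [_ ** (_ *: p q.2)]cmulZr [in RHS]cmulZl.
  by rewrite cmulZr r0 l0 pp !scaler0 addr0 add0r scalerA -sM.
- rewrite star_sum; apply: eq_bigr => q _ /=; rewrite starZ (pfam_star pP); congr (_ *: _).
  by rewrite /sample; case: pselect => // _; rewrite rmorph0.
Qed.

(** Sampling the simple function returns its own coefficients, so the estimate is contractivity of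
    the sampling homomorphism. *)
Lemma nrm_simple_disjoint s : pairwise disjoint_sets s ->
  nrm (simple p s) <= nrm (simple chi s : A).
Proof.
move=> sd; have := star_hom_contractive (sample_hom sd) (sc_val (simple chi s : A)).
apply: le_trans; rewrite le_eqVlt; apply/predU1P; left; congr nrm.
rewrite /simple big_seq [RHS]big_seq; apply: eq_bigr => q qs.
rewrite /sample; case: pselect => [h|h].
  congr (_ *: _); exact/esym/(ev_simple_in sd qs (svalP (cid h))).
(* On an empty set the sampled coefficient 0 may differ from [q.1], but the projection vanishes. *)
by rewrite (pfam_empty pP) ?scaler0//; apply/seteqP; split=> // v Bv; case: h; exists v.
Qed.

End ProjectionFamily.

(** * Refinement of simple functions to disjoint sets *)

Definition additive_on (M : lmodType R[i]) (phi : bset S -> M) :=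
  forall B D, phi B = phi (bcap B D) + phi (bdiff B D).

Lemma disjoint_insert s (c : R[i]) B : pairwise disjoint_sets s ->
  exists s', [/\ pairwise disjoint_sets s',
    forall v, (exists2 q, q \in s' & bset_val q.2 v) -> 
      bset_val B v \/ (exists2 q, q \in s & bset_val q.2 v) &
    forall (M : lmodType R[i]) (phi : bset S -> M), additive_on phi ->
      simple phi s' = c *: phi B + simple phi s].
Proof.
elim: s B => [|[d D] s ih] B.
  move=> _; exists [:: (c, B)]; split=> // [v [q]|M phi _].
    by rewrite inE => /eqP ->; left.
  by rewrite /simple big_seq1 big_nil addr0.
rewrite pairwise_cons => /andP[/allP h1 /(ih (bdiff B D))[s' [s'd s'B s'E]]].
have off q v : q \in s' -> bset_val D v -> bset_val q.2 v -> False.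
  move=> qs Dv qv; have [|[_ //]|[q' q's q'v]] := s'B v; first by exists q.
  by have /asboolP := h1 _ q's; apply; first exact: Dv.
(* The first set [D] is cut along [B], and the rest of [B] has been inserted into the tail. The
   support condition on [s'] keeps its sets disjoint from [D]. *)
exists [:: (c + d, bcap B D), (d, bdiff D B) & s']; split.
- rewrite !pairwise_cons; apply/and3P; split=> //; first (apply/andP; split).
  + by apply/asboolP => v [Bv _] [_]; apply.
  + by apply/allP => q qs; apply/asboolP => v [_ Dv]; exact: off.
  + by apply/allP => q qs; apply/asboolP => v [Dv _]; exact: off.
- move=> v [q]; rewrite !inE => /or3P[/eqP-> [Bv _]|/eqP-> [Dv _]|qs qv].
  + by left.
  + by right; exists (d, D); rewrite ?mem_head.
  + have [|[Bv _]|[q' q's q'v]] := s'B v; first by exists q.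
      by left.
    by right; exists q'; rewrite // inE q's orbT.
- move=> M phi hphi; have := s'E M phi hphi; rewrite /simple !big_cons /= => ->.
  rewrite [phi B](hphi B D) [phi D](hphi D B) (_ : bcap D B = bcap B D); last first.
    by apply: bset_ext; rewrite /= setIC.
  rewrite scalerDl !scalerDr !addrA; congr (_ + _).
  by rewrite [LHS]addrAC; congr (_ + _); exact: addrAC.
Qed.

Lemma disjointify s : exists2 s', pairwise disjoint_sets s' &
  forall (M : lmodType R[i]) (phi : bset S -> M), additive_on phi ->
    simple phi s' = simple phi s.
Proof.
elim: s => [|[c B] s [s1 s1d s1E]]; first by exists [::].
have [s' [s'd _ s'E]] := disjoint_insert c B s1d; exists s' => // M phi hphi.
by rewrite s'E// s1E// /simple big_cons.
Qed.

Lemma nrm_simple (Y : cstarAlgType R) (p : bset S -> Y) s : projection_family p ->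
  nrm (simple p s) <= nrm (simple chi s : A).
Proof.
move=> pP; have [s' s'd s'E] := disjointify s.
rewrite -(s'E _ _ (pfam_split pP)) -(s'E _ _ (pfam_split chi_projections)).
exact: nrm_simple_disjoint.
Qed.

Lemma nrm_simpleB (Y : cstarAlgType R) (p : bset S -> Y) s s' : projection_family p ->
  nrm (simple p s - simple p s') <= nrm (simple chi s - simple chi s' : A).
Proof.
move=> pP; have := nrm_simple (s ++ simple_scale (-1) s') pP.
by rewrite !simple_cat !simpleZ !scaleN1r.
Qed.

(** * Density of simple functions, and *-homomorphisms determined by projections *)

Lemma sc_val_hom : star_hom (@sc_val R _ _ : A -> linfty R (vertex S)).
Proof. by split. Qed.

Lemma projection_family_hom (Y Z : cstarAlgType R) (f : Y -> Z) (p : bset S -> Y) :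
  star_hom f -> projection_family p -> projection_family (f \o p).
Proof.
move=> fH pP; split=> [B|B D|B D|B B0] /=.
- by rewrite -(star_homS fH) (pfam_star pP).
- by rewrite -(star_homM fH) (pfam_cap pP).
- by rewrite (pfam_cup pP) (star_homB fH) (star_homD fH).
- by rewrite (pfam_empty pP B0) (star_hom0 fH).
Qed.

Lemma star_hom_simple (Y Z : cstarAlgType R) (f : Y -> Z) (p : bset S -> Y) s : star_hom f ->
  f (simple p s) = simple (f \o p) s.
Proof.
by move=> fH; rewrite (star_hom_sum fH); apply: eq_bigr => q _; rewrite (star_homZ fH).
Qed.

(** Limits of simple functions form a closed *-subalgebra of the bounded functions that contains the
    generators. The argument runs in the ambient algebra, where the generated subalgebra is
    defined. *)
Lemma simple_dense (f : A) (e : R) : 0 < e -> exists s, nrm (f - simple chi s) <= e.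
Proof.
move: e.
pose c := @sc_val R _ _ \o chi; have cP : projection_family c.
  exact: projection_family_hom sc_val_hom chi_projections.
pose P := [set g : linfty R (vertex S) | exists u : nat -> seq (R[i] * bset S),
  simple c (u n) @[n --> \oo] --> g].
suff : P (sc_val f).
  case=> u /cvg_seq_nrmP h e /h/filter_ex[n hn]; exists (u n).
  by move: hn; rewrite /= -(star_hom_simple _ _ sc_val_hom).
suff h : cstar_gen [set char_fun R B | B in @lsets _ S] `<=` P.
  by case: f => f Pf; exact: h.
apply: smallest_sub; last first.
  move=> _ [B hB <-]; exists (fun=> [:: (1, Bset hB)]).
  by rewrite /simple big_seq1 scale1r; exact: cvg_cst.
split.
- by exists (fun=> [::]); rewrite /simple big_nil; exact: cvg_cst.
- by move=> g h [u hu] [v hv]; exists (fun n => u n ++ v n); exact: simple_cvgD.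
- by move=> k g [u hu]; exists (fun n => simple_scale k (u n)); exact: simple_cvgZ.
- move=> g h [u hu] [v hv]; exists (fun n => simple_mul (u n) (v n)).
  exact: simple_cvgM.
- by move=> g [u hu]; exists (fun n => simple_star (u n)); exact: simple_cvgS.
- apply/closed_nrmP => g hg; apply: (@approx_seq _ _ _ (simple c)) => e e0.
  have e20 : 0 < e / 2 by rewrite divr_gt0.
  have [h [u /cvg_seq_nrmP/(_ _ e20)/filter_ex[n hn]] gh] := hg _ e20.
  exists (u n); rewrite -[g](subrK h) -addrA [e]splitr.
  by apply: le_trans (nrmD _ _) _; rewrite lerD.
Qed.

Lemma simple_seq (f : A) : exists u : nat -> seq (R[i] * bset S),
  simple chi (u n) @[n --> \oo] --> f.
Proof. by apply: approx_seq => e; exact: simple_dense. Qed.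

Lemma star_hom_eq_chi (Y : cstarAlgType R) (pi pi' : A -> Y) :
  star_hom pi -> star_hom pi' -> (forall B, pi (chi B) = pi' (chi B)) -> pi = pi'.
Proof.
move=> pH pH' h; apply/funext => f; have [u hu] := simple_seq f.
apply: (cvg_seq_unique (star_hom_cvg pH hu)).
rewrite (_ : (fun n => _) = fun n => pi' (simple chi (u n))); first exact: star_hom_cvg.
apply/funext => n; rewrite !star_hom_simple//; apply: eq_bigr => q _ /=.
by rewrite h.
Qed.

(** The list operations realize sums, products and adjoints for [chi] and for [p] at once, so each
    algebraic identity for [pi] is a limit of identities between lists. *)
Lemma star_hom_ex (Y : cstarAlgType R) (p : bset S -> Y) : projection_family p ->
  exists2 pi : A -> Y, star_hom pi & forall B, pi (chi B) = p B.
Proof.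
move=> pP; have [||s s'|pi hpi] := @lipschitz_extension R A Y _ (simple chi) (simple p) 1.
- exact: ler01.
- exact: simple_dense.
- by rewrite mul1r; exact: nrm_simpleB.
have pi_simple s : pi (simple chi s) = simple p s.
  apply: nrm_le_eq => e e0; apply: le_trans (hpi _ _) _.
  by rewrite subrr nrm0 mulr0 ltW.
have cvg_pi u f : simple chi (u n) @[n --> \oo] --> (f : A) ->
    simple p (u n) @[n --> \oo] --> pi f.
  by apply: (cvg_lip (C := 1)).
exists pi; last by move=> B; have := pi_simple [:: (1, B)]; rewrite /simple !big_seq1 !scale1r.
have cP := chi_projections.
split.
- move=> f g; have [[u hu] [v hv]] := (simple_seq f, simple_seq g).
  apply: (cvg_seq_unique (cvg_pi _ _ (simple_cvgD hu hv))).
  by apply: simple_cvgD; exact: cvg_pi.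
- move=> c f; have [u hu] := simple_seq f.
  apply: (cvg_seq_unique (cvg_pi _ _ (simple_cvgZ (c := c) hu))).
  by apply: simple_cvgZ; exact: cvg_pi.
- move=> f g; have [[u hu] [v hv]] := (simple_seq f, simple_seq g).
  apply: (cvg_seq_unique (cvg_pi _ _ (simple_cvgM cP hu hv))).
  by apply: simple_cvgM => //; exact: cvg_pi.
- move=> f; have [u hu] := simple_seq f.
  apply: (cvg_seq_unique (cvg_pi _ _ (simple_cvgS cP hu))).
  by apply: simple_cvgS => //; exact: cvg_pi.
Qed.

End SimpleFunctions.

(** * The correspondence of a labelled space *)

Section LabelledModule.
Variables (R : realType) (L : countType) (S : wlrNormalSpace L).
Local Notation A := (lalg R S).
Local Notation X := (lmodule R S).
Local Notation chi := (@chi R L S).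
Local Notation delta := (@delta R L S).
Implicit Types (B D : bset S) (f g : A) (x y : X) (a b : L).

Lemma lalgC f g : f ** g = g ** f.
Proof. by apply: ev_ext => v; rewrite !evM mulrC. Qed.

Lemma rel_range1P (B : set (vertex S)) a v :
  rel_range B [:: a] v <-> exists e, [/\ lab e = a, B (src e) & rng e = v].
Proof.
split=> [[e [[|e' q] [_ //= [ea] Be ev]]]|[e [ea Be ev]]]; first by exists e.
by exists e, [::]; rewrite /= ea.
Qed.

Lemma brel_range_sub B a v : bset_val (brel_range B a) v -> bset_val (brange S a) v.
Proof. by move=> [e [q [h1 h2 _ h3]]]; exists e, q. Qed.

(** The elements fixed by multiplication with [chi (brange S a)] form a closed ideal containing the
    generator. *)
Lemma lideal_unit a f : ideal_set (lideal R S a) f -> chi (brange S a) ** f = f.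
Proof.
move=> /(_ [set f | chi (brange S a) ** f = f]); apply; split; last first.
  by move=> _ ->; apply: ev_ext => v; rewrite evM !ev_chi -natrM mulnb andbb.
split=> /=.
- exact: cmul0r.
- by move=> g h gE hE; rewrite cmulDr gE hE.
- by move=> c g gE; rewrite cmulZr gE.
- by move=> g h hE; rewrite lalgC -cmulA [h ** _]lalgC hE.
- by move=> g h gE; rewrite cmulA gE.
- apply/closed_nrmP => g hg.
  have {}hg e : 0 < e -> exists h : {h : A | chi (brange S a) ** h = h}, nrm (g - sval h) <= e.
    by move=> /hg[h hE gh]; exists (exist _ h hE).
  have [u hu] := approx_seq hg.
  apply: (cvg_seq_unique (cvg_cmul (cvg_cst (chi (brange S a))) hu)).
  rewrite (_ : (fun n => _) = (fun n => sval (u n)))//.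
  by apply/funext => n; exact: (svalP (u n)).
Qed.

Lemma dval_sum I (r : seq I) (F : I -> X) a :
  dval (\sum_(i <- r) F i) a = \sum_(i <- r) dval (F i) a.
Proof. by elim: r => [|i r ih]; rewrite ?big_nil// !big_cons -ih. Qed.

Lemma delta_ne a b : a != b -> dval (delta a) b = 0.
Proof. by rewrite /= /delta_fam eq_sym => /negPf ->. Qed.

Lemma delta_eq a : dval (delta a) a = chi (brange S a).
Proof. by rewrite /= /delta_fam eqxx. Qed.

Lemma delta_ract_eq a f : dval (ract (delta a) f) a = chi (brange S a) ** f.
Proof. by rewrite -delta_eq. Qed.

Lemma delta_ract_ne a b f : a != b -> dval (ract (delta a) f) b = 0.
Proof. by move=> /delta_ne h; rewrite -[LHS]/(dval (delta a) b ** f) h cmul0l. Qed.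

(** Partial sums over finite sets containing [a] are constant, since [chi (brange S a)] acts as a
    unit on the coordinate at [a]. *)
Lemma ip_delta a x : ip (delta a) x = dval x a.
Proof.
apply: dip_unique; apply/cvg_nrmP => e e0; apply/totallyP.
exists [fset a]%fset => F; rewrite fsub1set => aF /=.
rewrite /gram (bigD1_seq a) ?fset_uniq// big1 => [|b ba].
  rewrite -[X in _ - X]/(star (dval (delta a) a) ** dval x a + 0) addr0 delta_eq.
  rewrite (pfam_star (chi_projections R S)) lideal_unit ?subrr ?nrm0 ?ltW//.
  exact: dval_in.
by rewrite -[delta_fam _ _ _ _]/(dval (delta a) b) delta_ne 1?eq_sym// star0 cmul0l.
Qed.

(** The form of relation (ii) inside the module. *)
Lemma lact_delta f a : lact f (delta a) = ract (delta a) (letter_map a f) :> X.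
Proof.
apply: dsum_ext => b; rewrite -[LHS]/(letter_map b f ** dval (delta a) b).
rewrite -[RHS]/(dval (delta a) b ** letter_map a f).
have [->|ab] := eqVneq a b; first exact: lalgC.
by rewrite delta_ne// cmul0l cmul0r.
Qed.

Lemma lact_ract f x g : lact f (ract x g) = ract (lact f x) g :> X.
Proof. by apply: dsum_ext => b; exact: cmulA. Qed.

Lemma lact_sum f I (r : seq I) (F : I -> X) :
  lact f (\sum_(i <- r) F i) = \sum_(i <- r) lact f (F i).
Proof.
apply: dsum_ext => b; rewrite dval_sum.
rewrite -[LHS]/(letter_map b f ** dval (\sum_(i <- r) F i) b) dval_sum.
exact: cmul_sumr.
Qed.

Lemma nrm_lact f x : nrm (lact f x : X) <= nrm f * nrm x.
Proof.
rewrite !nrm_dsum; apply: dnorm_le => [|F v].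
  by apply: mulr_ge0; [exact: nrm_ge0 | exact: sqrtr_ge0].
apply: (@le_trans _ _ (Num.sqrt (nrm f ^+ 2 * qsum x F v))).
  rewrite ler_wsqrtr// /qsum mulr_sumr; apply: ler_sum => a _.
  rewrite -[ev _ _]/(ev (letter_map a f) v * ev (dval x a) v) cabsM exprMn.
  rewrite ler_wpM2r ?sqr_ge0// lerXn2r ?nnegrE ?cabs_ge0 ?nrm_ge0//.
  by apply: le_trans (ev_le _ _) (letter_map_nrm _ _).
rewrite sqrtrM ?sqr_ge0// sqrtr_sqr ger0_norm ?nrm_ge0//.
by rewrite ler_wpM2l ?nrm_ge0// qsum_le_dnorm.
Qed.

Definition finite_vec (w : seq (L * A)) : X := \sum_(q <- w) ract (delta q.1) q.2.

Lemma dval_finite_vec x (F : {fset L}) a :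
  dval (finite_vec [seq (b, dval x b) | b <- F]) a = if a \in F then dval x a else 0.
Proof.
rewrite /finite_vec big_map dval_sum; case: ifP => aF.
  rewrite (bigD1_seq a) ?fset_uniq// big1 => [|b ba].
    rewrite -[LHS]/(dval (ract (delta a) (dval x a)) a + 0) addr0 delta_ract_eq lideal_unit//.
    exact: dval_in.
  exact: delta_ract_ne.
rewrite big_seq big1// => b bF; apply: delta_ract_ne.
by apply: contraFneq aF => <-.
Qed.

Lemma finite_vec_dense x (e : R) : 0 < e -> exists w, nrm (x - finite_vec w) <= e.
Proof.
(* Tails are measured by sums of squares, hence the square of [e]. *)
move=> e0; have [F0 hF0] := dsum_small x (exprn_gt0 2 e0).
exists [seq (b, dval x b) | b <- F0]; set w := finite_vec _.
rewrite nrm_dsum; apply: dnorm_le => [|F v]; first exact: ltW.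
have yE a : dval (x - w) a = if a \in F0 then 0 else dval x a.
  rewrite -[LHS]/(dval x a - dval w a) dval_finite_vec.
  by case: ifP => _; rewrite ?subrr ?subr0.
rewrite -[e]ger0_norm ?(ltW e0)// -sqrtr_sqr ler_wsqrtr//.
apply: le_trans (hF0 (F0 `|` F)%fset v).
apply: le_trans (qsum_mono _ _ (fsubsetUr F0 F)) _.
rewrite /qsum (sum_fsetD _ (fsubsetUl F0 F)) [X in X + _]big_seq [X in X + _]big1 => [|a aF].
  rewrite add0r big_seq [leRHS]big_seq; apply: ler_sum => a.
  by rewrite in_fsetD yE => /andP[/negPf ->].
by rewrite yE aF ev0 cabs0 expr0n.
Qed.

Lemma finite_vec_seq x : exists u : nat -> seq (L * A),
  finite_vec (u n) @[n --> \oo] --> x.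
Proof. by apply: approx_seq => e; exact: finite_vec_dense. Qed.

Lemma finite_vec_cat w w' : finite_vec (w ++ w') = finite_vec w + finite_vec w'.
Proof. exact: big_cat. Qed.

Definition map_coeff (h : L -> A -> A) (w : seq (L * A)) := [seq (q.1, h q.1 q.2) | q <- w].

Lemma finite_vecZ (c : R[i]) w :
  finite_vec (map_coeff (fun _ f => c *: f) w) = c *: finite_vec w.
Proof.
by rewrite /finite_vec big_map scaler_sumr; apply: eq_bigr => q _; rewrite ractZr.
Qed.

Lemma lact_finite_vec f w :
  lact f (finite_vec w) = finite_vec (map_coeff (fun a g => letter_map a f ** g) w).
Proof.
rewrite lact_sum /finite_vec big_map; apply: eq_bigr => q _ /=.
by rewrite lact_ract lact_delta ractM.
Qed.

Lemma corr_rep_finite_vec (Y : cstarAlgType R) (pi : A -> Y) (t : X -> Y) w :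
  corr_rep pi t -> t (finite_vec w) = \sum_(q <- w) t (delta q.1) ** pi q.2.
Proof.
by move=> h; rewrite (rep_t_sum h); apply: eq_bigr => q _; rewrite (rep_ract h).
Qed.

(** Injectivity of the correspondence: [pi] is determined on simple functions and [t] on the vectors
    [finite_vec w], both dense, and both maps are contractive. *)
Lemma corr_rep_eq (Y : cstarAlgType R) (pi pi' : A -> Y) (t t' : X -> Y) :
  corr_rep pi t -> corr_rep pi' t' -> (forall B, pi (chi B) = pi' (chi B)) ->
  (forall a, t (delta a) = t' (delta a)) -> pi = pi' /\ t = t'.
Proof.
move=> h h' pE tE; have ppE := star_hom_eq_chi (rep_pi h) (rep_pi h') pE.
split=> //; apply/funext => x; have [u hu] := finite_vec_seq x.
have tcvg (pi0 : A -> Y) t0 : corr_rep pi0 t0 -> t0 (finite_vec (u n)) @[n --> \oo] --> t0 x.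
  move=> h0; apply: (cvg_lip (C := 1)) hu => n.
  by rewrite -(rep_tB h0) mul1r; exact: nrm_rep_t h0 _.
apply: (cvg_seq_unique (tcvg _ _ h)).
rewrite (_ : (fun n => _) = fun n => t' (finite_vec (u n))); first exact: tcvg h'.
apply/funext => n; rewrite (corr_rep_finite_vec _ h) (corr_rep_finite_vec _ h').
by apply: eq_bigr => q _; rewrite tE ppE.
Qed.

(** * Construction of [t] from the images of the vectors [delta a] *)

Section Creation.
Variables (Y : cstarAlgType R) (pi : A -> Y) (s : L -> Y).
Hypotheses (pH : star_hom pi) (s_ip : forall a b, star (s a) ** s b = pi (ip (delta a) (delta b))).
Hypothesis s_comm : forall B a, pi (chi B) ** s a = s a ** pi (chi (brel_range B a)).
Hypothesis s_unit : forall a, s a ** pi (chi (brange S a)) = s a.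

Definition creation (w : seq (L * A)) : Y := \sum_(q <- w) s q.1 ** pi q.2.

Lemma creation_cat w w' : creation (w ++ w') = creation w + creation w'.
Proof. exact: big_cat. Qed.

Lemma creationZ (c : R[i]) w :
  creation (map_coeff (fun _ f => c *: f) w) = c *: creation w.
Proof.
rewrite /creation big_map scaler_sumr; apply: eq_bigr => q _ /=.
by rewrite (star_homZ pH) cmulZr.
Qed.

(** The isometric formula behind the extension: with contractivity of [pi] it bounds [creation] by
    the norm of [finite_vec]. *)
Lemma creation_ip w w' :
  star (creation w) ** creation w' = pi (ip (finite_vec w) (finite_vec w')).
Proof.
rewrite star_sum cmul_suml ip_suml (star_hom_sum pH); apply: eq_bigr => q _.
rewrite cmul_sumr ip_sumr (star_hom_sum pH); apply: eq_bigr => q' _.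
rewrite ip_ractl ip_ract !(star_homM pH) -s_ip (star_homS pH) starM.
by rewrite !cmulA.
Qed.

(** The hypothesis [s_comm] extends from the [chi B] to all of the algebra by linearity and
    density. *)
Lemma s_letter_map f a : pi f ** s a = s a ** pi (letter_map a f).
Proof.
have [u hu] := simple_seq f.
have aH := @letter_mapP R L S a.
apply: (cvg_seq_unique (cvg_cmul (star_hom_cvg pH hu) (cvg_cst (s a)))).
rewrite (_ : (fun n => _) = fun n => s a ** pi (letter_map a (simple chi (u n)))).
  apply: cvg_cmul (cvg_cst _) _.
  exact: star_hom_cvg pH (star_hom_cvg (letter_star_hom aH) hu).
apply/funext => n; rewrite (star_hom_sum pH) (star_hom_sum (letter_star_hom aH)).
rewrite (star_hom_sum pH) cmul_suml cmul_sumr; apply: eq_bigr => q _.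
rewrite (star_homZ (letter_star_hom aH)) !(star_homZ pH) cmulZl cmulZr.
by rewrite s_comm (letter_chi aH).
Qed.

Lemma nrm_creationB w w' :
  nrm (creation w - creation w') <= nrm (finite_vec w - finite_vec w').
Proof.
have -> : creation w - creation w' = creation (w ++ map_coeff (fun _ f => -1 *: f) w').
  by rewrite creation_cat creationZ scaleN1r.
have -> : finite_vec w - finite_vec w' = finite_vec (w ++ map_coeff (fun _ f => -1 *: f) w').
  by rewrite finite_vec_cat finite_vecZ scaleN1r.
rewrite -(@ler_pXn2r _ 2)// ?nnegrE ?nrm_ge0// -nrm_cstar creation_ip -nrm_ip.
exact: star_hom_contractive.
Qed.

Lemma corr_rep_ex : exists2 t : X -> Y, corr_rep pi t & forall a, t (delta a) = s a.
Proof.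
have [||w w'|t ht] := @lipschitz_extension R X Y _ finite_vec creation 1.
- exact: ler01.
- exact: finite_vec_dense.
- by rewrite mul1r; exact: nrm_creationB.
have tE w : t (finite_vec w) = creation w.
  apply: nrm_le_eq => e e0; apply: le_trans (ht _ _) _.
  by rewrite subrr nrm0 mulr0 ltW.
have tcvg u x : finite_vec (u n) @[n --> \oo] --> x -> creation (u n) @[n --> \oo] --> t x.
  by apply: (cvg_lip (C := 1)).
exists t; last first.
  move=> a; have := tE [:: (a, chi (brange S a))].
  rewrite /creation /finite_vec !big_seq1 s_unit => <-; congr t.
  apply: dsum_ext => b; have [<-|ab] := eqVneq a b; last by rewrite delta_ract_ne ?delta_ne.
  by rewrite delta_ract_eq delta_eq lideal_unit//; exact: chi_in_lideal.
split=> //.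
- move=> x y; have [[u hu] [v hv]] := (finite_vec_seq x, finite_vec_seq y).
  have : finite_vec (u n ++ v n) @[n --> \oo] --> x + y.
    rewrite (_ : (fun n => _) = fun n => finite_vec (u n) + finite_vec (v n)).
      exact: cvgD.
    by apply/funext => n; rewrite finite_vec_cat.
  move=> /tcvg h; apply: (cvg_seq_unique h).
  rewrite (_ : (fun n => _) = fun n => creation (u n) + creation (v n)).
    by apply: cvgD; exact: tcvg.
  by apply/funext => n; rewrite creation_cat.
- move=> c x; have [u hu] := finite_vec_seq x.
  have : finite_vec (map_coeff (fun _ f => c *: f) (u n)) @[n --> \oo] --> c *: x.
    rewrite (_ : (fun n => _) = fun n => c *: finite_vec (u n)); first exact: cvg_scale.
    by apply/funext => n; rewrite finite_vecZ.
  move=> /tcvg h; apply: (cvg_seq_unique h).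
  rewrite (_ : (fun n => _) = fun n => c *: creation (u n)).
    by apply: cvg_scale; exact: tcvg.
  by apply/funext => n; rewrite creationZ.
- move=> x y; have [[u hu] [v hv]] := (finite_vec_seq x, finite_vec_seq y).
  apply: (cvg_seq_unique (cvg_cmul (cvg_star (tcvg _ _ hu)) (tcvg _ _ hv))).
  rewrite (_ : (fun n => _) = fun n => pi (ip (finite_vec (u n)) (finite_vec (v n)))).
    by apply: star_hom_cvg pH _; exact: cvg_ip.
  by apply/funext => n; rewrite creation_ip.
- move=> f x; have [u hu] := finite_vec_seq x.
  apply: (cvg_seq_unique (cvg_cmul (cvg_cst (pi f)) (tcvg _ _ hu))).
  rewrite (_ : (fun n => _) =
    fun n => creation (map_coeff (fun a g => letter_map a f ** g) (u n))).
    apply: tcvg; rewrite (_ : (fun n => _) = fun n => lact f (finite_vec (u n))).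
      apply: (cvg_lip (C := nrm f)) hu => n.
      have -> : lact f x - lact f (finite_vec (u n)) = lact f (x - finite_vec (u n)).
        by apply: dsum_ext => b; exact/esym/cmulBr.
      exact: nrm_lact.
    by apply/funext => n; rewrite lact_finite_vec.
  apply/funext => n; rewrite /creation big_map cmul_sumr; apply: eq_bigr => q _ /=.
  by rewrite (star_homM pH) !cmulA s_letter_map.
Qed.

End Creation.

End LabelledModule.

(** * The Katsura ideal *)

Section KatsuraIdeal.
Variables (R : realType) (L : countType) (S : wlrNormalSpace L).
Local Notation A := (lalg R S).
Local Notation X := (lmodule R S).
Local Notation chi := (@chi R L S).
Local Notation delta := (@delta R L S).
Implicit Types (B C D : bset S) (f g : A) (x y : X) (a b : L).

Definition regular_set B := finite_set (labels_from (bset_val B)) /\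
  forall C, C `<=` sinks S -> B `&` C = set0.

Lemma chi_empty B : (forall v, ~ bset_val B v) -> chi B = 0.
Proof.
by move=> B0; apply: (pfam_empty (chi_projections R S)); apply/seteqP; split=> // v /B0.
Qed.

Lemma brel_range_empty B a : ~ labels_from (bset_val B) a -> chi (brel_range B a) = 0.
Proof.
move=> Ba; apply: chi_empty => v /rel_range1P[e [ea Be _]]; apply: Ba.
by exists e.
Qed.

(** On the coordinate at [b] only the term of the letter [b] survives; if [b] labels no edge leaving
    [B], both sides vanish because the relative range is empty. *)
Lemma lact_chi B : finite_set (labels_from (bset_val B)) ->
  lact (chi B) = rank_op [seq (ract (delta a) (chi (brel_range B a)), delta a : X) |
                         a <- fset_set (labels_from (bset_val B))] :> (X -> X).
Proof.
move=> finB; apply/funext => x; apply: dsum_ext => b.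
rewrite -[LHS]/(letter_map b (chi B) ** dval x b) (letter_chi (@letter_mapP R L S b)).
rewrite /rank_op big_map dval_sum.
have termE a : dval (theta (ract (delta a) (chi (brel_range B a))) (delta a) x) b =
    dval (delta a) b ** chi (brel_range B a) ** dval x a.
  by rewrite /theta ip_delta.
rewrite (eq_bigr _ (fun a _ => termE a)).
have [bB|bB] := pselect (labels_from (bset_val B) b).
  have bF : b \in fset_set (labels_from (bset_val B)) by rewrite in_fset_set// mem_set.
  rewrite (bigD1_seq b) ?fset_uniq// big1 => [|a ab].
    rewrite -[RHS]/(dval (delta b) b ** chi (brel_range B b) ** dval x b + 0) addr0.
    rewrite delta_eq (pfam_cap (chi_projections R S)); congr (chi _ ** _).
    apply: bset_ext => /=; apply/seteqP; split=> [v h|v []//].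
    by split=> //; exact: brel_range_sub h.
  by rewrite delta_ne// !cmul0l.
rewrite brel_range_empty// cmul0l big_seq big1// => a.
rewrite in_fset_set// inE => aB; rewrite delta_ne ?cmul0l//.
by apply/eqP => ab; apply: bB; rewrite -ab.
Qed.

(** The action of [g] on [delta a] recovers [letter_map a g] as a coordinate. *)
Lemma lact_eq0 g : (forall x, lact g x = 0 :> X) <-> (forall a, letter_map a g = 0).
Proof.
split=> [h a|h x]; last first.
  by apply: dsum_ext => a; rewrite -[LHS]/(letter_map a g ** dval x a) h cmul0l.
have := lact_delta g a; rewrite h => /(congr1 (fun x : X => dval x a)).
rewrite delta_ract_eq lideal_unit => [/esym//|].
exact: letter_lideal (@letter_mapP R L S a) g.
Qed.

(** An edge leaving [B] puts its range in the relative range for its label. With [lact_eq0], the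
    sets of sinks are those whose [chi] acts by zero. *)
Lemma sinks_brel_range B : B `<=` sinks S <-> forall a, chi (brel_range B a) = 0.
Proof.
split=> [h a|h v Bv e sev].
  by apply: brel_range_empty => -[e Be _]; exact: (h _ Be e).
have /(congr1 (fun f : A => ev f (rng e))) := h (lab e).
rewrite ev_chi mem_set => [/eqP|]; first by rewrite oner_eq0.
by apply/rel_range1P; exists e; split=> //; rewrite sev.
Qed.

(** [chi C ** f - c *: chi C] has norm at most [e], and so has its image under the contractive
    [letter_map a]; this image is evaluated at [w]. *)
Lemma letter_map_near f C (c : R[i]) (e : R) a w : 0 <= e ->
  (forall v, bset_val C v -> cabs (ev f v - c) <= e) ->
  bset_val (brel_range C a) w -> cabs (ev (letter_map a f) w - c) <= e.
Proof.
move=> e0 h wC; have aH := @letter_mapP R L S a; have lH := letter_star_hom aH.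
have := letter_map_nrm a (chi C ** f - c *: chi C).
rewrite (star_homB lH) (star_homM lH) (star_homZ lH) !(letter_chi aH) => hn.
have := ev_le (chi (brel_range C a) ** letter_map a f - c *: chi (brel_range C a)) w.
rewrite evB evM evZ ev_chi mem_set// mul1r mulr1 => /le_trans; apply.
apply: (le_trans hn); apply: le_nrm => // v; rewrite evB evM evZ ev_chi.
case: (boolP (v \in bset_val C)); last by rewrite mul0r mulr0 subr0 cabs0.
by rewrite inE mul1r mulr1; exact: h.
Qed.

Lemma disjoint_dense f (e : R) : 0 < e ->
  exists2 s, pairwise (@disjoint_sets R L S) s & nrm (f - simple chi s) <= e.
Proof.
move=> /(simple_dense f)[s hs]; have [s' s'd s'E] := disjointify s.
exists s' => //; rewrite s'E//; exact: pfam_split (chi_projections R S).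
Qed.

Lemma simple_near f s (e : R) q v : pairwise (@disjoint_sets R L S) s ->
  nrm (f - simple chi s) <= e -> q \in s -> bset_val q.2 v -> cabs (ev f v - q.1) <= e.
Proof.
move=> sd fs qs qv; rewrite -(ev_simple_in sd qs qv) -evB.
exact: le_trans (ev_le _ _) fs.
Qed.

(** If [g] acts by zero but [g v] is nonzero for some [v] in [B], then [g] is close to a nonzero
    constant on a piece around [v]. Since every [letter_map a g] vanishes, that piece meets [B] in
    sinks only, against regularity. *)
Lemma katsura_regular B : regular_set B -> katsura_ideal X (chi B).
Proof.
move=> [finB sinkB]; split.
  by rewrite lact_chi//; exact: op_cvg_compacts (@op_cvg_rank _ _ _ _).
move=> g /lact_eq0 g0; apply: ev_ext => v; rewrite evM ev_chi ev0.
case: (boolP (v \in bset_val B)); last by rewrite mul0r.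
rewrite inE mul1r => Bv; apply: cabs0_eq0; apply/eqP; rewrite eq_le cabs_ge0 andbT.
rewrite leNgt; apply/negP => gv.
(* An error of one third of |g v| leaves the constant of the piece above [e], which contradicts
   [letter_map_near] at any point of the relative range. *)
pose e := cabs (ev g v) / 3; have e0 : 0 < e by rewrite divr_gt0.
have gE : cabs (ev g v) = 3 * e by rewrite /e; field.
have [s sd gs] := disjoint_dense g e0.
have [[q qs qv]|out] := pselect (exists2 q, q \in s & bset_val q.2 v); last first.
  have := le_trans (ev_le _ v) gs; rewrite evB ev_simple_out ?subr0 ?gE => [|q qs qv]; first lra.
  by apply: out; exists q.
have qc : e < cabs q.1.
  have := simple_near sd gs qs qv; have := cabsD (ev g v - q.1) q.1.
  by rewrite subrK gE; lra.
suff : bcap B q.2 `<=` sinks S.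
  by move=> /sinkB/seteqP[+ _] => /(_ v); apply.
apply/sinks_brel_range => a; apply: chi_empty => w wC.
have := @letter_map_near g (bcap B q.2) q.1 e a w (ltW e0).
rewrite g0 ev0 sub0r cabsN leNgt qc => h; suff : false by [].
by apply: h => // u [_ qu]; exact: simple_near sd gs qs qu.
Qed.

Lemma nrm_chi B : nrm (chi B) <= 1.
Proof.
apply: le_nrm => // v; rewrite ev_chi.
by case: (v \in _); rewrite ?cabs0 ?cabs1.
Qed.

Lemma nrm_delta a : nrm (delta a : X) <= 1.
Proof.
rewrite -(@ler_pXn2r _ 2)// ?nnegrE ?nrm_ge0// -nrm_ip ip_delta delta_eq expr1n.
exact: nrm_chi.
Qed.

Lemma coord_small x (e : R) : 0 < e ->
  exists F0 : {fset L}, forall a, a \notin F0 -> nrm (dval x a) <= e.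
Proof.
move=> e0; have [F0 hF0] := dsum_small x (exprn_gt0 2 e0); exists F0 => a aF.
apply: le_nrm => [|v]; first exact: ltW.
have := hF0 [fset a]%fset v.
have -> : ([fset a] `\` F0 = [fset a])%fset.
  by apply/fsetP => b; rewrite !inE andbC; case: eqP => // ->; rewrite aF.
by rewrite /qsum big_seq_fset1 ler_pXn2r ?nnegrE ?cabs_ge0 ?(ltW e0).
Qed.

(** Uniformity in [z] is the point: a finite-rank operator is nearly zero in all but finitely many
    letters. *)
Lemma rank_coord_small (s : seq (X * X)) (e : R) : 0 < e -> exists F0 : {fset L},
  forall a z, a \notin F0 -> nrm (dval (rank_op s z) a) <= e * nrm z.
Proof.
elim: s e => [|p s ih] e e0.
  exists fset0 => a z _; rewrite /rank_op big_nil.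
  by rewrite -[dval _ _]/(0 : A) nrm0 mulr_ge0 ?nrm_ge0// ltW.
have e20 : 0 < e / 2 by rewrite divr_gt0.
have K0 : 0 < 2 * nrm p.2 + 1 by rewrite ltr_wpDl ?mulr_ge0 ?nrm_ge0.
have [F hF] := ih _ e20; have [G hG] := coord_small p.1 (divr_gt0 e20 K0).
exists (F `|` G)%fset => a z; rewrite in_fsetU negb_or => /andP[aF aG].
rewrite /rank_op big_cons [e]splitr mulrDl.
apply: le_trans (nrmD (dval (theta p.1 p.2 z) a) _) _; rewrite addrC lerD ?hF//.
apply: le_trans (nrmM (dval p.1 a) (ip p.2 z)) _.
apply: (@le_trans _ _ (e / 2 / (2 * nrm p.2 + 1) * ((2 * nrm p.2 + 1) * nrm z))).
  rewrite ler_pM ?nrm_ge0 ?hG//; apply: le_trans (nrm_ip_le _ _) _.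
  by rewrite mulrA ler_wpM2r ?nrm_ge0// lerDl.
by rewrite mulrA divfK// gt_eqF.
Qed.

Lemma katsura_approx f (e : R) : katsura_ideal X f -> 0 < e ->
  exists2 s, (forall q, q \in s -> regular_set q.2) & nrm (f - simple chi s) <= e.
Proof.
move=> [fc fk] e0; pose d := e / 3; have d0 : 0 < d by rewrite divr_gt0.
have eE : e = 3 * d by rewrite /d; field.
have [s sd fs] := disjoint_dense f d0.
(* Where a piece is discarded, |f| <= 2 d + d = e; where it is kept, [f] stays away from 0, which
   forces regularity. *)
pose r := [seq q <- s | 2 * d < cabs q.1]; exists r.
  move=> q; rewrite mem_filter => /andP[qd qs].
  have fq v : bset_val q.2 v -> cabs (ev f v - q.1) <= d := simple_near sd fs qs.
  split; last first.
    (* The intersection with a set of sinks acts by zero, so [f] vanishes on it although it is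
       within [d] of a constant larger than [2 * d]. *)
    move=> C Cs; apply/seteqP; split=> // v [qv Cv].
    have : f ** chi (bcap q.2 C) = 0.
      apply: fk; apply/lact_eq0 => a; rewrite (letter_chi (@letter_mapP R L S a)).
      have Ds : bcap q.2 C `<=` sinks S by move=> u [_ /Cs].
      by have /sinks_brel_range := Ds; apply.
    move=> /(congr1 (fun g : A => ev g v)); rewrite evM ev_chi mem_set ?mulr1// ev0 => fv.
    have := fq _ qv; rewrite fv sub0r cabsN; lra.
  have d20 : 0 < d / 2 by rewrite divr_gt0.
  have /compactsP/(_ _ d20)[w hw] := fc.
  have [F hF] := rank_coord_small w d20.
  apply: (@sub_finite_set _ _ [set` F]) => [a [e' qe ea]|]; last exact: finite_fset.
  (* For a label outside [F], compactness makes [letter_map a f] at most [d / 2 + d / 2], while at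
     the range of an edge it is within [d] of [q.1]. *)
  apply: contrapT => /negP aF; pose u := rng e'.
  have ua : bset_val (brel_range q.2 a) u by apply/rel_range1P; exists e'.
  have := letter_map_near (ltW d0) fq ua.
  have h1 : cabs (ev (letter_map a f) u) <= d.
    have -> : letter_map a f = dval (lact f (delta a) : X) a.
      rewrite lact_delta delta_ract_eq lideal_unit//.
      exact: letter_lideal (@letter_mapP R L S a) f.
    apply: le_trans (ev_le _ _) _.
    rewrite -[dval _ _](subrK (dval (rank_op w (delta a)) a)).
    apply: le_trans (nrmD _ _) _; rewrite [leRHS]splitr lerD//.
      apply: le_trans (dval_nrm (lact f (delta a) - rank_op w (delta a)) a) _.
      apply: le_trans (hw _) _.
      by rewrite ler_piMr ?nrm_delta// ltW.
    apply: le_trans (hF _ _ aF) _.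
    by rewrite ler_piMr ?nrm_delta// ltW.
  have := cabsD (ev (letter_map a f) u) (- (ev (letter_map a f) u - q.1)).
  rewrite opprB addrC subrK cabsB; lra.
apply: le_nrm => [|v]; first exact: ltW.
rewrite evB; have rs q : q \in r -> q \in s by rewrite mem_filter => /andP[].
have rd : pairwise (@disjoint_sets R L S) r by exact: pairwise_filter.
have fv := le_trans (ev_le _ v) fs; rewrite evB in fv.
have [[q qr qv]|out] := pselect (exists2 q, q \in r & bset_val q.2 v).
  rewrite (ev_simple_in rd qr qv) -(ev_simple_in sd (rs _ qr) qv).
  by apply: (le_trans fv); lra.
rewrite [X in _ - X]ev_simple_out ?subr0 => [|q qr qv]; last by apply: out; exists q.
have [[q qs qv]|out'] := pselect (exists2 q, q \in s & bset_val q.2 v); last first.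
  move: fv; rewrite ev_simple_out ?subr0 => [|q qs qv]; first by lra.
  by apply: out'; exists q.
move: fv; rewrite (ev_simple_in sd qs qv); have := cabsD (ev f v - q.1) q.1.
rewrite subrK; have : cabs q.1 <= 2 * d; last by lra.
rewrite leNgt; apply/negP => qd; apply: out; exists q => //.
by rewrite mem_filter qd.
Qed.

End KatsuraIdeal.

(** * From covariant representations to labelled ones and back *)

Section Correspondence.
Variables (R : realType) (L : countType) (S : wlrNormalSpace L) (Y : cstarAlgType R).
Local Notation A := (lalg R S).
Local Notation X := (lmodule R S).
Local Notation chi := (@chi R L S).
Local Notation delta := (@delta R L S).
Implicit Types (B C D : bset S) (f g : A) (x y : X) (a b : L).

Lemma ip_deltas a b : ip (delta a) (delta b) = if b == a then chi (brange S a) else 0 :> A.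
Proof.
rewrite ip_delta; case: eqP => [->|/eqP ba]; first exact: delta_eq.
exact: delta_ne.
Qed.

Lemma lact_chi_delta B a :
  lact (chi B) (delta a) = ract (delta a) (chi (brel_range B a)) :> X.
Proof. by rewrite lact_delta (letter_chi (@letter_mapP R L S a)). Qed.

Lemma covariant_labelled (pi : A -> Y) (t : X -> Y) : covariant_rep pi t ->
  labelled_rep (fun B : bset S => pi (chi B)) (fun a => t (delta a)).
Proof.
move=> [rep [psi psiH cov]]; have pH := rep_pi rep.
have pP := projection_family_hom pH (chi_projections R S).
have source a : star (t (delta a)) ** t (delta a) = pi (chi (brange S a)).
  by rewrite (rep_ip rep) ip_deltas eqxx.
split=> //.
- move=> B; split; first exact: (pfam_star pP B).
  by rewrite [LHS](pfam_cap pP); congr (pi (chi _)); apply: bset_ext; rewrite /= setIid.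
- move=> a; rewrite -cmulA source -(rep_ract rep); congr t.
  apply: dsum_ext => b; have [<-|ab] := eqVneq a b; last by rewrite delta_ract_ne ?delta_ne.
  by rewrite delta_ract_eq delta_eq lideal_unit//; exact: chi_in_lideal.
- exact: (pfam_cap pP).
- exact: (pfam_cup pP).
- exact: (pfam_empty pP).
- by move=> B a; rewrite (rep_lact rep) lact_chi_delta (rep_ract rep).
- by move=> a b /eqP ab; rewrite (rep_ip rep) ip_deltas eq_sym (negPf ab) (star_hom0 pH).
(* Relation (iv) is covariance at [chi B], where the left action is an explicit finite-rank
   operator. *)
- move=> B finB sinkB; rewrite (cov _ (katsura_regular _ _)); last by split.
  rewrite lact_chi// (induced_hom_rank _ psiH) /rank_val big_map fsbig_finite//=.
  by apply: eq_bigr => a _; rewrite (rep_ract rep).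
Qed.

Lemma labelled_covariant (p : bset S -> Y) (s : L -> Y) : labelled_rep p s ->
  exists pi t, [/\ covariant_rep pi t, forall B, pi (chi B) = p B &
    forall a, t (delta a) = s a].
Proof.
move=> h; have pP : projection_family p.
  split; [by move=> B; have [] := lrep_proj h B | exact: lrep_cap h | |].
    exact: lrep_cup h.
  exact: lrep_empty h.
have [pi pH piE] := star_hom_ex pP.
have [a b|B a|a|t rep tE] := @corr_rep_ex R L S Y pi s pH.
- rewrite ip_deltas; case: eqP => [->|ba]; first by rewrite piE (lrep_source h).
  by rewrite (star_hom0 pH) (lrep_orth h)// => ab; apply: ba.
- by rewrite !piE (lrep_comm h).
- by rewrite piE -(lrep_source h) cmulA (lrep_pisom h).
exists pi, t; split=> //; split=> //.
exists (induced_map rep) => [|f fK]; first exact: induced_map_hom.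
set psi := induced_map rep; have psiH : induced_hom t psi := induced_map_hom rep.
(* Conversely, relation (iv) gives covariance on regular sets; linearity extends it to simple
   functions over them, and approximation to the Katsura ideal. *)
have psi_reg B : regular_set B -> psi (lact (chi B)) = p B.
  move=> [finB sinkB]; rewrite lact_chi// (induced_hom_rank _ psiH) /rank_val big_map.
  rewrite (lrep_sum h)// fsbig_finite//=; apply: eq_bigr => a _.
  by rewrite (rep_ract rep) !tE piE.
have psi_simple w : (forall q, q \in w -> regular_set q.2) ->
    compacts (lact (simple chi w : A) : X -> X) /\
    psi (lact (simple chi w : A)) = simple p w.
  elim: w => [_|q w ih hw].
    have -> : lact (simple chi [::] : A) = rank_op [::] :> (X -> X).
      apply/funext => x; rewrite /simple /rank_op !big_nil.
      by move: x; apply/lact_eq0 => a; rewrite (star_hom0 (letter_star_hom (@letter_mapP R L S a))).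
    split; first exact: op_cvg_compacts (@op_cvg_rank _ _ _ _).
    by rewrite (induced_hom_rank _ psiH) /rank_val /simple !big_nil.
  have [c1 e1] : compacts (lact (simple chi w : A) : X -> X) /\
      psi (lact (simple chi w : A)) = simple p w.
    by apply: ih => q' q'w; apply: hw; rewrite inE q'w orbT.
  have qreg : regular_set q.2 by apply: hw; rewrite mem_head.
  have [c2 _] := katsura_regular R qreg.
  have [u hu] := compacts_seq c1; have [v hv] := compacts_seq c2.
  have c3 := op_cvg_compacts (op_cvgZ (q.1) hv).
  have -> : lact (simple chi (q :: w) : A) =
      (fun x => q.1 *: lact (chi q.2) x + lact (simple chi w : A) x) :> (X -> X).
    by apply/funext => x; rewrite /simple big_cons lactD lactZ.
  split; first exact: op_cvg_compacts (op_cvgD (op_cvgZ (q.1) hv) hu).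
  apply: (etrans (inducedD psiH c3 c1)); rewrite (inducedZ psiH q.1 c2) e1.
  by rewrite (psi_reg _ qreg) /simple big_cons.
apply: nrm_le_eq => e e0; have d0 : 0 < e / 3 by rewrite divr_gt0.
have [w hw fw] := katsura_approx fK d0.
have [cw ew] := psi_simple w hw; have [cf _] := fK.
pose g : A := simple chi w.
have lactB : lact (g - f) = (fun x => lact g x + (-1) *: lact f x) :> (X -> X).
  by apply/funext => x; rewrite -scaleN1r lactD lactZ.
(* The values at [g] cancel. The first term costs [e / 3] and the second [2 * (e / 3)], by the
   factor 2 in [induced_map_bound]. *)
have -> : pi f - psi (lact f) = pi (f - g) + psi (lact (g - f)).
  rewrite lactB; have [u hu] := compacts_seq cf.
  rewrite (inducedD psiH cw (op_cvg_compacts (op_cvgZ (-1) hu))).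
  rewrite (inducedZ psiH (-1) cf) scaleN1r ew (star_homB pH) (star_hom_simple _ _ pH).
  have -> : pi \o chi = p by apply/funext.
  by rewrite addrA subrK.
apply: le_trans (nrmD _ _) _.
have h1 : nrm (pi (f - g)) <= e / 3.
  by apply: le_trans fw; exact: star_hom_contractive.
have h2 : nrm (psi (lact (g - f))) <= 2 * (e / 3).
  apply: induced_map_bound; [|exact: ltW|].
    have [[u hu] [v hv]] := (compacts_seq cw, compacts_seq cf).
    rewrite lactB; exact: op_cvg_compacts (op_cvgD hu (op_cvgZ (-1) hv)).
  move=> x; apply: le_trans (nrm_lact _ _) _.
  by rewrite ler_wpM2r ?nrm_ge0// nrmB.
lra.
Qed.

Lemma corr_rep_hom (Z : cstarAlgType R) (rho : Y -> Z) (pi : A -> Y) (t : X -> Y) :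
  star_hom rho -> corr_rep pi t -> corr_rep (rho \o pi) (rho \o t).
Proof.
move=> rH h; split=> [|x y|c x|x y|f x] /=.
- exact: star_hom_comp rH (rep_pi h).
- by rewrite (rep_tD h) (star_homD rH).
- by rewrite (rep_tZ h) (star_homZ rH).
- by rewrite -(star_homS rH) -(star_homM rH) (rep_ip h).
- by rewrite -(star_homM rH) (rep_lact h).
Qed.

End Correspondence.

(** * The bijection of representations and the isomorphism of universal algebras *)

Theorem theorem3p8 (R : realType) (L : countType) (S : wlrNormalSpace L) :
  (forall Y : cstarAlgType R,
    set_bij
      [set pt : (lalg R S -> Y) * (lmodule R S -> Y) |
        covariant_rep pt.1 pt.2]
      [set ps : (bset S -> Y) * (L -> Y) | labelled_rep ps.1 ps.2]
      (fun pt => (fun B : bset S => pt.1 (chi R B),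
                  fun a : L => pt.2 (delta R S a)))) /\
  (forall (O : cstarAlgType R) (pi : lalg R S -> O) (t : lmodule R S -> O)
     (C : cstarAlgType R) (p : bset S -> C) (s : L -> C),
    is_cuntz_pimsner pi t -> is_labelled_cstar p s -> cstar_isomorphic O C).
Proof.
split=> [Y|O pi t C p s [cov Ogen Ouniv] [lab Cgen Cuniv]].
  split=> [[pi t] /= /covariant_labelled //|[pi t] [pi' t']|[p s] /= h].
    rewrite !inE /= => -[rep _] [rep' _] [pE tE].
    have [|a|-> ->] // := corr_rep_eq rep rep'.
      by move=> B; exact: (congr1 (@^~ B) pE).
    exact: (congr1 (@^~ a) tE).
  have [pi [t [cov pE tE]]] := labelled_covariant h.
  by exists (pi, t) => //=; congr pair; apply/funext.
(* Each universal representation is transported to the other side, which gives [rho] from [C] to [O]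
   and [sigma] from [O] to [C]; both composites fix generators. *)
have [rho rH [pE sE]] := Cuniv _ _ _ (covariant_labelled cov).
have [pi' [t' [cov' pE' tE']]] := labelled_covariant lab.
have [sigma sH [piE tE]] := Ouniv _ _ _ cov'.
exists sigma => //; exists rho => x.
  have [rep _] := cov; have [rep' _] := cov'.
  (* [rho] carries the pair [pi'], [t'] back to [pi], [t], as the two representations agree on every
     [chi B] and [delta a]. *)
  have [||piK tK] := corr_rep_eq (corr_rep_hom rH rep') rep.
  - by move=> B /=; rewrite pE' (congr1 (@^~ B) pE).
  - by move=> a /=; rewrite tE' (congr1 (@^~ a) sE).
  have : cstar_gen (range pi `|` range t) x by rewrite Ogen.
  apply: (star_hom_eq_gen (star_hom_comp rH sH) (g := id)) => // _ [[f _ <-]|[y _ <-]] /=.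
    by rewrite -[sigma (pi f)]/((sigma \o pi) f) -piE -[in RHS]piK.
  by rewrite -[sigma (t y)]/((sigma \o t) y) -tE -[in RHS]tK.
have : cstar_gen (range p `|` range s) x by rewrite Cgen.
apply: (star_hom_eq_gen (star_hom_comp sH rH) (g := id)) => // _ [[B _ <-]|[a _ <-]] /=.
  by rewrite -[rho (p B)]/((rho \o p) B) -pE -[sigma _]/((sigma \o pi) (chi R B)) -piE pE'.
by rewrite -[rho (s a)]/((rho \o s) a) -sE -[sigma _]/((sigma \o t) (delta R S a)) -tE tE'.
Qed.
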